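(* Let $\mathsf{k}$ be a local field, $n\ge 2$, $G=\mathrm{GL}_n(\mathsf{k})$, and let $\sigma=\sigma_1\otimes\cdots\otimes\sigma_n$ be a character of the diagonal torus $A$ of $G$, with $|\sigma_i|=|\cdot|_{\mathsf{k}}^{\nu_i}$, $\nu_i\in\mathbb{R}$. Assume that $$\max\{\nu_1,\nu_2\}<\nu_3<\cdots<\nu_{n-1}<\nu_n\quad\text{and}\quad \nu_1<\nu_2+1.$$ Let $\Omega_\sigma=\{s\in\mathbb{C}\mid -\nu_2<\mathrm{Re}(s)<1-\nu_1\}$. Then for all $s\in\Omega_\sigma$, the integral $$\Lambda_s(f)=\int_R f(w_1g)\,\psi_s^{-1}(g)\,\mathrm{d}_{\mathrm r}g$$ converges absolutely for all $f\in I(\sigma)$. Moreover, the map $$\Omega_\sigma\times I(\sigma)\to\mathbb{C},\qquad (s,f)\mapsto\Lambda_s(f)$$ is continuous, holomorphic in the first variable, and linear in the second variable.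
   Context: $\mathsf{k}$ is an arbitrary local field (archimedean or not), $|\cdot|_{\mathsf{k}}$ its normalized absolute value (the square of the usual one if $\mathsf{k}\cong\mathbb{C}$). A character is a continuous homomorphism to $\mathbb{C}^\times$. Fix a non-trivial unitary character $\psi:\mathsf{k}\to\mathbb{C}^\times$ and equip $\mathsf{k}$ with the self-dual Haar measure $\mathrm{d}x$ associated to $\psi$; put $\mathrm{d}^\times a=|a|_{\mathsf{k}}^{-1}\mathrm{d}a$ on $\mathsf{k}^\times$. $A$ is the group of diagonal matrices in $G$, $N$ (resp. $\bar N$) the upper (resp. lower) triangular unipotent matrices, $\bar B=A\bar N$. $\psi_N:N\to\mathbb{C}^\times$ is $[u_{i,j}]\mapsto\psi(\sum_{i=1}^{n-1}u_{i,i+1})$. $R$ is the subgroup of $G$ of all matrices $\begin{bmatrix}a&u\\0&h\end{bmatrix}$ with $a\in\mathsf{k}^\times$, $h$ an upper triangular unipotent matrix of size $n-1$, and $u$ a row vector whose first entry is $0$. Put $N'=R\cap N$, $[a]=\mathrm{diag}(a,1,\dots,1)$ for $a\in\mathsf{k}^\times$, $A'=R\cap A=\{[a]\mid a\in\mathsf{k}^\times\}$, so $R=A'N'=N'A'$. The measure on $R$ is $\mathrm{d}_{\mathrm r}g=\prod_{1\le i<j\le n,\,j\ne2}\mathrm{d}g_{i,j}\cdot\mathrm{d}^\times g_{1,1}$ for $g=[g_{i,j}]\in R$. For $s\in\mathbb{C}$, $\psi_s:R\to\mathbb{C}^\times$ is the character $u'\cdot[a]\mapsto\psi_N(u')|a|_{\mathsf{k}}^{\frac{n-1}{2}-s}$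 ($u'\in N'$, $a\in\mathsf{k}^\times$). $w_1=\mathrm{diag}\left(\begin{bmatrix}1&1\\0&1\end{bmatrix},1,\dots,1\right)\in G$. The character $\sigma$ (where each $\sigma_i$ is a character of $\mathsf{k}^\times$) is extended to $\bar B$ trivially on $\bar N$. Let $\bar\rho=|\cdot|_{\mathsf{k}}^{\frac{1-n}{2}}\otimes|\cdot|_{\mathsf{k}}^{\frac{3-n}{2}}\otimes\cdots\otimes|\cdot|_{\mathsf{k}}^{\frac{n-1}{2}}$, a character of $A$, also extended trivially to $\bar B$. $I(\sigma)=\mathrm{Ind}_{\bar B}^G\sigma$ is the space of smooth functions $f:G\to\mathbb{C}$ with $f(\bar bg)=\sigma(\bar b)\bar\rho(\bar b)f(g)$ for all $\bar b\in\bar B$, $g\in G$ (smooth in the non-archimedean case means invariant under right translation by some open subgroup), with $G$ acting by right translations. In the non-archimedean case $I(\sigma)$ carries the finest locally convex topology (all seminorms are continuous); in the archimedean case it is a Fréchet space under the smooth topology. When $n=2$, the first chain of inequalities in the hypothesis is empty (only $\nu_1<\nu_2+1$ is required). *)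

(* Defs.v *)
From HB Require Import structures.
From mathcomp Require Import all_boot all_order all_algebra.
From mathcomp Require Import all_classical all_reals all_analysis.
From mathcomp Require Import complex.

Set Implicit Arguments.
Unset Strict Implicit.
Unset Printing Implicit Defensive.

Import Order.TTheory GRing.Theory Num.Theory.
Import numFieldNormedType.Exports.

Local Open Scope classical_set_scope.
Local Open Scope ring_scope.

(* [complex R] itself carries no topology in the library; the usual topology of
   the complex plane is that of the regular module [(complex R)^o]. *)
Notation cplx R := ((complex R)^o).

(* Local fields: non-discrete locally compact Hausdorff topological fields. *)
HB.mixin Record isLocalField K & TopologicalZmodule K & GRing.Field K := {
  lf_mul_continuous : continuous (fun x : K * K => x.1 * x.2) ;
  lf_inv_continuous : forall x : K, x != 0 -> {for x, continuous (@GRing.inv K)} ;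
  lf_hausdorff : hausdorff_space K ;
  lf_locally_compact : locally_compact [set: K] ;
  lf_nondiscrete : ~ open [set (0 : K)] }.

#[short(type="localFieldType")]
HB.structure Definition LocalField :=
  {K of TopologicalZmodule K & GRing.Field K & isLocalField K}.

(* The library's generated sigma-algebras ask for a base point. *)
Definition based (K : localFieldType) : Type := K.
HB.instance Definition _ (K : localFieldType) := Choice.on (based K).
HB.instance Definition _ (K : localFieldType) := isPointed.Build (based K) 0.

Definition borel (K : localFieldType) :=
  g_sigma_algebraType (@open K : set (set (based K))).
HB.instance Definition _ (K : localFieldType) := Measurable.on (borel K).

Section LocalFields.
Context (R : realType) (K : localFieldType).
Implicit Types (x y : K).

Definition homeomorphic_map (S T : topologicalType) (phi : S -> T) : Prop :=
  exists phi' : T -> S,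
    [/\ cancel phi phi', cancel phi' phi, continuous phi & continuous phi'].

Definition archimedean_field : Prop :=
  (exists phi : {rmorphism R -> K}, homeomorphic_map phi) \/
  (exists phi : {rmorphism cplx R -> K}, homeomorphic_map phi).

(* [s] lists, without repetition, representatives of the residue field. *)
Definition residue_system (absK : K -> R) (s : seq K) : Prop :=
  [/\ {in s, forall r, absK r <= 1},
      {in s &, forall r r', absK (r - r') < 1 -> r = r'}, uniq s &
      forall x, absK x <= 1 -> exists2 r, r \in s & absK (x - r) < 1].

Definition nonarchimedean_normalized_absval (absK : K -> R) : Prop :=
  [/\ absK 0 = 0 /\ (forall x, x != 0 -> 0 < absK x),
      {morph absK : x y / x * y},
      (forall x y, absK (x + y) <= Num.max (absK x) (absK y)),
      (forall x (U : set K), nbhs x U <->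
         exists2 e : R, 0 < e & forall y, absK (y - x) < e -> U y) &
      exists (pi : K) (s : seq K),
        [/\ 0 < absK pi < 1, (forall x, absK x < 1 -> absK x <= absK pi),
            residue_system absK s & absK pi = (size s)%:R^-1]].

Definition normalized_absval (absK : K -> R) : Prop :=
  [\/ exists2 phi : {rmorphism R -> K},
        homeomorphic_map phi & forall t, absK (phi t) = `|t|,
      exists2 phi : {rmorphism cplx R -> K},
        homeomorphic_map phi & forall z, absK (phi z) = Normc.normc z ^+ 2 |
      nonarchimedean_normalized_absval absK].

Definition nontrivial_unitary_character (psi : K -> cplx R) : Prop :=
  [/\ continuous psi, (forall x y, psi (x + y) = psi x * psi y),
      (forall x, Normc.normc (psi x) = 1) & exists x, psi x != 1].

(* Characters of the multiplicative group; the value at 0 is irrelevant. *)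
Definition mult_character (chi : K -> cplx R) : Prop :=
  [/\ (forall x, x != 0 -> chi x != 0),
      (forall x y, x != 0 -> y != 0 -> chi (x * y) = chi x * chi y) &
      forall x, x != 0 -> {for x, continuous chi}].

End LocalFields.

Section Measures.
Context (R : realType).

Section ComplexIntegral.
Context d (T : measurableType d) (mu : {measure set T -> \bar R}).

Definition cplx_integrable (D : set T) (f : T -> cplx R) : Prop :=
  [/\ measurable_fun D (fun x => complex.Re (f x)),
      measurable_fun D (fun x => complex.Im (f x)) &
      (\int[mu]_(x in D) (Normc.normc (f x))%:E < +oo)%E].

Definition cintegral (D : set T) (f : T -> cplx R) : cplx R :=
  Complex (\int[mu]_(x in D) complex.Re (f x)) (\int[mu]_(x in D) complex.Im (f x)).

End ComplexIntegral.

Section PowerMeasure.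
Context d (T : measurableType d) (mu : {sigma_finite_measure set T -> \bar R}).

Definition tcons m (p : T * m.-tuple T) : m.+1.-tuple T := cons_tuple p.1 p.2.

Lemma measurable_tcons m : measurable_fun [set: T * m.-tuple T] (@tcons m).
Proof. by apply: measurable_cons. Qed.

Section Step.
Context m (nu : {sigma_finite_measure set (m.-tuple T) -> \bar R}).

Definition cons_measure : set (m.+1.-tuple T) -> \bar R :=
  pushforward (mu \x nu)%E (@tcons m).

Let pre_measurable A : measurable A -> measurable (@tcons m @^-1` A).
Proof. by move=> mA; rewrite -[X in measurable X]setTI; exact: measurable_tcons. Qed.

Let cons_measure0 : cons_measure set0 = 0%E.
Proof. by rewrite /cons_measure /pushforward preimage_set0 measure0. Qed.

Let cons_measure_ge0 A : (0 <= cons_measure A)%E.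
Proof. by rewrite /cons_measure /pushforward measure_ge0. Qed.

Let cons_measure_sigma_additive : semi_sigma_additive cons_measure.
Proof.
move=> F mF tF mUF; rewrite /cons_measure /pushforward preimage_bigcup.
apply: measure_semi_sigma_additive.
- by move=> i; exact: pre_measurable.
- apply/trivIsetP => /= i j _ _ ij; rewrite -preimage_setI.
  by move/trivIsetP : tF => /(_ _ _ _ _ ij) ->//; rewrite preimage_set0.
- by rewrite -preimage_bigcup; exact: pre_measurable.
Qed.

HB.instance Definition _ := isMeasure.Build _ _ _ cons_measure
  cons_measure0 cons_measure_ge0 cons_measure_sigma_additive.

Let cons_measure_sigma_finite : sigma_finite setT cons_measure.
Proof.
have /sigma_finiteP[F0 [F0T ndF F0oo]] := sigma_finiteT mu.
have /sigma_finiteP[G0 [G0T ndG G0oo]] := sigma_finiteT nu.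
pose F i : set (T * m.-tuple T) := F0 i `*` G0 i.
have FT : [set: T * m.-tuple T] = \bigcup_i F i.
  rewrite -setXTT F0T G0T predeqE => -[x y]; split.
    move=> [/= [i _ Fix] [k _ Gky]]; exists (maxn i k) => //; split.
    - by move: x Fix; exact/subsetPset/ndF/leq_maxl.
    - by move: y Gky; exact/subsetPset/ndG/leq_maxr.
  by move=> [i _ []/= ? ?]; split; exists i.
have Foo i : measurable (F i) /\ ((mu \x nu) (F i) < +oo)%E.
  have [? ?] := F0oo i; have [? ?] := G0oo i.
  split; first exact: measurableX.
  by rewrite product_measure1E// lte_mul_pinfty// ge0_fin_numE.
pose uncons (x : m.+1.-tuple T) : T * m.-tuple T := (thead x, [tuple of behead x]).
have unconsK : cancel uncons (@tcons m).
  by move=> x; apply/val_inj; rewrite /= [in RHS](tuple_eta x).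
have tconsK : cancel (@tcons m) uncons.
  by move=> [a x]; rewrite /uncons theadE; congr pair; exact/val_inj.
exists (fun i => uncons @^-1` F i).
  by rewrite -preimage_bigcup -FT preimage_setT.
move=> i; have [mF Fi] := Foo i; split.
  rewrite -[X in measurable X]setTI.
  have : measurable_fun [set: m.+1.-tuple T] uncons.
    apply/measurable_fun_pairP; split; last exact: measurable_behead.
    exact: (@measurable_tnth _ T m.+1 ord0).
  by apply.
rewrite /cons_measure /pushforward.
rewrite (_ : _ @^-1` _ = F i)//; apply/seteqP; split => p /=; by rewrite tconsK.
Qed.

HB.instance Definition _ := Measure_isSigmaFinite.Build _ _ _ cons_measure
  cons_measure_sigma_finite.

End Step.

Fixpoint power_measure m : {sigma_finite_measure set (m.-tuple T) -> \bar R} :=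
  match m with
  | 0 => [the {sigma_finite_measure set (0.-tuple T) -> \bar R} of
            dirac [tuple]]
  | m.+1 => [the {sigma_finite_measure set (m.+1.-tuple T) -> \bar R} of
            cons_measure (power_measure m)]
  end.

End PowerMeasure.
End Measures.

Section ComplexLimits.
Context (R : realType).
Local Notation C := (cplx R).

Lemma cplx_cvg_lin (T : Type) (F : set_system T) {FF : Filter F} (a : C)
    (f h : T -> C) (x y : C) :
  f @ F --> x -> h @ F --> y -> (fun t => a * f t + h t) @ F --> a * x + y.
Proof.
move=> fx hy; exact: (@cvgD (complex R) C _ F FF (fun t => a *: f t) h _ _
  (@cvgZr (complex R) C _ F FF a f x fx) hy).
Qed.

Lemma cplx_cvg_lim (T : Type) (F : set_system T) {FF : ProperFilter F}
    (f : T -> C) (x : C) : f @ F --> x -> lim (f @ F) = x.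
Proof. by apply: cvg_lim; exact: (@norm_hausdorff (complex R) C). Qed.

End ComplexLimits.

Section SelfDual.
Context (R : realType) (K : localFieldType).
Context (mu : {sigma_finite_measure set (borel K) -> \bar R}).

Definition haar_measure : Prop :=
  [/\ forall (x : K) (A : set K), measurable (A : set (borel K)) ->
        mu [set x + y | y in A] = mu A,
      forall A : set K, compact A -> (mu A < +oo)%E &
      forall U : set K, open U -> U !=set0 -> (0 < mu U)%E].

Definition fourier (psi : K -> cplx R) (f : K -> cplx R) (y : K) : cplx R :=
  cintegral mu [set: borel K] (fun x : borel K => f x * psi ((x : K) * y)).

Definition self_dual_haar_measure (psi : K -> cplx R) : Prop :=
  haar_measure /\
  forall f : K -> cplx R, continuous f ->
    cplx_integrable mu [set: borel K] f ->
    cplx_integrable mu [set: borel K] (fourier psi f) ->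
    forall x, fourier psi (fourier psi f) x = f (- x).

End SelfDual.

(* Functions on GL_n(K) are encoded as functions on all matrices that vanish on
   the non-invertible ones. *)
Section Smooth.
Context (R : realType) (K : localFieldType) (n : nat).
Local Notation C := (cplx R).
Local Notation M := 'M[K]_n.
Implicit Types (f : M -> C) (g v : M).

Section DirectionalDerivatives.
Context (iota : R -> K).

Definition diff_quotient v f g (t : R) : C :=
  (t^-1)%:C%C * (f (g + iota t *: v) - f g).

Definition dir_derive v f g : C :=
  if g \in unitmx then lim (diff_quotient v f g @ 0^') else 0.

Definition iter_derive (vs : seq M) f : M -> C := foldr dir_derive f vs.

Definition smooth_along f : Prop :=
  forall (vs : seq M) g, g \in unitmx ->
    {for g, continuous (iter_derive vs f)} /\
    forall v, cvg (diff_quotient v (iter_derive vs f) g @ 0^').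

Lemma diff_quotient_lin v (a : C) f f' g : diff_quotient v (a *: f + f') g =
  (fun t => a * diff_quotient v f g t + diff_quotient v f' g t).
Proof.
apply/funext => t; rewrite /diff_quotient !fctE /=.
rewrite -![a *: _]/(a * _) opprD addrACA -mulrBr mulrDr.
by congr (_ + _); rewrite mulrCA.
Qed.

Lemma cvg_diff_quotient_lin v (a : C) f f' g :
  cvg (diff_quotient v f g @ 0^') -> cvg (diff_quotient v f' g @ 0^') ->
  diff_quotient v (a *: f + f') g @ 0^' -->
    a * lim (diff_quotient v f g @ 0^') + lim (diff_quotient v f' g @ 0^').
Proof.
move=> cf cf'; rewrite diff_quotient_lin.
exact: (@cplx_cvg_lin R _ _ _ a (diff_quotient v f g) (diff_quotient v f' g)
  _ _ cf cf').
Qed.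

Lemma iter_derive_lin vs (a : C) f f' : smooth_along f -> smooth_along f' ->
  iter_derive vs (a *: f + f') = a *: iter_derive vs f + iter_derive vs f'.
Proof.
move=> sf sf'; elim: vs => [//|v vs IH] /=; rewrite -!/(iter_derive _ _) IH.
apply/funext => g; rewrite /dir_derive !fctE; case: ifPn => gu; last first.
  by rewrite addr0 -[RHS]/(a * 0) mulr0.
apply: cplx_cvg_lim; apply: cvg_diff_quotient_lin.
- by have [_] := sf vs g gu; apply.
- by have [_] := sf' vs g gu; apply.
Qed.

Lemma smooth_along_lin (a : C) f f' : smooth_along f -> smooth_along f' ->
  smooth_along (a *: f + f').
Proof.
move=> sf sf' vs g gu; rewrite (iter_derive_lin vs a sf sf').
have [cf df] := sf vs g gu; have [cf' df'] := sf' vs g gu.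
split => [|v].
  exact: (@cplx_cvg_lin R M (nbhs g) _ a (iter_derive vs f) (iter_derive vs f')
    _ _ cf cf').
exact: (@cvgP C _ _ (@cvg_diff_quotient_lin _ a _ _ _ (df v) (df' v))).
Qed.

Lemma smooth_along0 : smooth_along 0.
Proof.
have dq0 v g : diff_quotient v 0 g = cst 0.
  by apply/funext => t; rewrite /diff_quotient !fctE subrr mulr0.
have it0 vs : iter_derive vs 0 = 0 :> (M -> C).
  elim: vs => [//|v vs IH] /=; rewrite -!/(iter_derive _ _) IH.
  apply/funext => g; rewrite /dir_derive dq0; case: ifP => // _.
  by apply: cplx_cvg_lim; exact: cvg_cst.
move=> vs g gu; rewrite it0; split; first exact: cst_continuous.
by move=> v; rewrite dq0; exact: is_cvg_cst.
Qed.

End DirectionalDerivatives.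

(* [iota] is the embedding of the real numbers into an archimedean local field;
   it is the only continuous ring morphism from [R] to [K]. *)
Definition smooth_archimedean f : Prop :=
  forall iota : {rmorphism R -> K}, continuous iota -> smooth_along iota f.

Definition open_subgroup (U : set M) : Prop :=
  [/\ open U, (forall x, U x -> x \in unitmx), U 1%:M,
      (forall x y, U x -> U y -> U (x *m y)) & (forall x, U x -> U (invmx x))].

Definition smooth_nonarchimedean f : Prop :=
  exists2 U, open_subgroup U & forall u g, U u -> g \in unitmx -> f (g *m u) = f g.

Definition smooth f : Prop :=
  if `[< archimedean_field R K >] then smooth_archimedean f
  else smooth_nonarchimedean f.

Lemma open_unitmx : open [set x : M | x \in unitmx].
Proof.
have coord i j : continuous (fun x : M => x i j).
  move=> x U /= Ux; exists (fun i' j' => if (i' == i) && (j' == j) then U else setT).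
    by move=> i' j'; case: ifPn => [/andP[/eqP -> /eqP ->]//|_]; exact: filterT.
  by move=> y /(_ i j); rewrite !eqxx.
have cadd (h h' : M -> K) : continuous h -> continuous h' ->
    continuous (fun x => h x + h' x).
  move=> ch ch' x.
  exact: (cvg_comp2 (ch x) (ch' x) (add_continuous (h x, h' x))).
have cmul (h h' : M -> K) : continuous h -> continuous h' ->
    continuous (fun x => h x * h' x).
  move=> ch ch' x.
  exact: (cvg_comp2 (ch x) (ch' x) (lf_mul_continuous (h x, h' x))).
have csum I (r : seq I) (F : I -> M -> K) : (forall i, continuous (F i)) ->
    continuous (fun x => \sum_(i <- r) F i x).
  move=> cF; elim: r => [|i r IH].
    by under eq_fun do rewrite big_nil; exact: cst_continuous.
  by under eq_fun do rewrite big_cons; apply: cadd.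
have cprod I (r : seq I) (F : I -> M -> K) : (forall i, continuous (F i)) ->
    continuous (fun x => \prod_(i <- r) F i x).
  move=> cF; elim: r => [|i r IH].
    by under eq_fun do rewrite big_nil; exact: cst_continuous.
  by under eq_fun do rewrite big_cons; apply: cmul.
have cdet : continuous (fun x : M => \det x).
  apply: csum => s; apply: cmul; first exact: cst_continuous.
  by apply: cprod => i; exact: coord.
have op0 : open [set x : K | x != 0].
  rewrite (_ : [set x : K | x != 0] = ~` [set 0]); last first.
    by apply/seteqP; split => x /= /eqP.
  rewrite openC; apply: accessible_closed_set1; apply: hausdorff_accessible.
  exact: lf_hausdorff.
rewrite (_ : [set _ | _] = (fun x : M => \det x) @^-1` [set x : K | x != 0]).
  by apply: open_comp => // x _; exact: cdet.
by apply/seteqP; split => x /=; rewrite unitmxE unitfE.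
Qed.

Lemma smooth0 : smooth 0.
Proof.
rewrite /smooth; case: ifP => _; first by move=> iota _; exact: smooth_along0.
exists (fun x => x \in unitmx) => //; split => //.
- exact: open_unitmx.
- exact: unitmx1.
- by move=> x y ux uy; rewrite /= unitmx_mul ux.
- by move=> x ux; rewrite /= unitmx_inv.
Qed.

Lemma smooth_lin (a : C) f f' : smooth f -> smooth f' -> smooth (a *: f + f').
Proof.
rewrite /smooth; case: ifP => _.
  by move=> sf sf' iota ci; apply: smooth_along_lin; [exact: sf|exact: sf'].
move=> [U [oU uU U1 UM UV] Uf] [U' [oU' uU' U'1 U'M U'V] U'f].
exists (U `&` U').
  split.
  - exact: openI.
  - by move=> x [/uU].
  - by [].
  - by move=> x y [? ?] [? ?]; split; [exact: UM|exact: U'M].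
  - by move=> x [? ?]; split; [exact: UV|exact: U'V].
by move=> u g [Uu U'u] gu; rewrite !fctE Uf// U'f.
Qed.

End Smooth.

Section Induced.
Context (R : realType) (K : localFieldType) (absK : K -> R) (n : nat).
Context (sigma : 'I_n -> K -> cplx R).
Local Notation C := (cplx R).
Local Notation M := 'M[K]_n.
Implicit Types (f : M -> C) (g b : M).

(* [is_trig_mx] singles out the lower triangular matrices. *)
Definition sigma_Bbar b : C := \prod_i sigma i (b i i).

(* With rows numbered from 0, the i-th exponent is (2 i + 1 - n) / 2. *)
Definition rho_Bbar b : C :=
  (\prod_i absK (b i i) `^ (((2 * i + 1)%:R - n%:R) / 2))%:C%C.

Definition in_induced f : Prop :=
  [/\ smooth f, (forall g, g \notin unitmx -> f g = 0) &
      forall b g, is_trig_mx b -> b \in unitmx -> g \in unitmx ->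
        f (b *m g) = sigma_Bbar b * rho_Bbar b * f g].

Definition induced_pred : {pred M -> C} := fun f => `[< in_induced f >].

Lemma induced_submod_closed : GRing.submod_closed induced_pred.
Proof.
split.
  apply/asboolP; split => //; first exact: smooth0.
  by move=> b g _ _ _; exact/esym/mulr0.
move=> a f f' /asboolP[sf f0 fb] /asboolP[sf' f'0 f'b]; apply/asboolP; split.
- exact: smooth_lin.
- by move=> g gu; rewrite !fctE f0// f'0// addr0 scaler0.
- move=> b g tb bu gu; rewrite !fctE fb// f'b// mulrDr.
  by rewrite -![a *: _]/(a * _) mulrCA.
Qed.

HB.instance Definition _ :=
  GRing.isSubmodClosed.Build (complex R) (M -> C) induced_pred induced_submod_closed.

Record induced_rep := Induced {
  induced_fun :> M -> C ;
  induced_funP : induced_fun \in induced_pred }.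

HB.instance Definition _ := [isSub for induced_fun].
HB.instance Definition _ := [Choice of induced_rep by <:].
HB.instance Definition _ := [SubChoice_isSubLmodule of induced_rep by <:].

Definition seminorm (p : induced_rep -> R) : Prop :=
  (forall f h : induced_rep, p (f + h) <= p f + p h) /\
  (forall (a : complex R) (f : induced_rep), p (a *: f) = Normc.normc a * p f).

(* Uniform convergence on compact subsets of the group of all derivatives. *)
Definition smooth_seminorm (p : induced_rep -> R) : Prop :=
  exists iota : {rmorphism R -> K}, exists (vs : seq M) (Q : set M),
    [/\ continuous iota, compact Q, (forall g, Q g -> g \in unitmx) &
      p = (fun f : induced_rep => sup [set Normc.normc (iter_derive iota vs f g) | g in Q])].

Definition defining_seminorm (p : induced_rep -> R) : Prop :=
  if `[< archimedean_field R K >] then smooth_seminorm p else seminorm p.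

(* The locally convex topology generated by the defining seminorms; for
   non-archimedean K this is the finest locally convex topology. *)
Definition open_induced (U : set induced_rep) : Prop :=
  forall f : induced_rep, U f -> exists (m : nat) (p : 'I_m -> induced_rep -> R) (e : R),
    [/\ 0 < e, (forall i, defining_seminorm (p i)) &
        forall h : induced_rep, (forall i, p i (h - f) < e) -> U h].

Let open_inducedT : open_induced setT.
Proof. by move=> f _; exists 0%N, (fun=> cst 0), 1; split => // -[]. Qed.

Let open_inducedI : setI_closed open_induced.
Proof.
move=> U V oU oV f [Uf Vf].
have [m [p [e [e0 dp pU]]]] := oU f Uf.
have [m' [p' [e' [e'0 dp' pV]]]] := oV f Vf.
exists (m + m')%N, (fun i => match fintype.split i with inl j => p j | inr j => p' j end).
exists (Num.min e e'); split.
- by rewrite lt_min e0.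
- by move=> i; case: fintype.splitP.
- move=> h ph; split; [apply: pU => i|apply: pV => i].
    have := ph (lshift m' i); rewrite lt_min.
    by rewrite (unsplitK (inl i)) => /andP[].
  have := ph (rshift m i); rewrite lt_min.
  by rewrite (unsplitK (inr i)) => /andP[].
Qed.

Let open_induced_bigU (I : Type) (U : I -> set induced_rep) :
  (forall i, open_induced (U i)) -> open_induced (\bigcup_i U i).
Proof.
move=> oU f [i _ Uf]; have [m [p [e [e0 dp pU]]]] := oU i f Uf.
by exists m, p, e; split => // h ph; exists i => //; exact: pU.
Qed.

HB.instance Definition _ := isOpenTopological.Build induced_rep
  open_inducedT open_inducedI open_induced_bigU.

End Induced.

Section RightIntegral.
Context (R : realType) (K : localFieldType) (absK : K -> R) (psi : K -> cplx R).
Context (mu : {sigma_finite_measure set (borel K) -> \bar R}).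
Context (n : nat) (hn : (2 <= n)%N).
Local Notation C := (cplx R).
Local Notation M := 'M[K]_n.

(* The complex power of a positive real number. *)
Definition cpow (r : R) (z : C) : C :=
  Complex (r `^ complex.Re z * cos (complex.Im z * ln r))
          (r `^ complex.Re z * sin (complex.Im z * ln r)).

Definition idx1 : 'I_n := Ordinal (ltnW hn).
Definition idx2 : 'I_n := Ordinal hn.

Definition psi_N (u : M) : C :=
  psi (\sum_(i < n) \sum_(j < n | j == i.+1 :> nat) u i j).

Definition diag1 (a : K) : M := diag_mx (\row_j if j == idx1 then a else 1).

Definition w1 : M :=
  \matrix_(i, j) ((i == j) || (i == idx1) && (j == idx2))%:R.

Definition in_R (g : M) : Prop :=
  [/\ g idx1 idx1 != 0, g idx1 idx2 = 0,
      (forall i, i != idx1 -> g i i = 1) &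
      forall i j : 'I_n, (j < i)%N -> g i j = 0].

Definition psi_s (s : C) (g : M) : C :=
  let a := g idx1 idx1 in
  psi_N (g *m invmx (diag1 a)) * cpow (absK a) ((n%:R - 1) / 2 - s).

(* The free entries of an element of R, besides the one at [(idx1, idx1)]. *)
Definition R_coords : {set 'I_n * 'I_n} :=
  [set p : 'I_n * 'I_n | (p.1 < p.2)%N & p.2 != idx2].

Definition R_elt (a : K) (x : #|R_coords|.-tuple K) : M :=
  \matrix_(i, j)
    if i == j then (if i == idx1 then a else 1)
    else nth 0 x (index (i, j) (enum R_coords)).

Lemma in_R_eltP (g : M) : in_R g <-> exists2 a, a != 0 & exists x, g = R_elt a x.
Proof.
have szE : size (enum R_coords) = #|R_coords| by rewrite -cardE.
split=> [[ga g12 g1 g0]|[a a0 [x ->]]].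
  exists (g idx1 idx1) => //.
  have szt : size [seq g p.1 p.2 | p <- enum R_coords] == #|R_coords|.
    by rewrite size_map szE.
  exists (Tuple szt); apply/matrixP => i j; rewrite mxE.
  case: eqVneq => [<-|ij]; first by case: eqVneq => [->//|/g1].
  have [ijR|ijR] := boolP ((i, j) \in R_coords).
    rewrite (nth_map (i, j)) ?index_mem ?mem_enum//.
    by rewrite nth_index ?mem_enum.
  rewrite memNindex ?mem_enum// nth_default ?size_map//.
  move: ijR; rewrite inE /= negb_and negbK -leqNgt => /orP[ji|/eqP j2].
    by apply: g0; rewrite ltn_neqAle ji andbT eq_sym.
  subst j; have [i0|i0] := posnP i.
    by rewrite -[RHS]g12; congr (g _ _); exact/val_inj.
  apply: g0; rewrite ltn_neqAle i0 andbT.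
  by apply: contraNneq ij => /val_inj ->.
have off i j : i != j -> (i, j) \notin R_coords -> R_elt a x i j = 0.
  move=> ij ijR; rewrite mxE (negbTE ij) memNindex ?mem_enum//.
  by rewrite nth_default// size_tuple szE.
split.
- by rewrite mxE !eqxx.
- by rewrite off// inE eqxx andbF.
- by move=> i i1; rewrite mxE eqxx (negbTE i1).
- move=> i j ji; rewrite off//; first by rewrite neq_ltn ji orbT.
  by rewrite inE /= ltnNge (ltnW ji).
Qed.

(* R is parametrized by its entries; the factor [absK a ^-1] is the density of
   the multiplicative Haar measure with respect to [mu]. *)
Definition R_measure := (mu \x power_measure mu #|R_coords|)%E.

Definition R_domain : set (borel K * #|R_coords|.-tuple (borel K)) :=
  [set p | (p.1 : K) != 0].

Definition Lambda_integrand (s : C) (f : M -> C)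
    (p : borel K * #|R_coords|.-tuple (borel K)) : C :=
  let g := R_elt p.1 p.2 in
  f (w1 *m g) * (psi_s s g)^-1 * ((absK p.1)^-1)%:C%C.

Definition Lambda (s : C) (f : M -> C) : C :=
  cintegral R_measure R_domain (Lambda_integrand s f).

End RightIntegral.

Arguments R_measure {R K} mu {n} hn.
Arguments R_domain {K n} hn.
Arguments Lambda_integrand {R K} absK psi {n} hn s f p.
Arguments Lambda {R K} absK psi mu {n} hn s f.

(* Main.v *)
From HB Require Import structures.
Require Import Defs.
From mathcomp Require Import all_boot all_order all_algebra.
From mathcomp Require Import all_classical all_reals all_analysis.
From mathcomp Require Import perm complex measurable_realfun ring lra.

(** The theorem is a convergence estimate for an integral of a function [f] of the
    induced representation, followed by an analysis of a Mellin transform.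

    Since [f] transforms on the left by a character of the lower triangular
    group, it is natural to bound [f] at [w1 * g] by the factorization of [w1 * g]
    as a lower triangular matrix times an element of a compact set [Q]: then
    [|f (w1 * g)|] is at most the supremum of [|f|] on [Q] times a product of
    powers of the diagonal entries of the triangular factor. To treat all local
    fields at once, the factorization is not the Iwasawa decomposition but column
    elimination with pivoting ([stage_factor], [stage_lower]): each step divides
    by the larger of two entries, so the operations stay in a compact set.

    The elimination runs through the columns from left to right and through each
    column from top to bottom, so that the operations before a given entry do not
    depend on it. As a function of this entry [y], the step multiplies one
    diagonal entry and divides another one by [max 1 |u * y + b|], up to scaling
    ([stage_entry_affine]). The integral over [y] therefore converges as soon as
    the gap between the two exponents is less than [-1], and produces a Jacobian
    that shifts the exponents by one ([integral_stage]). The entries are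
    integrated out in the reverse order; each gap met on the way is
    [nu i - nu j - 1] ([stage_exponent_gap]), which is less than [-1] by the chain
    of inequalities between the exponents. The matrix [w1] only shears the first
    row and is removed by translations ([integral_sheared]). What remains is an
    integral in [a] of [|a| ^ e * (max 1 |a|^-1) ^ e'], convergent at [0] and at
    infinity exactly on the strip ([integral_powR_lty]).

    The estimates rest on the invariance of the Haar measure and on the linear
    growth of the measure of balls ([haar_ball_le]). The latter follows from a
    self-similar tile: a set whose dilate by some [c] is a disjoint union of
    [|c|] translates. The tiles also show that open sets of matrices are countable
    unions of boxes, which gives measurability ([measurable_continuous_mxR]).

    This bounds the functional by a continuous seminorm of [f], locally uniformly
    in [s] ([amplitude_integral_bound], [Lambda_bound]). For fixed [f] the
    functional is the Mellin transform of a function whose moments are finite on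
    an open strip, and a second-order Taylor estimate for complex powers gives its
    derivative ([mellin_second_order]). Joint continuity combines the two. *)

Set Implicit Arguments.
Unset Strict Implicit.
Unset Printing Implicit Defensive.

Import Order.TTheory GRing.Theory Num.Theory.
Import numFieldNormedType.Exports.

Local Open Scope classical_set_scope.
Local Open Scope ring_scope.

(** * Integrals over powers of a measure *)
Lemma ge0_integral_image (R : realType) d1 d2 (X : measurableType d1)
    (Y : measurableType d2) (phi : X -> Y) (m1 : {measure set X -> \bar R})
    (m2 : {measure set Y -> \bar R}) (f : Y -> \bar R) :
  measurable_fun setT phi -> (forall A, measurable A -> m2 A = m1 (phi @^-1` A)) ->
  measurable_fun setT f -> (forall y, 0 <= f y)%E ->
  (\int[m2]_y f y = \int[m1]_x f (phi x))%E.
Proof.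
move=> mphi m2E mf f0.
pose phi' : {mfun X >-> Y} := HB.pack phi (isMeasurableFun.Build _ _ _ _ _ mphi).
rewrite (eq_measure_integral (pushforward m1 phi')); last by move=> A mA _; exact: m2E.
by rewrite ge0_integral_pushforward.
Qed.

Section PowerMeasureSections.
Context (R : realType) d (T : measurableType d).
Context (mu : {sigma_finite_measure set T -> \bar R}).

Definition upd m (k : 'I_m) (y : T) (x : m.-tuple T) : m.-tuple T :=
  [tuple if i == k then y else tnth x i | i < m].

Lemma tnth_upd m (k : 'I_m) y (x : m.-tuple T) i :
  tnth (upd k y x) i = if i == k then y else tnth x i.
Proof. by rewrite tnth_mktuple. Qed.

Lemma tcons_upd0 m y z (x : m.-tuple T) :
  upd ord0 y (@tcons d T m (z, x)) = @tcons d T m (y, x).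
Proof.
apply: eq_from_tnth => i; rewrite tnth_upd.
case: (unliftP ord0 i) => [j ->|->]; last by rewrite !tnth0.
by rewrite !tnthS.
Qed.

Lemma tcons_updS m (k : 'I_m) y z (x : m.-tuple T) :
  upd (lift ord0 k) y (@tcons d T m (z, x)) = @tcons d T m (z, upd k y x).
Proof.
apply: eq_from_tnth => i; rewrite tnth_upd.
case: (unliftP ord0 i) => [j ->|->] /=; last by rewrite !tnth0.
by rewrite !tnthS tnth_upd.
Qed.

Lemma ge0_integral_power_cons m (F : m.+1.-tuple T -> \bar R) :
  measurable_fun [set: m.+1.-tuple T] F -> (forall x, 0 <= F x)%E ->
  (\int[power_measure mu m.+1]_x F x =
   \int[mu \x power_measure mu m]_p F (@tcons d T m p))%E.
Proof.
move=> mF F0; apply: ge0_integral_image => //; exact: measurable_tcons.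
Qed.

(** Fubini in the [k]-th coordinate alone: coordinates can thus be compared one
    at a time, in any order, without leaving the power measure. *)
Lemma ge0_le_integral_sections m (k : 'I_m) (F G : m.-tuple T -> \bar R) :
  measurable_fun [set: m.-tuple T] F -> measurable_fun [set: m.-tuple T] G ->
  (forall x, 0 <= F x)%E -> (forall x, 0 <= G x)%E ->
  (forall x, \int[mu]_y F (upd k y x) <= \int[mu]_y G (upd k y x))%E ->
  (\int[power_measure mu m]_x F x <= \int[power_measure mu m]_x G x)%E.
Proof.
elim: m k F G => [[]//|m IH] k F G mF mG F0 G0 FG.
rewrite !ge0_integral_power_cons//.
have mc (H : m.+1.-tuple T -> \bar R) : measurable_fun [set: m.+1.-tuple T] H ->
    measurable_fun setT (fun p => H (@tcons d T m p)).
  by move=> mH; apply: (measurableT_comp mH); exact: measurable_tcons.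
case: (unliftP ord0 k) FG => [k' ->|->] FG.
  rewrite !fubini_tonelli1//; [|exact: mc..].
  apply: ge0_le_integral => //.
  - by move=> z _; apply: integral_ge0 => x _; exact: F0.
  - by apply: measurable_fun_fubini_tonelli_F => //; exact: mc.
  - by apply: measurable_fun_fubini_tonelli_F => //; exact: mc.
  move=> z _; apply: (IH k') => //.
  - by apply: (measurableT_comp (mc _ mF)).
  - by apply: (measurableT_comp (mc _ mG)).
  - move=> x; have := FG (@tcons d T m (z, x)).
    by under eq_integral do rewrite tcons_updS;
       under [X in (_ <= X)%E]eq_integral do rewrite tcons_updS.
rewrite !fubini_tonelli2//; [|exact: mc..].
apply: ge0_le_integral => //.
- by move=> z _; apply: integral_ge0 => x _; exact: F0.
- by apply: measurable_fun_fubini_tonelli_G => //; exact: mc.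
- by apply: measurable_fun_fubini_tonelli_G => //; exact: mc.
move=> x _; have := FG (@tcons d T m (point, x)).
by under eq_integral do rewrite tcons_upd0;
   under [X in (_ <= X)%E]eq_integral do rewrite tcons_upd0.
Qed.

Lemma integral_power_prod m (h : T -> R) :
  measurable_fun setT h -> (forall y, 0 <= h y) -> (\int[mu]_y (h y)%:E = 1)%E ->
  (\int[power_measure mu m]_x (\prod_(i < m) h (tnth x i))%:E = 1)%E.
Proof.
move=> mh h0 h1.
have mt m' (i : 'I_m') : measurable_fun [set: m'.-tuple T] (fun x : m'.-tuple T => h (tnth x i)).
  by apply: (measurableT_comp mh); exact: measurable_tnth.
have mp m' : measurable_fun [set: m'.-tuple T]
    (fun x : m'.-tuple T => (\prod_(i < m') h (tnth x i))%:E).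
  by apply/measurable_EFinP; apply: measurable_prod => i _; exact: mt.
have p0 m' (x : m'.-tuple T) : (0 <= (\prod_(i < m') h (tnth x i))%:E)%E.
  by rewrite lee_fin; apply: prodr_ge0 => i _; exact: h0.
elim: m => [|m IH].
  rewrite [LHS](@integral_dirac _ _ [tuple] R setT measurableT _ (mp 0%N)).
  by rewrite diracE mem_set// mul1e big_ord0.
rewrite ge0_integral_power_cons//.
rewrite fubini_tonelli1//; last first.
  by apply: (measurableT_comp (mp _)); exact: measurable_tcons.
rewrite -[RHS]h1; apply: eq_integral => z _.
rewrite /fubini_F.
transitivity (\int[power_measure mu m]_x
    ((h z)%:E * (\prod_(i < m) h (tnth x i))%:E))%E.
  apply: eq_integral => x _; rewrite big_ord_recl tnth0 EFinM.
  by under eq_bigr do rewrite tnthS.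
rewrite ge0_integralZl ?lee_fin//; last exact: mp.
by rewrite -[RHS]mule1; congr (_ * _)%E; exact: IH.
Qed.

End PowerMeasureSections.

(** * The topology of the complex plane *)
Section ComplexPlane.
Context (R : realType).
Implicit Types z w : cplx R.

Lemma normcE z : `|z| = (Normc.normc z)%:C%C.
Proof. by case: z. Qed.

Lemma normc_ge0 z : 0 <= Normc.normc z.
Proof. by case: z => a b /=; exact: sqrtr_ge0. Qed.

Lemma normc_triangle z w : Normc.normc (z + w) <= Normc.normc z + Normc.normc w.
Proof. exact: le_normcD. Qed.

Lemma normc_opp z : Normc.normc (- z) = Normc.normc z.
Proof. exact: normcN. Qed.

Lemma normc_real (r : R) : Normc.normc r%:C%C = `|r|.
Proof. by rewrite /= expr0n addr0 sqrtr_sqr. Qed.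

Lemma sqr_normc z : Normc.normc z ^+ 2 = complex.Re z ^+ 2 + complex.Im z ^+ 2.
Proof. by case: z => a b /=; rewrite sqr_sqrtr// addr_ge0// sqr_ge0. Qed.

Lemma normc_ge_Re z : `|complex.Re z| <= Normc.normc z.
Proof.
case: z => a b /=; rewrite -sqrtr_sqr ler_sqrt ?addr_ge0 ?sqr_ge0//.
by rewrite lerDl sqr_ge0.
Qed.

Lemma normc_ge_Im z : `|complex.Im z| <= Normc.normc z.
Proof.
case: z => a b /=; rewrite -sqrtr_sqr ler_sqrt ?addr_ge0 ?sqr_ge0//.
by rewrite lerDr sqr_ge0.
Qed.

Lemma normc_le_ReIm z : Normc.normc z <= `|complex.Re z| + `|complex.Im z|.
Proof.
case: z => a b /=; rewrite -(@ler_pXn2r _ 2)// ?nnegrE ?sqrtr_ge0 ?addr_ge0//.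
rewrite sqr_sqrtr ?addr_ge0 ?sqr_ge0// sqrrD !real_normK ?num_real//.
by rewrite addrAC lerDl mulrn_wge0// mulr_ge0.
Qed.

Lemma nbhs_cplxP z (U : set (cplx R)) :
  nbhs z U <-> exists2 e : R, 0 < e & forall w, Normc.normc (w - z) < e -> U w.
Proof.
split=> [/nbhs_ballP[e /= e0 zU]|[e e0 zU]].
  move: e0 zU; rewrite ltcE /=; case: e => e i /= /andP[/eqP -> e0] zU.
  exists e => // w wz; apply: zU; rewrite /ball/= distrC normcE.
  by rewrite -[X in _ < X]/(e%:C%C) ltcR.
apply/nbhs_ballP; exists e%:C%C => /=; first by rewrite ltcR.
by move=> w; rewrite /ball/= distrC normcE ltcR; exact: zU.
Qed.

Lemma cvg_cplxP (T : Type) (F : set_system T) {FF : Filter F} (f : T -> cplx R) z :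
  f @ F --> z <-> forall e : R, 0 < e -> F [set t | Normc.normc (f t - z) < e].
Proof.
split=> [fz e e0|H U /nbhs_cplxP[e e0 eU]].
  by apply: (fz [set w | Normc.normc (w - z) < e]); apply/nbhs_cplxP; exists e.
by apply: filterS (H e e0) => t; exact: eU.
Qed.

Lemma continuous_Re : continuous (@complex.Re R : cplx R -> R).
Proof.
move=> z U /nbhs_ballP[e /= e0 zU]; apply/nbhs_cplxP; exists e => // w wz.
apply: zU; rewrite /ball/= distrC (le_lt_trans _ wz)//.
by have := normc_ge_Re (w - z); case: (w) (z) => a b [].
Qed.

Lemma continuous_Im : continuous (@complex.Im R : cplx R -> R).
Proof.
move=> z U /nbhs_ballP[e /= e0 zU]; apply/nbhs_cplxP; exists e => // w wz.
apply: zU; rewrite /ball/= distrC (le_lt_trans _ wz)//.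
by have := normc_ge_Im (w - z); case: (w) (z) => a b [].
Qed.

Lemma continuous_normc : continuous (@Normc.normc R : cplx R -> R).
Proof.
move=> z U /nbhs_ballP[e /= e0 zU]; apply/nbhs_cplxP; exists e => // w wz.
apply: zU; rewrite /ball/= (le_lt_trans _ wz)// ler_norml; apply/andP; split.
  have := normc_triangle z (w - z); rewrite subrKC; lra.
have := normc_triangle w (z - w); rewrite subrKC -(normc_opp (w - z)) opprB; lra.
Qed.

End ComplexPlane.

(** * Self-similar tiles in a local field *)
Section LocalAbsval.
Context (R : realType) (K : localFieldType).

(** One self-similar set [D] serves all local fields: a half-open interval or
    square for the real and complex numbers, the ring of integers otherwise.
    Dilated by [c] it becomes a disjoint union of [v c] translates of itself, so
    translation invariance alone shows that a Haar measure gives the dilate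
    [v c] times the measure of [D]. *)
Record tiling (v : K -> R) (c : K) (D : set K) (S : seq K) : Prop := Tiling {
  tile_abs : v c = (size S)%:R ;
  tile_size : (1 < size S)%N ;
  tile_nbhs : nbhs 0 D ;
  tile_measurable : measurable (D : set (borel K)) ;
  tile_bounded : exists M, forall d d', D d -> D d' -> v (d - d') <= M ;
  tile_split : forall x, D (c^-1 * x) <-> exists2 r, r \in S & D (x - r) ;
  tile_uniq : uniq S ;
  tile_disjoint : forall x r r', r \in S -> r' \in S -> D (x - r) -> D (x - r') -> r = r' }.

(** No triangle inequality is recorded, because it fails for the square of the
    modulus on the complex numbers; the topology and the tiling replace it. *)
Record local_absval (v : K -> R) : Prop := LocalAbsval {
  lav0 : v 0 = 0 ;
  lav_gt0 : forall x, x != 0 -> 0 < v x ;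
  lavM : {morph v : x y / x * y} ;
  lav_continuous : continuous v ;
  lav_nbhs : forall U : set K, nbhs 0 U ->
    exists2 e : R, 0 < e & forall y, v y < e -> U y ;
  lav_tile : exists c D S, tiling v c D S }.

Lemma open_borel (U : set K) : open U -> measurable (U : set (borel K)).
Proof. by move=> oU; exact: sub_sigma_algebra. Qed.

Lemma closed_borel (U : set K) : closed U -> measurable (U : set (borel K)).
Proof.
move=> cU; rewrite -[U]setCK; apply: measurableC; apply: open_borel.
by rewrite openC.
Qed.

Lemma itvco_borel (f : K -> R) (a b : R) : continuous f ->
  measurable ([set x | a <= f x < b] : set (borel K)).
Proof.
move=> cf; rewrite (_ : [set _ | _] =
    (f @^-1` [set t | a <= t]) `&` (f @^-1` [set t | t < b])); last first.
  by apply/seteqP; split => x /=; [move=> /andP[]|move=> [-> ->]].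
apply: (@measurableI _ (borel K)).
  by apply: closed_borel; apply: (closed_comp (fun x _ => cf x)); exact: closed_ge.
by apply: open_borel; apply: (open_comp (fun x _ => cf x)); exact: open_lt.
Qed.

Lemma half_open_unit_split (t : R) :
  (- 2^-1 <= 2^-1 * t < 2^-1) <->
  (- 2^-1 <= t - 2^-1 < 2^-1) \/ (- 2^-1 <= t + 2^-1 < 2^-1).
Proof.
split=> [/andP[? ?]|[] /andP[? ?]].
- by have [?|?] := leP 0 t; [left|right]; apply/andP; split; lra.
- by apply/andP; split; lra.
- by apply/andP; split; lra.
Qed.

(** The tile is a half-open interval of length one around [0], whose double
    consists of its translates by [1/2] and [-1/2]. *)
Lemma real_local_absval (v : K -> R) (phi : {rmorphism R -> K}) :
  homeomorphic_map phi -> (forall t, v (phi t) = `|t|) -> local_absval v.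
Proof.
move=> [psi [phiK psiK cphi cpsi]] vphi.
have vE x : v x = `|psi x| by rewrite -{1}(psiK x) vphi.
have psi0 : psi 0 = 0 by rewrite -[RHS]phiK rmorph0.
have psiM x y : psi (x * y) = psi x * psi y.
  by rewrite -[RHS]phiK rmorphM !psiK.
have psiB x y : psi (x - y) = psi x - psi y.
  by rewrite -[RHS]phiK rmorphB !psiK.
have psi2 : psi (2^-1) = 2^-1.
  by rewrite -[RHS]phiK fmorphV rmorph_nat.
split.
- by rewrite vE psi0 normr0.
- move=> x x0; rewrite vE normr_gt0; apply: contraNneq x0 => px.
  by rewrite -(psiK x) px rmorph0.
- by move=> x y; rewrite !vE psiM normrM.
- rewrite (_ : v = fun x => `|psi x|); last by apply/funext => x; exact: vE.
  move=> x; apply: (continuous_comp (cpsi x)).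
  exact: norm_continuous.
- move=> U; rewrite -(rmorph0 phi) => /cphi /= /nbhs_ballP[e /= e0 eU].
  exists e => // y vy; rewrite -(psiK y); apply: eU.
  by rewrite /ball /= sub0r normrN -vE.
exists 2, [set x | - 2^-1 <= psi x < 2^-1], [:: phi 2^-1; phi (- 2^-1)].
split.
- by rewrite vE -(rmorph_nat phi) phiK normr_nat.
- by [].
- have e0 : 0 < 2^-1 :> R by rewrite invr_gt0.
  suff N : nbhs (psi 0) [set t : R | - 2^-1 <= t < 2^-1] by exact: (cpsi _ _ N).
  rewrite psi0; apply/nbhs_ballP; exists 2^-1 => //= t; rewrite /ball/= sub0r normrN.
  by rewrite ltr_norml => /andP[/ltW -> ->].
- exact: itvco_borel.
- exists 1 => d d' /= /andP[? ?] /andP[? ?]; rewrite vE psiB ler_norml.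
  by apply/andP; split; lra.
- move=> x /=; rewrite psiM psi2; split.
    move=> /half_open_unit_split[H|H].
      by exists (phi 2^-1); rewrite ?mem_head//= psiB phiK.
    by exists (phi (- 2^-1)); rewrite ?inE ?eqxx ?orbT//= psiB phiK opprK.
  move=> [r]; rewrite !inE => /orP[] /eqP ->; rewrite psiB phiK => H.
    by apply/half_open_unit_split; left.
  by apply/half_open_unit_split; right; rewrite -[X in _ + X]opprK.
- rewrite /= andbT inE; apply/eqP => /(can_inj phiK); lra.
- move=> x r r'; rewrite !inE => /orP[] /eqP -> /orP[] /eqP -> //=.
    by rewrite !psiB !phiK => /andP[? ?] /andP[? ?]; exfalso; lra.
  by rewrite !psiB !phiK => /andP[? ?] /andP[? ?]; exfalso; lra.
Qed.

(** The tile is a half-open square, whose double consists of four translates;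
    accordingly the normalized absolute value of [2] is [4]. *)
Lemma complex_local_absval (v : K -> R) (phi : {rmorphism cplx R -> K}) :
  homeomorphic_map phi -> (forall z, v (phi z) = Normc.normc z ^+ 2) ->
  local_absval v.
Proof.
move=> [psi [phiK psiK cphi cpsi]] vphi.
have vE x : v x = Normc.normc (psi x) ^+ 2 by rewrite -{1}(psiK x) vphi.
have psi0 : psi 0 = 0 by rewrite -[RHS]phiK rmorph0.
have psiM x y : psi (x * y) = psi x * psi y.
  by rewrite -[RHS]phiK rmorphM !psiK.
have psiB x y : psi (x - y) = psi x - psi y.
  by rewrite -[RHS]phiK rmorphB !psiK.
have psi2 : psi (2^-1) = 2^-1.
  by rewrite -[RHS]phiK fmorphV rmorph_nat.
have half : (2^-1 : cplx R) = Complex (2^-1) 0.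
  by rewrite -[X in _ = X]/((2^-1 : R)%:C%C) fmorphV rmorph_nat.
have halfM (z : cplx R) : 2^-1 * z = Complex (2^-1 * complex.Re z) (2^-1 * complex.Im z).
  by rewrite half; case: z => a b; apply/eqP; rewrite eq_complex /=;
    apply/andP; split; apply/eqP; ring.
pose re x := complex.Re (psi x); pose im x := complex.Im (psi x).
have cre : continuous re.
  by move=> x; apply: (continuous_comp (cpsi x)); exact: continuous_Re.
have cim : continuous im.
  by move=> x; apply: (continuous_comp (cpsi x)); exact: continuous_Im.
pose J (t : R) := - 2^-1 <= t < 2^-1.
pose h : R := 2^-1.
have reB x y : re (x - y) = re x - re y.
  by rewrite /re psiB; case: (psi x) => ? ?; case: (psi y).
have imB x y : im (x - y) = im x - im y.
  by rewrite /im psiB; case: (psi x) => ? ?; case: (psi y).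
split.
- by rewrite vE psi0 Normc.normc0 expr0n.
- move=> x x0; rewrite vE exprn_gt0// lt_def normc_ge0 andbT.
  apply: contraNneq x0 => /Normc.eq0_normc px.
  by rewrite -(psiK x) px rmorph0.
- by move=> x y; rewrite !vE psiM Normc.normcM exprMn.
- rewrite (_ : v = fun x => Normc.normc (psi x) ^+ 2); last by apply/funext => x; exact: vE.
  move=> x; apply: (continuous_comp (f := fun x => Normc.normc (psi x)) (g := fun t : R => t ^+ 2)).
    by apply: (continuous_comp (cpsi x)); exact: continuous_normc.
  exact: exprn_continuous.
- move=> U; rewrite -(rmorph0 phi) => /cphi /= /nbhs_cplxP[e /= e0 eU].
  exists (e ^+ 2); first exact: exprn_gt0.
  move=> y vy; rewrite -(psiK y); apply: eU.
  by rewrite subr0 -(@ltr_pXn2r _ 2)// ?nnegrE ?normc_ge0 ?(ltW e0)// -vE.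
exists 2, [set x | J (re x) /\ J (im x)],
  [:: phi (Complex h h); phi (Complex h (- h));
      phi (Complex (- h) h); phi (Complex (- h) (- h))].
split.
- rewrite vE -(rmorph_nat phi) phiK -[(2%:R : cplx R)](rmorph_nat (real_complex R)).
  by rewrite normc_real normr_nat -natrX.
- by [].
- have e0 : 0 < 2^-1 :> R by rewrite invr_gt0.
  suff N : nbhs (psi 0) [set z : cplx R | J (complex.Re z) /\ J (complex.Im z)].
    exact: (cpsi _ _ N).
  rewrite psi0; apply/nbhs_cplxP; exists 2^-1 => //= z; rewrite subr0 => zh.
  have := le_lt_trans (normc_ge_Re z) zh; have := le_lt_trans (normc_ge_Im z) zh.
  rewrite !ltr_norml /J => /andP[/ltW -> ->] /andP[/ltW -> ->] //.
- rewrite (_ : [set _ | _] = [set x | J (re x)] `&` [set x | J (im x)])//.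
  by apply: (@measurableI _ (borel K)); exact: itvco_borel.
- exists 4 => d d' /= [/andP[? ?] /andP[? ?]] [/andP[? ?] /andP[? ?]].
  rewrite vE sqr_normc -/(re _) -/(im _) reB imB.
  have sq (t : R) : -1 <= t <= 1 -> t ^+ 2 <= 1.
    move=> /andP[? ?]; have : 0 <= (1 - t) * (1 + t) by apply: mulr_ge0; lra.
    by lra.
  have : (re d - re d') ^+ 2 <= 1 by apply: sq; apply/andP; split; lra.
  have : (im d - im d') ^+ 2 <= 1 by apply: sq; apply/andP; split; lra.
  by lra.
- move=> x /=; rewrite /J /re /im psiM psi2 halfM /=.
  have D a b : J (re x - a) -> J (im x - b) ->
      J (re (x - phi (Complex a b))) /\ J (im (x - phi (Complex a b))).
    by rewrite reB imB /re /im phiK.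
  split.
    move=> [/half_open_unit_split H /half_open_unit_split H'].
    case: H => H; case: H' => H'.
    + by exists (phi (Complex h h)); [rewrite !inE eqxx|exact: D].
    + exists (phi (Complex h (- h))); first by rewrite !inE eqxx ?orbT.
      by apply: D => //; rewrite opprK.
    + exists (phi (Complex (- h) h)); first by rewrite !inE eqxx ?orbT.
      by apply: D => //; rewrite opprK.
    + exists (phi (Complex (- h) (- h))); first by rewrite !inE eqxx ?orbT.
      by apply: D => //; rewrite opprK.
  move=> [r]; rewrite !inE -/(re _) -/(im _) reB imB.
  have E a b : re (phi (Complex a b)) = a /\ im (phi (Complex a b)) = b.
    by rewrite /re /im phiK.
  case/or4P => /eqP ->; rewrite !(proj1 (E _ _)) !(proj2 (E _ _)) ?opprK => -[H H'].
  + by split; apply/half_open_unit_split; left.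
  + by split; apply/half_open_unit_split; [left|right].
  + by split; apply/half_open_unit_split; [right|left].
  + by split; apply/half_open_unit_split; right.
- have h0 : h != - h by apply/eqP; rewrite /h; lra.
  rewrite /= !inE !(can_eq phiK) !eq_complex /= !eqxx /= !andbT.
  by rewrite (negbTE h0) eq_sym (negbTE h0).
- move=> x r r'; rewrite !inE /J.
  have E a b : re (phi (Complex a b)) = a /\ im (phi (Complex a b)) = b.
    by rewrite /re /im phiK.
  have hh : (h - - h < 1) = false by apply/negbTE; rewrite -leNgt /h; lra.
  have F (a b a' b' t u : R) : - 2^-1 <= t - a < 2^-1 /\ - 2^-1 <= u - b < 2^-1 ->
      - 2^-1 <= t - a' < 2^-1 /\ - 2^-1 <= u - b' < 2^-1 ->
      [/\ a - a' < 1, a' - a < 1, b - b' < 1 & b' - b < 1].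
    by move=> -[/andP[? ?] /andP[? ?]] [/andP[? ?] /andP[? ?]]; split; lra.
  by case/or4P => /eqP ->; case/or4P => /eqP -> //=;
    rewrite !reB !imB !(proj1 (E _ _)) !(proj2 (E _ _)) => H /(F _ _ _ _ _ _ H);
    rewrite hh => -[].
Qed.

(** The tile is the ring of integers; the inverse of a uniformizer [p] dilates
    it to the union of the cosets of the representatives [p^-1 * r], where [r]
    runs through a residue system. *)
Lemma nonarchimedean_local_absval (v : K -> R) :
  nonarchimedean_normalized_absval v -> local_absval v.
Proof.
move=> [[v0 vp] vM vU vN [p [s [p01 pmax [s1 sD us sC] vps]]]].
have vge0 x : 0 <= v x by have [->|/vp/ltW//] := eqVneq x 0; rewrite v0.
have v1 : v 1 = 1.
  have : v 1 * v 1 = v 1 * 1 by rewrite -vM !mulr1.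
  by apply: mulfI; rewrite gt_eqF// vp// oner_eq0.
have vN1 x : v (- x) = v x.
  rewrite -mulN1r vM (_ : v (- 1) = 1) ?mul1r//; apply/eqP.
  by rewrite -(@eqrXn2 _ 2)//= expr1n expr2 -vM mulrNN mulr1 v1.
have vB x y : v (x - y) <= Num.max (v x) (v y) by rewrite -(vN1 y) vU.
have p0 : p != 0 by apply: contraTneq p01 => ->; rewrite v0 ltxx.
have vV x : x != 0 -> v x^-1 = (v x)^-1.
  move=> x0; have vx : v x != 0 by rewrite gt_eqF// vp.
  by apply: (mulfI vx); rewrite -vM divff// divff.
have s0 : (0 < (size s)%:R :> R) by rewrite -invr_gt0 -vps; case/andP: p01.
split => //.
- move=> x U /nbhs_ballP[e /= e0 eU].
  have [x0|x0] := eqVneq x 0.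
    apply/vN; exists e => // y; rewrite x0 subr0 => vy; apply: eU.
    by rewrite /ball /= x0 v0 sub0r normrN ger0_norm.
  apply/vN; exists (v x); first exact: vp.
  move=> y vyx; apply: eU; rewrite /ball /= (_ : v y = v x) ?subrr ?normr0//.
  apply/eqP; rewrite eq_le; apply/andP; split.
    have := vU (y - x) x; rewrite subrK => /le_trans -> //.
    by rewrite ge_max (ltW vyx) lexx.
  have := vB y (y - x); rewrite opprB subrKC le_max => /orP[//|].
  by rewrite leNgt vyx.
- move=> U /vN[e e0 eU]; exists e => // y vy; apply: eU; by rewrite subr0.
exists p^-1, [set x | v x <= 1], [seq p^-1 * r | r <- s].
have smap r : (r \in [seq p^-1 * r | r <- s]) -> exists2 r', r' \in s & r = p^-1 * r'.
  by move=> /mapP.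
have lt1 x : v x < 1 -> v (p^-1 * x) <= 1.
  by move=> /pmax; rewrite vM vV// mulrC ler_pdivrMr ?mul1r//; case/andP: p01.
have gt1 x : v (p^-1 * x) <= 1 -> v x < 1.
  rewrite vM vV// mulrC ler_pdivrMr ?mul1r; last by case/andP: p01.
  by move=> /le_lt_trans -> //; case/andP: p01.
split.
- by rewrite vV// vps invrK size_map.
- rewrite size_map -(ltr_nat R); move: p01 => /andP[_]; rewrite vps.
  by rewrite invf_lt1.
- by apply/vN; exists 1 => // y; rewrite subr0 => /ltW.
- apply: closed_borel; rewrite -openC openE => x /= /negP; rewrite -ltNge => x1.
  apply/vN; exists (v x); first exact: lt_trans x1.
  move=> y vyx /=; apply/negP; rewrite -ltNge (lt_le_trans x1)//.
  have := vB y (y - x); rewrite opprB subrKC le_max => /orP[//|].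
  by rewrite leNgt vyx.
- by exists 1 => d d' d1 d'1; rewrite (le_trans (vB _ _))// ge_max d1 d'1.
- move=> x /=; rewrite invrK; split.
    move=> /sC[r rs /lt1]; rewrite mulrBr mulKf// => H.
    by exists (p^-1 * r) => //; apply: map_f.
  move=> [_ /smap[r rs ->]] H.
  rewrite -[p * x](subrK r) (le_trans (vU _ _))// ge_max.
  by apply/andP; split; [apply/ltW/gt1; rewrite mulrBr mulKf|exact: s1].
- by rewrite map_inj_uniq//; apply: mulfI; rewrite invr_eq0.
- move=> x _ _ /smap[r rs ->] /smap[r' r's ->] /= xr xr'.
  congr (_ * _); apply: sD => //; apply: gt1.
  have -> : p^-1 * (r - r') = (x - p^-1 * r') - (x - p^-1 * r) by ring.
  by rewrite (le_trans (vB _ _))// ge_max xr xr'.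
Qed.

Lemma normalized_local_absval (v : K -> R) : normalized_absval v -> local_absval v.
Proof.
case=> [[phi hphi vphi]|[phi hphi vphi]|].
- exact: real_local_absval hphi vphi.
- exact: complex_local_absval hphi vphi.
- exact: nonarchimedean_local_absval.
Qed.

End LocalAbsval.

(** * Haar measure of balls *)
Lemma exprz_between (R : realType) (N x : R) : 1 < N -> 0 < x ->
  exists k : int, x < N ^ k <= N * x.
Proof.
move=> N1 x0; have N0 : 0 < N by lra.
have lN : 0 < ln N by rewrite ln_gt0.
have := floor_itv (ln x / ln N).
rewrite ler_pdivlMr// ltr_pdivrMr//.
set k := Num.floor _ => /andP[k1 k2]; exists (k + 1).
have NkE : N ^ (k + 1) = expR ((k + 1)%:~R * ln N).
  by rewrite -powR_intmul ?ltW// /powR gt_eqF.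
rewrite NkE -{1}(@lnK _ x)// ltr_expR k2 /=.
rewrite -(@lnK _ (N * x)) ?posrE ?mulr_gt0// ler_expR lnM ?posrE//.
by rewrite intrD mulrDl mul1r addrC lerD2l.
Qed.

Section HaarBalls.
Context (R : realType) (K : localFieldType) (v : K -> R).
Hypothesis lv : local_absval v.

Lemma lav_ge0 x : 0 <= v x.
Proof.
by have [->|/(lav_gt0 lv)/ltW//] := eqVneq x 0; rewrite (lav0 lv).
Qed.

Lemma lav1 : v 1 = 1.
Proof.
have v1 : 0 < v 1 by rewrite (lav_gt0 lv)// oner_eq0.
by apply: (mulfI (lt0r_neq0 v1)); rewrite -(lavM lv) !mulr1.
Qed.

Lemma lavV x : v x^-1 = (v x)^-1.
Proof.
have [->|x0] := eqVneq x 0; first by rewrite invr0 (lav0 lv) invr0.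
have vx : v x != 0 by rewrite gt_eqF// (lav_gt0 lv).
by apply: (mulfI vx); rewrite -(lavM lv) divff// lav1 divff.
Qed.

Lemma lavX x n : v (x ^+ n) = v x ^+ n.
Proof. by elim: n => [|n IH]; rewrite ?expr0 ?lav1// !exprS (lavM lv) IH. Qed.

Lemma lavN x : v (- x) = v x.
Proof.
apply/eqP; rewrite -(@eqrXn2 _ 2) ?lav_ge0//; apply/eqP.
by rewrite -!lavX sqrrN.
Qed.

Lemma lav_eq0 x : (v x == 0) = (x == 0).
Proof.
have [->|x0] := eqVneq x 0; first by rewrite (lav0 lv) eqxx.
by rewrite gt_eqF// (lav_gt0 lv).
Qed.

Lemma lavXz x (k : int) : v (x ^ k) = v x ^ k.
Proof. by case: k => k; rewrite ?NegzE -?exprz_inv -?exprnP ?lavX ?lavV. Qed.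

Lemma continuous_mull (a : K) : continuous (fun x : K => a * x).
Proof.
move=> x; apply: (cvg_comp2 (cvg_cst a) cvg_id (lf_mul_continuous (a, x))).
Qed.

Lemma continuous_addl (a : K) : continuous (fun x : K => a + x).
Proof.
move=> x; apply: (cvg_comp2 (cvg_cst a) cvg_id (add_continuous (a, x))).
Qed.

Lemma lav_exists_gt1 : exists2 c, c != 0 & 1 < v c.
Proof.
have [c [D [S t]]] := lav_tile lv; exists c.
  by rewrite -lav_eq0 (tile_abs t) pnatr_eq0 -lt0n; exact/ltnW/tile_size/t.
by rewrite (tile_abs t) ltr1n (tile_size t).
Qed.

Definition vball (r : R) : set K := [set y | v y <= r].

Lemma closed_ball_lav r : closed (vball r).
Proof.
rewrite -[vball r]/(v @^-1` [set t | t <= r]).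
by apply: closed_comp => [x _|]; [exact: (lav_continuous lv)|exact: closed_le].
Qed.

(** Local compactness provides one compact neighbourhood of [0], and every ball
    is closed in a dilate of it. *)
Lemma compact_ball r : compact (vball r).
Proof.
have [U U0 [cU clU]] : exists2 U, nbhs (0 : K) U & compact U /\ closed U.
  have [U sU [cU clU]] := @lf_locally_compact K 0 I.
  have H : nbhs (0 : K) [set x | setT x -> U x] := sU.
  by exists U => //; apply: filterS H => x; exact.
have [e e0 eU] := lav_nbhs lv U0.
have [c c0 c1] := lav_exists_gt1.
have [r0|r0] := ltP r 0.
  rewrite (_ : vball r = set0); first exact: compact0.
  by apply/seteqP; split => // y /= yr; have := lav_ge0 y; rewrite leNgt (le_lt_trans yr).
have re : 0 < (r + 1) / e by rewrite divr_gt0// ltr_wpDl.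
have [k /andP[rk _]] := exprz_between c1 re.
have rk' : r < e * v c ^ k.
  by rewrite -ltr_pdivrMl// mulrC (le_lt_trans _ rk)// ler_pM2r ?invr_gt0// lerDl.
have cT (u : K) (A : set K) : compact A -> compact [set u * x | x in A].
  move=> cA; apply: continuous_compact => //.
  by apply: continuous_subspaceT; exact: continuous_mull.
have -> : vball r = [set c ^ k * x | x in vball (r / v c ^ k)].
  have ck : 0 < v c ^ k by rewrite exprz_gt0// (lt_trans _ c1).
  have ck0 : c ^ k != 0 by rewrite expfz_neq0.
  apply/seteqP; split => [y /= yr|_ [x xr <-]] /=.
    exists ((c ^ k)^-1 * y); last by rewrite mulVKf.
    by rewrite /vball /= (lavM lv) lavV lavXz mulrC ler_pM2r// invr_gt0.
  by rewrite /vball /= (lavM lv) lavXz mulrC -ler_pdivlMr.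
apply: cT; apply: (subclosed_compact _ cU); first exact: closed_ball_lav.
have ck : 0 < v c ^ k by rewrite exprz_gt0// (lt_trans _ c1).
by move=> y /= yr; apply: eU; rewrite (le_lt_trans yr)// ltr_pdivrMr.
Qed.

Lemma borel_ball r : measurable (vball r : set (borel K)).
Proof. by apply: closed_borel; exact: closed_ball_lav. Qed.

Lemma borel_continuous (f : K -> K) : continuous f ->
  measurable_fun [set: borel K] (f : borel K -> borel K).
Proof.
move=> cf; apply: (@measurability _ _ (borel K) (borel K) setT f (@open K)) => //.
move=> _ [U oU <-]; rewrite setTI; apply: open_borel.
by apply: open_comp => // x _; exact: cf.
Qed.

Lemma borel_continuousR (f : K -> R) : continuous f ->
  measurable_fun [set: borel K] (f : borel K -> R).
Proof.
move=> cf; apply: (measurability _ (RGenOpens.measurableE R)).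
move=> _ [_ [a [b ->]] <-]; rewrite setTI; apply: open_borel.
by apply: open_comp => [x _|]; [exact: cf|exact: interval_open].
Qed.

Section Haar.
Context (mu : {sigma_finite_measure set (borel K) -> \bar R}).
Hypothesis hmu : haar_measure mu.

Lemma haar_translate (b : K) (A : set K) : measurable (A : set (borel K)) ->
  mu [set y | A (y + b)] = mu A.
Proof.
case: hmu => H _ _ mA; rewrite -[RHS](H (- b))//; congr (mu _).
apply/seteqP; split => [y /= Ayb|_ [y Ay <-] /=].
  by exists (y + b) => //; rewrite addrC addrK.
by rewrite addrC addrA subrr add0r.
Qed.

Lemma ge0_integral_translate (b : K) (F : borel K -> \bar R) :
  measurable_fun setT F -> (forall y, 0 <= F y)%E ->
  (\int[mu]_y F ((y : K) + b)%R = \int[mu]_y F y)%E.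
Proof.
move=> mF F0; apply/esym.
apply: (@ge0_integral_image _ _ _ _ _ (fun y : borel K => (y : K) + b : borel K)) => //.
  rewrite (_ : (fun _ => _) = (fun y : K => b + y)); last first.
    by apply/funext => y; rewrite addrC.
  by apply: borel_continuous; exact: continuous_addl.
by move=> A mA; apply/esym; exact: haar_translate.
Qed.

Lemma haar_ball_lty r : (mu (vball r) < +oo)%E.
Proof. by case: hmu => _ H _; apply: H; exact: compact_ball. Qed.

Lemma borel_preim_mull (u : K) (A : set K) : measurable (A : set (borel K)) ->
  measurable ([set x | A (u * x)] : set (borel K)).
Proof.
move=> mA; rewrite -[X in measurable X]setTI.
exact: (borel_continuous (@continuous_mull u)).
Qed.

Lemma borel_preim_addl (u : K) (A : set K) : measurable (A : set (borel K)) ->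
  measurable ([set x | A (u + x)] : set (borel K)).
Proof.
move=> mA; rewrite -[X in measurable X]setTI.
exact: (borel_continuous (@continuous_addl u)).
Qed.

(** A ball of radius [r] lies in a dilate of the tile by a power of [c] of
    absolute value at most a constant times [r]. *)
Lemma haar_ball_le : exists2 C : R, 0 <= C &
  forall r, 0 < r -> (mu (vball r) <= (C * r)%:E)%E.
Proof.
have [c [D [S t]]] := lav_tile lv.
have [e e0 eD] := lav_nbhs lv (tile_nbhs t).
have D0 : D 0 by exact: nbhs_singleton (tile_nbhs t).
have N1 : 1 < v c by rewrite (tile_abs t) ltr1n (tile_size t).
have N0 : 0 < v c by lra.
have c0 : c != 0 by rewrite -lav_eq0 gt_eqF.
pose E u : set (borel K) := [set x | D (u^-1 * x)].
have mE u : measurable (E u) by apply: borel_preim_mull; exact: tile_measurable t.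
have E1 : E 1 = D by apply/seteqP; split => x; rewrite /E /= invr1 mul1r.
have muDoo : (mu (E 1%R) < +oo)%E.
  have [M DM] := tile_bounded t.
  apply: le_lt_trans (haar_ball_lty M); apply: le_measure; rewrite ?inE//.
    exact: borel_ball.
  by move=> x; rewrite E1 => Dx /=; rewrite -[x]subr0; exact: DM.
(* translation invariance turns the splitting of the dilated tile into a factor *)
have EcE u : u != 0 -> mu (E (c * u)) = ((v c)%:E * mu (E u))%E.
  move=> u0.
  have -> : E (c * u) = \big[setU/set0]_(i < size S) [set x | E u (x - u * nth 0 S i)].
    rewrite -(bigcup_mkord _ (fun i => [set x | E u (x - u * nth 0 S i)])).
    apply/seteqP; split => x /=.
      rewrite /E /= invfM -mulrA => /(tile_split t)[r rS Dx].
      exists (index r S); rewrite /= ?index_mem//.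
      by rewrite nth_index// mulrBr mulKf.
    move=> [i /= iS]; rewrite /E /= mulrBr mulKf// => Dx.
    by rewrite invfM -mulrA; apply/(tile_split t); exists (nth 0 S i); rewrite ?mem_nth.
  rewrite measure_bigsetU_ord; last 2 first.
  - move=> i; rewrite (_ : [set x | _] = [set x | E u (- (u * nth 0 S i) + x)]).
      by apply: borel_preim_addl; exact: mE.
    by apply/funext => x /=; rewrite addrC.
  - apply/trivIsetP => i j _ _ ij; apply/seteqP; split => // x [/=].
    rewrite /E /= !mulrBr !mulKf// => Di Dj.
    have := tile_disjoint t (mem_nth 0 (ltn_ord i)) (mem_nth 0 (ltn_ord j)) Di Dj.
    by move=> /eqP; rewrite nth_uniq// ?(tile_uniq t)// => /eqP /val_inj /eqP; rewrite (negbTE ij).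
  rewrite (eq_bigr (fun=> mu (E u))) => [|i _]; last exact: haar_translate.
  by rewrite (tile_abs t) mule_natl sumr_const card_ord.
have EzE (k : int) : mu (E (c ^ k)) = ((v c ^ k)%:E * mu (E 1%R))%E.
  have vk (j : int) : 0 <= v c ^ j by rewrite exprz_ge0// ltW.
  elim/int_rect: k => [|k IH|k IH].
  - by rewrite !expr0z mul1e.
  - rewrite -addn1 PoszD addrC !expfzDr ?gt_eqF// !expr1z EcE ?expfz_neq0//.
    by rewrite IH EFinM muleA.
  - have -> : - k.+1%:Z = - k%:Z - 1 by rewrite -addn1 PoszD opprD.
    rewrite [in RHS]expfzDr ?gt_eqF// exprN1.
    have H : (mu (E (c ^ (- k%:Z))) = (v c)%:E * mu (E (c ^ (- k%:Z - 1)%R)))%E.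
      by rewrite -EcE ?expfz_neq0// -[c in (c * _)]expr1z -expfzDr// addrC subrK.
    rewrite IH in H; rewrite mulrC EFinM -muleA H muleA -EFinM mulVf ?gt_eqF//.
    by rewrite mul1e.
pose m := fine (mu (E 1)).
have mE1 : mu (E 1) = m%:E by rewrite fineK// ge0_fin_numE.
have m0 : 0 <= m by rewrite fine_ge0.
exists (v c / e * m) => [|r r0]; first by rewrite mulr_ge0// divr_ge0 ?ltW.
have [k /andP[k1 k2]] := exprz_between N1 (divr_gt0 r0 e0).
apply: (@le_trans _ _ (mu (E (c ^ k)))).
  apply: le_measure; rewrite ?inE//; first exact: borel_ball.
  move=> x /= xr; apply: eD; rewrite (lavM lv) lavV lavXz mulrC.
  rewrite ltr_pdivrMr ?exprz_gt0// (le_lt_trans xr)// mulrC.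
  by rewrite -ltr_pdivrMr.
rewrite EzE mE1 -EFinM lee_fin.
have -> : v c / e * m * r = v c * (r / e) * m by rewrite -!mulrA; congr (_ * _); ring.
exact: ler_wpM2r.
Qed.

(** The one-variable integrals below are all dominated by a geometric series of
    balls: a function bounded by [c k] on the ball of radius [rho k] contributes
    at most [C * c k * rho k]. *)
Lemma ge0_integral_layers : exists2 C : R, 0 <= C &
  forall (F : borel K -> R) (c rho : nat -> R) (A theta : R),
  measurable_fun setT F -> (forall y, 0 <= F y) ->
  (forall k, 0 <= c k) -> (forall k, 0 < rho k) -> 0 <= theta < 1 -> 0 <= A ->
  (forall k, c k * rho k <= A * theta ^+ k) ->
  (forall y, F y = 0 \/ exists2 k, F y <= c k & v y <= rho k) ->
  (\int[mu]_y (F y)%:E <= (C * A / (1 - theta))%:E)%E.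
Proof.
have [C C0 HC] := haar_ball_le; exists C => // F c rho A th mF F0 c0 rho0.
move=> /andP[th0 th1] A0 crho HF.
pose G k (y : borel K) : R := c k * \1_(vball (rho k)) y.
have mi k : measurable_fun setT (\1_(vball (rho k) : set (borel K)) : borel K -> R).
  by apply: measurable_indic; exact: borel_ball.
have mG k : measurable_fun setT (EFin \o G k).
  apply/measurable_EFinP; apply: measurable_funM; first exact: measurable_cst.
  exact: mi.
have G0 k y : 0 <= G k y by rewrite mulr_ge0// indicE.
apply: (@le_trans _ _ (\int[mu]_y (\sum_(0 <= k <oo) (G k y)%:E))%E).
  apply: ge0_le_integral => //.
  - by move=> y _; rewrite lee_fin.
  - exact/measurable_EFinP.
  - apply: ge0_emeasurable_sum; last by move=> k _; exact: mG.
    by move=> k y _ _; rewrite lee_fin.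
  move=> y _; case: (HF y) => [->|[k Fk yk]].
    by apply: nneseries_ge0 => k _ _; rewrite lee_fin.
  apply: (@le_trans _ _ (\sum_(0 <= i < k.+1) (G i y)%:E)%E); last first.
    by apply: nneseries_lim_ge => i _; rewrite lee_fin.
  rewrite big_nat_recr//= -[leLHS]add0e; apply: leeD.
    by apply: sume_ge0 => i _; rewrite lee_fin.
  by rewrite lee_fin /G indicE mem_set// mulr1.
rewrite integral_nneseries//; last by move=> k y _; rewrite lee_fin.
apply: lime_le.
  by apply: is_cvg_nneseries => k _ _; apply: integral_ge0 => y _; rewrite lee_fin.
apply: nearW => n.
apply: (@le_trans _ _ (\sum_(0 <= k < n) (C * A * th ^+ k)%:E)%E).
  apply: lee_sum => k _.
  under eq_integral do rewrite EFinM.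
  rewrite ge0_integralZl ?lee_fin//; last exact/measurable_EFinP.
  rewrite integral_indic// ?setIT; last exact: borel_ball.
  apply: (@le_trans _ _ ((c k)%:E * (C * rho k)%:E)%E).
    by apply: lee_pmul; rewrite ?lee_fin//; exact: HC.
  rewrite -EFinM lee_fin mulrCA -mulrA; apply: ler_wpM2l => //.
rewrite sumEFin lee_fin -mulr_sumr ler_wpM2l ?mulr_ge0//.
rewrite -[leRHS]mul1r ler_pdivlMr ?subr_gt0// mulrC big_mkord.
have := subrX1 th n; rewrite -opprB -[in RHS]opprB mulNr => /oppr_inj <-.
by rewrite gerBl exprn_ge0.
Qed.
End Haar.
End HaarBalls.

(** * Integrals in one variable *)
Section Decay.
Context (R : realType) (K : localFieldType) (v : K -> R).
Hypothesis lv : local_absval v.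
Context (mu : {sigma_finite_measure set (borel K) -> \bar R}).
Hypothesis hmu : haar_measure mu.

Lemma exprn2_between (t : R) : 1 <= t -> exists k : nat, t < 2 ^+ k <= 2 * t.
Proof.
move=> t1; have [[k|k] H] := @exprz_between R 2 t ltac:(lra) ltac:(lra).
  by exists k.
move: H => /andP[+ _]; rewrite NegzE -exprz_inv -exprnP => H; exfalso.
have : (2 : R)^-1 ^+ k.+1 <= 1 by rewrite exprn_ile1// ?invr_ge0// invf_le1//; lra.
lra.
Qed.

Lemma powR_exprn2 (a : R) k : (2 ^+ k) `^ a = (2 `^ a) ^+ k :> R.
Proof. by rewrite -!powR_mulrn ?powR_ge0// -!powRrM mulrC. Qed.

Lemma powR2_ltr1 (a : R) : a < 0 -> 2 `^ a < 1.
Proof. by move=> a0; rewrite /powR pnatr_eq0 /= expR_lt1 pmulr_llt0// ln_gt0//; lra. Qed.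

Lemma powR_gt0D (x a b : R) : 0 < x -> x `^ (a + b) = x `^ a * x `^ b.
Proof. by move=> x0; rewrite powRD// (gt_eqF x0) implybT. Qed.

Lemma measurable_max1_powR (q r : R) (s : K) :
  measurable_fun setT (fun y : borel K => Num.max 1 (v (s * (y : K)) / r) `^ q).
Proof.
apply: (measurableT_comp (measurable_powR q)).
apply: measurable_maxr => //; apply: measurable_funM => //.
apply: (@borel_continuousR R K (fun y => v (s * y))) => y.
apply: (@continuous_comp K K R (fun y => s * y) v).
  exact: continuous_mull.
exact: (lav_continuous lv).
Qed.

(** On the dyadic layer where the maximum is about [2 ^ k], the integrand is of
    order [2 ^ (- q k)] and the layer has measure of order [2 ^ k]. The factor
    [d / v s] is the Jacobian of the affine substitution; the constant must not
    depend on that substitution, which varies with the other entries of the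
    matrix. *)
Lemma integral_decay (q : R) : 1 < q -> exists2 C : R, 0 <= C &
  forall (d : R) (s b : K), 0 < d -> s != 0 ->
  (\int[mu]_y (Num.max 1 (v (s * (y : K) + b) / d) `^ (- q))%:E
     <= (C * (d / v s))%:E)%E.
Proof.
move=> q1; have [C C0 HC] := ge0_integral_layers lv hmu.
pose th : R := 2 `^ (1 - q).
have th1 : 0 <= th < 1 by rewrite powR_ge0 powR2_ltr1// subr_lt0.
exists (C * 2 `^ q / (1 - th)) => [|d s b d0 s0].
  by rewrite divr_ge0 ?mulr_ge0 ?powR_ge0// subr_ge0 ltW//; case/andP: th1.
have vs0 : 0 < v s by apply: lav_gt0 lv _ s0.
pose F (y : borel K) : R := Num.max 1 (v (s * (y : K)) / d) `^ (- q).
have mF : measurable_fun setT F by exact: measurable_max1_powR.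
rewrite (eq_integral (fun y : borel K => (F ((y : K) + s^-1 * b)%R)%:E)); last first.
  by move=> y _; rewrite /F mulrDr mulVKf.
rewrite (@ge0_integral_translate R K mu hmu _ (EFin \o F))//; last 2 first.
- exact/measurable_EFinP.
- by move=> y; rewrite lee_fin powR_ge0.
have dv : 0 < d / v s by rewrite divr_gt0.
apply: le_trans (HC F (fun k => 2 `^ q * (2 ^+ k) `^ (- q))
   (fun k => d / v s * 2 ^+ k) (2 `^ q * (d / v s)) th mF _ _ _ th1 _ _ _) _.
- by move=> y; exact: powR_ge0.
- by move=> k; rewrite mulr_ge0 ?powR_ge0.
- by move=> k; rewrite mulr_gt0// exprn_gt0.
- by apply: mulr_ge0; [exact: powR_ge0|exact: ltW].
- move=> k; rewrite mulrACA; apply: ler_wpM2l.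
    by apply: mulr_ge0; [exact: powR_ge0|exact: ltW].
  have k0 : 0 < (2 : R) ^+ k by rewrite exprn_gt0.
  by rewrite /th -powR_exprn2 addrC powR_gt0D// powRr1// ltW.
- move=> y; right; rewrite /F; set t := Num.max _ _.
  have t1 : 1 <= t by rewrite le_max lexx.
  have [k /andP[k1 k2]] := exprn2_between t1; exists k.
    have t0 : 0 < t by rewrite (lt_le_trans _ t1).
    have k0 : 0 < (2 : R) ^+ k by rewrite exprn_gt0.
    rewrite !powRN ler_pdivlMr ?powR_gt0// ler_pdivrMl ?powR_gt0//.
    rewrite -powRM ?(ltW t0)// ge0_ler_powR ?nnegrE ?(ltW k0) ?mulr_ge0 ?(ltW t0)//.
      by rewrite (le_trans _ (ltW q1)).
    by rewrite mulrC.
  rewrite mulrAC ler_pdivlMr// mulrC -(lavM lv) mulrC -ler_pdivrMl// mulrC.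
  rewrite (le_trans _ (ltW k1))// le_max.
  by rewrite [d^-1 * _]mulrC lexx orbT.
by rewrite lee_fin le_eqVlt; apply/orP; left; apply/eqP; ring.
Qed.

Lemma measurable_lav : measurable_fun setT (v : borel K -> R).
Proof. by apply: borel_continuousR; exact: lav_continuous. Qed.

Lemma measurable_near0_powR (p : R) :
  measurable_fun setT (fun y : borel K => if 0 < v y <= 1 then v y `^ p else 0).
Proof.
have mv := measurable_lav.
apply: measurable_fun_ifT => //; last exact: (measurableT_comp (measurable_powR p)).
apply: measurable_and; first exact: measurable_fun_ltr.
exact: measurable_fun_ler.
Qed.

(** Dyadic layers [v y <= 2 / 2 ^ k] shrinking to [0]. The constant [1 + 2 `^ p]
    bounds the oscillation of the power on a layer for either sign of [p]. *)
Lemma integral_near0 (p : R) : - 1 < p -> exists2 C : R, 0 <= C &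
  (\int[mu]_y (if 0 < v y <= 1 then v y `^ p else 0)%:E <= C%:E)%E.
Proof.
move=> p1; have [C C0 HC] := ge0_integral_layers lv hmu.
pose th : R := 2 `^ (- p - 1).
have th1 : 0 <= th < 1 by rewrite powR_ge0 powR2_ltr1//; lra.
pose M : R := 1 + 2 `^ p.
have M0 : 0 <= M by rewrite addr_ge0 ?powR_ge0.
pose F (y : borel K) : R := if 0 < v y <= 1 then v y `^ p else 0.
have k0 k : 0 < (2 : R) ^+ k by rewrite exprn_gt0.
exists (C * (M * 2) / (1 - th)).
  apply: divr_ge0; last by rewrite subr_ge0 ltW//; case/andP: th1.
  exact: mulr_ge0 C0 (mulr_ge0 M0 (ler0n _ _)).
apply: (HC F (fun k => M * (2 ^+ k) `^ (- p)) (fun k => 2 / 2 ^+ k) (M * 2) th) => //.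
- exact: measurable_near0_powR.
- by move=> y; rewrite /F; case: ifP => // _; exact: powR_ge0.
- by move=> k; rewrite mulr_ge0 ?powR_ge0.
- exact: mulr_ge0 M0 (ler0n _ _).
- move=> k; rewrite mulrACA; apply: ler_wpM2l; first exact: mulr_ge0 M0 (ler0n _ _).
  by rewrite /th -powR_exprn2 powR_gt0D// powR_inv1// ltW.
move=> y; rewrite /F; case: ifPn => [/andP[vy0 vy1]|_]; [right|by left].
have vV : 1 <= (v y)^-1 by rewrite invf_ge1.
have [k /andP[k1 k2]] := exprn2_between vV; exists k; last first.
  by rewrite ler_pdivlMr// mulrC -ler_pdivlMr// mulrC.
have t1 : 1 < v y * 2 ^+ k by rewrite mulrC -ltr_pdivrMr// mul1r.
have t2 : v y * 2 ^+ k <= 2 by rewrite mulrC -ler_pdivlMr.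
rewrite powRN ler_pdivlMr ?powR_gt0// -powRM ?(ltW vy0) ?(ltW (k0 _))//.
have [p0|p0] := leP 0 p.
  rewrite (@le_trans _ _ (2 `^ p)) ?lerDr//.
  by rewrite ge0_ler_powR ?nnegrE//; lra.
rewrite (@le_trans _ _ 1) ?lerDl ?powR_ge0//.
rewrite -[p]opprK powRN invf_le1 ?powR_gt0 ?(lt_trans _ t1)//.
have : 1 `^ (- p) <= (v y * 2 ^+ k) `^ (- p) by apply: ge0_ler_powR; rewrite ?nnegrE//; lra.
by rewrite powR1.
Qed.

(** The integrand is [v y `^ e] outside the unit ball and [v y `^ (e - f)] inside:
    the first exponent governs infinity, the second one governs [0]. *)
Lemma integral_powR_lty (e f : R) : e < - 1 -> - 1 < e - f ->
  (\int[mu]_y (v y `^ e * Num.max 1 (v y)^-1 `^ f)%:E < +oo)%E.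
Proof.
move=> e1 f1.
have [C1 C10 H1] := integral_decay (q := - e) ltac:(lra).
have [C2 C20 H2] := integral_near0 f1.
have mv := measurable_lav.
pose F1 (y : borel K) : R := Num.max 1 (v (1 * (y : K)) / 1) `^ (- - e).
have mF1 : measurable_fun setT F1 by exact: measurable_max1_powR.
apply: (@le_lt_trans _ _ (\int[mu]_y ((F1 y)%:E +
    (if 0 < v y <= 1 then v y `^ (e - f) else 0)%:E))%E); last first.
  rewrite ge0_integralD//; last 4 first.
  - by move=> y _; rewrite lee_fin powR_ge0.
  - exact/measurable_EFinP.
  - by move=> y _; rewrite lee_fin; case: ifP => // _; exact: powR_ge0.
  - by apply/measurable_EFinP; exact: measurable_near0_powR.
  apply: lte_add_pinfty; last exact: le_lt_trans H2 (ltry _).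
  apply: le_lt_trans (ltry (C1 * (1 / v 1))).
  apply: le_trans (H1 1 1 0 ltr01 (oner_neq0 _)).
  by rewrite le_eqVlt; apply/orP; left; apply/eqP; apply: eq_integral => y _;
    rewrite addr0.
apply: ge0_le_integral => //.
- by move=> y _; rewrite lee_fin mulr_ge0 ?powR_ge0.
- apply/measurable_EFinP; apply: measurable_funM.
    exact: (measurableT_comp (measurable_powR e)).
  apply: (measurableT_comp (measurable_powR f)); apply: measurable_maxr => //.
  rewrite (_ : (fun _ => _) = fun y : borel K => v y `^ (- 1)).
    exact: (measurableT_comp (measurable_powR (- 1))).
  by apply/funext => y; rewrite powR_inv1// lav_ge0.
- apply: emeasurable_funD; first exact/measurable_EFinP.
  by apply/measurable_EFinP; exact: measurable_near0_powR.
move=> y _; rewrite -EFinD lee_fin /F1 mul1r divr1 opprK.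
have [y0|y0] := eqVneq (y : K) 0.
  rewrite y0 (lav0 lv) powR0 ?mul0r; last by rewrite lt_eqF//; lra.
  by rewrite addr_ge0 ?powR_ge0//; case: ifP => // _; exact: powR_ge0.
have vy : 0 < v y by exact: lav_gt0 lv _ y0.
rewrite vy /=; have [vy1|vy1] := leP (v y) 1.
  rewrite (max_idPr _) ?invf_ge1// -(powR_inv1 (ltW vy)) -powRrM mulN1r.
  by rewrite -powR_gt0D// lerDr powR_ge0.
rewrite addr0 (max_idPl _) ?invf_le1 ?(ltW vy1)// powR1 mulr1.
by [].
Qed.

End Decay.

(** * Measurability of continuous functions of matrices *)
Section BorelMatrices.
Context (R : realType) (K : localFieldType) (v : K -> R).
Hypothesis lv : local_absval v.

Lemma exprn_unbounded (N y : R) : 1 < N -> exists m : nat, y < N ^+ m.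
Proof.
move=> N1; have y0 : 0 < Num.max 1 y by rewrite lt_max ltr01.
have [[m|m] /andP[+ _]] := exprz_between N1 y0.
  by rewrite gt_max => /andP[_]; exists m.
rewrite gt_max => /andP[_ yN]; exists 0%N; rewrite expr0 (lt_le_trans yN)//.
by rewrite NegzE -exprz_inv -exprnP exprn_ile1 ?invr_ge0 ?invf_le1//; lra.
Qed.

(** Translates of the shrunken tiles form a countable family of Borel sets
    that is fine enough to write every open set as a countable union. *)
Lemma countable_borel_net : exists B : nat * (nat * nat) -> set K,
  (forall i, measurable (B i : set (borel K))) /\
  forall (x : K) (U : set K), nbhs x U -> exists2 i, B i x & B i `<=` U.
Proof.
have [c [D [S t]]] := lav_tile lv.
have [e e0 eD] := lav_nbhs lv (tile_nbhs t).
have D0 : D 0 by exact: nbhs_singleton (tile_nbhs t).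
have N1 : 1 < v c by rewrite (tile_abs t) ltr1n (tile_size t).
have N0 : 0 < v c by lra.
have c0 : c != 0 by rewrite -(lav_eq0 lv) gt_eqF.
have [M DM] := tile_bounded t.
pose Z := fix Z m := if m is m'.+1 then [seq c * z + r | z <- Z m', r <- S] else [:: 0].
have ZP m x : D ((c ^+ m)^-1 * x) -> exists2 z, z \in Z m & D (x - z).
  elim: m x => [|m IH] x.
    by rewrite expr0 invr1 mul1r => Dx; exists 0; rewrite ?mem_head// subr0.
  rewrite exprSr invfM -mulrA => /IH[z zm].
  rewrite (_ : c^-1 * x - z = c^-1 * (x - c * z)); last by rewrite mulrBr mulKf.
  move=> /(tile_split t)[r rS Dx]; exists (c * z + r); last by rewrite opprD addrA.
  by apply/allpairsP; exists (z, r).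
exists (fun i => [set y | D (c ^+ i.1 * y - nth 0 (Z i.2.1) i.2.2)]); split.
  move=> [k [m i]] /=.
  rewrite (_ : [set _ | _] = [set y | [set z | D (- nth 0 (Z m) i + z)] (c ^+ k * y)]).
    apply: borel_preim_mull; apply: borel_preim_addl; exact: tile_measurable t.
  by apply/funext => y /=; rewrite addrC.
move=> x U xU.
have xU' : nbhs (x + 0) U by rewrite addr0.
have [d d0 dU] := lav_nbhs lv (@continuous_addl K x 0 U xU').
have [k Mk] := exprn_unbounded (M / d) N1.
have [m em] := exprn_unbounded (v (c ^+ k * x) / e) N1.
have [z zm Dz] : exists2 z, z \in Z m & D (c ^+ k * x - z).
  apply: ZP; apply: eD; rewrite (lavM lv) (lavV lv) (lavX lv).
  by rewrite ltr_pdivrMl ?exprn_gt0// -ltr_pdivrMr.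
exists (k, (m, index z (Z m))) => /=; first by rewrite nth_index.
rewrite nth_index// => y Dy; rewrite -[y](subrKC x); apply: dU.
have := DM _ _ Dy Dz; rewrite (_ : _ - _ = c ^+ k * (y - x)); last by ring.
rewrite (lavM lv) (lavX lv) => H; rewrite -(@ltr_pM2l _ (v c ^+ k)) ?exprn_gt0//.
by rewrite (le_lt_trans H)// -ltr_pdivrMr.
Qed.

Context d (T : measurableType d) (Dom : set T) (p q : nat).
Hypothesis mDom : measurable Dom.
Context (phi : T -> 'M[K]_(p, q)).
Hypothesis mphi : forall i j, measurable_fun Dom (fun t => phi t i j : borel K).

(** An open set of matrices is a countable union of boxes with sides in the net,
    and the preimage of a box is measurable entry by entry. *)
Lemma measurable_preimage_open_mx (O : set 'M[K]_(p, q)) : open O ->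
  measurable (Dom `&` phi @^-1` O).
Proof.
move=> oO; have [B [mB BU]] := countable_borel_net.
pose Box (I : 'M[nat * (nat * nat)]_(p, q)) : set 'M[K]_(p, q) :=
  [set X | forall i j, B (I i j) (X i j)].
rewrite (_ : _ `&` _ = \bigcup_(J in [set J | Box J `<=` O]) (Dom `&` phi @^-1` Box J)).
  rewrite bigcup_mkcond; apply: countable_bigcupT_measurable => [|J].
    exact: countableP.
  case: ifP => // _.
  rewrite (_ : _ `&` _ = \bigcap_(ij in [set: 'I_p * 'I_q])
      (Dom `&` (fun t => phi t ij.1 ij.2) @^-1` B (J ij.1 ij.2)) `&` Dom).
    apply: measurableI => //; apply: fin_bigcap_measurable => // -[i j] _ /=.
    exact: mphi.
  apply/seteqP; split => [x [Dx Bx]|x [H Dx]] /=.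
    by split => // -[i j] _ /=; split => //; exact: Bx.
  by split => // i j; have [] := H (i, j) I.
apply/seteqP; split => [x [Dx Ox]|x [I BO [Dx Bx]]]; last by split => //; exact: BO.
have : nbhs (phi x) O by exact: open_nbhs_nbhs.
move=> [P xP PO].
have H i j : {k | B k (phi x i j) & B k `<=` P i j} by apply: cid2; exact: BU.
exists (\matrix_(i, j) s2val (H i j)).
  by move=> X BX; apply: PO => i j; apply: (s2valP' (H i j)); have := BX i j; rewrite mxE.
by split => // i j; rewrite mxE; exact: (s2valP (H i j)).
Qed.

Lemma measurable_continuous_mxR (V : set 'M[K]_(p, q)) (h : 'M[K]_(p, q) -> R) :
  open V -> (forall t, Dom t -> V (phi t)) -> (forall X, V X -> {for X, continuous h}) ->
  measurable_fun Dom (h \o phi).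
Proof.
move=> oV DV hV; apply: (measurability _ (RGenOpens.measurableE R)).
move=> _ [_ [a [b ->]] <-].
rewrite (_ : _ `&` _ = Dom `&` phi @^-1` (V `&` h @^-1` `]a, b[%classic)).
  apply: measurable_preimage_open_mx; rewrite openE => X [VX hX].
  apply: filterI; first exact: open_nbhs_nbhs.
  by apply: (hV _ VX); apply: open_nbhs_nbhs; split => //; exact: interval_open.
by apply/seteqP; split => x [Dx H]; split => //=; [split => //; exact: DV|case: H].
Qed.

Lemma measurable_continuous_mxK (V : set 'M[K]_(p, q)) (h : 'M[K]_(p, q) -> K) :
  open V -> (forall t, Dom t -> V (phi t)) -> (forall X, V X -> {for X, continuous h}) ->
  measurable_fun Dom (h \o phi : T -> borel K).
Proof.
move=> oV DV hV.
apply: (@measurability _ _ T (borel K) Dom (h \o phi) (@open K)) => //.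
move=> _ [U oU <-].
rewrite (_ : _ `&` _ = Dom `&` phi @^-1` (V `&` h @^-1` U)).
  apply: measurable_preimage_open_mx; rewrite openE => X [VX hX].
  apply: filterI; first exact: open_nbhs_nbhs.
  by apply: (hV _ VX); apply: open_nbhs_nbhs.
by apply/seteqP; split => x [Dx H]; split => //=; [split => //; exact: DV|case: H].
Qed.

End BorelMatrices.

(** * Column elimination with pivoting *)
Section Elimination.
Context (R : realType) (K : localFieldType) (v : K -> R).
Hypothesis lv : local_absval v.
Implicit Types (g : nat -> nat -> K) (x y : nat -> K) (i j r c : nat).

(** A column operation, seen as an operator on each row separately: [tau] times
    column [i] is subtracted from column [j], the two columns being exchanged
    beforehand when [s] holds. *)
Definition rowop (s : bool) (tau : K) i j x : nat -> K := fun c =>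
  if s then (if c == i then x j else if c == j then x i - tau * x j else x c)
  else (if c == j then x j - tau * x i else x c).

Definition swapped i j (B : nat -> nat -> K) : bool := v (B i i) < v (B i j).

(** The pivot is the larger of the two entries, so that the ratio has absolute
    value at most one. *)
Definition pivot_ratio i j (B : nat -> nat -> K) : K :=
  if swapped i j B then B i i / B i j else B i j / B i i.

Definition clear i j (B : nat -> nat -> K) : nat -> nat -> K :=
  fun r => rowop (swapped i j B) (pivot_ratio i j B) i j (B r).

Fixpoint clear_rows j i B := if i is i'.+1 then clear i' j (clear_rows j i' B) else B.

Fixpoint clear_cols j B := if j is j'.+1 then clear_rows j' j' (clear_cols j' B) else B.

(** The matrix just before its entry at row [i] of column [j] is cleared, the
    columns being treated from left to right and each from top to bottom. *)
Definition stage j i g := clear_rows j i (clear_cols j g).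

Lemma stageS j i g : stage j i.+1 g = clear i j (stage j i g).
Proof. by []. Qed.

Lemma stage_col j g : stage j.+1 0 g = stage j j g.
Proof. by []. Qed.

(** The operator on rows through which the stage acts. Keeping it apart from the
    matrix separates the choice of the pivots, which is not linear, from their
    effect, which is. *)
Fixpoint rowop_rows g j i x :=
  if i is i'.+1 then
    rowop (swapped i' j (stage j i' g)) (pivot_ratio i' j (stage j i' g)) i' j
      (rowop_rows g j i' x)
  else x.

Fixpoint rowop_cols g j x :=
  if j is j'.+1 then rowop_rows g j' j' (rowop_cols g j' x) else x.

Definition rowact g j i x := rowop_rows g j i (rowop_cols g j x).

Lemma rowactS g j i x : rowact g j i.+1 x =
  rowop (swapped i j (stage j i g)) (pivot_ratio i j (stage j i g)) i j
    (rowact g j i x).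
Proof. by []. Qed.

Lemma rowact_col g j x : rowact g j.+1 0 x = rowact g j j x.
Proof. by []. Qed.

Lemma stage_ind (P : nat -> nat -> Prop) :
  P 0%N 0%N -> (forall j, P j j -> P j.+1 0%N) ->
  (forall j i, (i < j)%N -> P j i -> P j i.+1) ->
  forall j i, (i <= j)%N -> P j i.
Proof.
move=> P0 Pc Pr.
have H j : P j 0%N -> forall i, (i <= j)%N -> P j i.
  by move=> Pj0; elim=> [//|i IH] ij; apply: Pr => //; exact/IH/ltnW.
have {}P0 j : P j 0%N by elim: j => [//|j IH]; apply: Pc; apply: H.
by move=> j i ij; exact: H.
Qed.

Lemma stage_rowact g j i : (i <= j)%N -> stage j i g = fun r => rowact g j i (g r).
Proof.
move: j i; apply: stage_ind => [//|j IH|j i ij IH]; first by rewrite stage_col IH.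
by rewrite stageS {1}IH; apply/funext => r; rewrite rowactS /clear -IH.
Qed.

Lemma rowact_linear g j i (a : K) x y : (i <= j)%N ->
  rowact g j i (fun c => x c + a * y c) =
  fun c => rowact g j i x c + a * rowact g j i y c.
Proof.
move: j i; apply: stage_ind => [//|j IH|j i ij IH]; first by rewrite !rowact_col IH.
rewrite !rowactS IH; apply/funext => c; rewrite /rowop.
by case: ifP => _; do ?case: ifP => _ //; ring.
Qed.

Lemma rowact_right g j i : (i <= j)%N -> forall x c, (j < c)%N ->
  rowact g j i x c = x c.
Proof.
move: j i; apply: stage_ind => [//|j IH x c jc|j i ij IH x c jc].
  by rewrite rowact_col IH// ltnW.
rewrite rowactS /rowop !gtn_eqF ?(ltn_trans ij)// !IH//.
by case: ifP.
Qed.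

Lemma rowact_local g j i : (i <= j)%N -> forall x y,
  (forall c, (c <= j)%N -> x c = y c) ->
  forall c, (c <= j)%N -> rowact g j i x c = rowact g j i y c.
Proof.
move: j i; apply: stage_ind => [//|j IH x y xy c|j i ij IH x y xy c cj].
  rewrite !rowact_col leq_eqVlt => /predU1P[->|cj].
    by rewrite !rowact_right// xy.
  by apply: IH => // c' c'j; apply: xy; exact: leqW.
have H := IH _ _ xy; rewrite !rowactS /rowop.
by rewrite !H// ltnW.
Qed.

(** The pivots used up to a stage are read off from the entries cleared so far,
    so the remaining entries can vary without changing the operator. *)
Lemma rowact_dep g g' j i : (i <= j)%N ->
  (forall r c, (c < j)%N || (c == j) && (r < i)%N -> g r c = g' r c) ->
  rowact g j i = rowact g' j i.
Proof.
move: j i; apply: stage_ind => [//|j IH gg|j i ij IH gg].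
  apply/funext => x; rewrite !rowact_col IH// => r c /orP[cj|/andP[/eqP -> rj]].
    by apply: gg; rewrite ltnW.
  by apply: gg; rewrite ltnSn.
have E : rowact g j i = rowact g' j i.
  apply: IH => r c /orP[cj|/andP[cj ri]]; apply: gg; first by rewrite cj.
  by rewrite cj ltnS (ltnW ri) orbT.
have S c : (c <= j)%N -> stage j i g i c = stage j i g' i c.
  move=> cj; rewrite !stage_rowact 1?ltnW// E; apply: rowact_local => //.
    exact: ltnW.
  move=> c'; rewrite leq_eqVlt => /predU1P[->|c'j].
    by apply: gg; rewrite eqxx ltnSn orbT.
  by apply: gg; rewrite c'j.
apply/funext => x; rewrite !rowactS E.
by rewrite /swapped /pivot_ratio /swapped !S// ltnW.
Qed.

Definition unit_row j : nat -> K := fun c => (c == j)%:R.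

Lemma rowact_unit_row0 g j i c : (i <= c < j)%N -> rowact g j i (unit_row j) c = 0.
Proof.
move=> /andP[ic cj]; have := leq_trans ic (ltnW cj).
elim: i c ic cj => [|i IH] c ic cj ij.
  case: j cj ij => // j; rewrite ltnS => cj _; rewrite rowact_col.
  rewrite (@rowact_local g j j (leqnn j) _ (fun _ => 0))//.
    have := rowact_linear g (-1) (fun _ => 0) (fun _ => 0) (leqnn j).
    by move=> /(congr1 (fun f => f c)); rewrite mulr0 addr0 mulN1r subrr.
  by move=> c' c'j; rewrite /unit_row ltn_eqF.
have Hi : rowact g j i (unit_row j) i = 0 by rewrite IH// ltnW.
have Hc : rowact g j i (unit_row j) c = 0 by rewrite IH// ltnW.
rewrite rowactS /rowop Hi (gtn_eqF ic) (ltn_eqF cj) Hc.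
by case: ifP.
Qed.

(** The shape of [w1 * g] for [g] in [R]. *)
Record unitriangular_from1 g : Prop := UnitriangularFrom1 {
  utf_lower : forall r c, (c < r)%N -> g r c = 0 ;
  utf_diag : forall r, (0 < r)%N -> g r r = 1 ;
  utf_diag0 : g 0%N 0%N != 0 }.

Definition diagabs j i g r : R := v (stage j i g r r).

Lemma diagabs_col g j i : unitriangular_from1 g -> (i <= j)%N -> (0 < j)%N ->
  diagabs j i g j = v (rowact g j i (unit_row j) j).
Proof.
move=> ug ij j0; rewrite /diagabs stage_rowact//; congr v.
apply: rowact_local => // c; rewrite leq_eqVlt => /predU1P[->|cj].
  by rewrite (utf_diag ug)// /unit_row eqxx.
by rewrite (utf_lower ug)// /unit_row ltn_eqF.
Qed.

Definition growth j i g : R := Num.max 1 (v (stage j i g i j) / diagabs j i g i).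

Lemma diagabs_other j i g r : r != i -> r != j ->
  diagabs j i.+1 g r = diagabs j i g r.
Proof.
move=> ri rj; rewrite /diagabs stageS /clear /rowop.
by rewrite (negbTE ri) (negbTE rj); case: ifP.
Qed.

Lemma growth_ge1 j i g : 1 <= growth j i g.
Proof. by rewrite le_max lexx. Qed.

(** Together with [diagabs_colS]: what a pivot gains, the diagonal entry of the
    column loses, since the operations preserve the absolute value of the
    determinant. *)
Lemma diagabs_row j i g : (i < j)%N -> 0 < diagabs j i g i ->
  diagabs j i.+1 g i = diagabs j i g i * growth j i g.
Proof.
move=> ij d0; rewrite /growth maxr_pMr ?(ltW d0)// mulr1 mulrCA divff ?gt_eqF// mulr1.
rewrite {1}/diagabs stageS /clear /rowop eqxx (ltn_eqF ij) /swapped -/(diagabs j i g i).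
by case: ltP.
Qed.

Lemma diagabs_colS j i g : unitriangular_from1 g -> (i < j)%N ->
  0 < diagabs j i g i ->
  diagabs j i.+1 g j = diagabs j i g j / growth j i g.
Proof.
move=> ug ij d0; have j0 : (0 < j)%N by exact: leq_ltn_trans ij.
rewrite !diagabs_col//; last exact: ltnW.
rewrite rowactS /rowop (gtn_eqF ij) eqxx (@rowact_unit_row0 g j i i) ?leqnn//.
rewrite mulr0 subr0 add0r /growth /pivot_ratio /swapped -/(diagabs j i g i).
case: ltP => H; last first.
  by rewrite (max_idPl _) ?divr1// ler_pdivrMr// mul1r.
rewrite (max_idPr _) ?ler_pdivlMr// ?mul1r ?(ltW H)//.
by rewrite (lavN lv) (lavM lv) (lavM lv) (lavV lv) invfM invrK /diagabs; ring.
Qed.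

Lemma diagabs_gt0 g j i : unitriangular_from1 g -> (i <= j)%N ->
  forall r, 0 < diagabs j i g r.
Proof.
move=> ug; move: j i; apply: stage_ind => [r|j IH r|j i ij IH r].
- rewrite /diagabs /stage /=; have [->|r0] := posnP r.
    exact: lav_gt0 lv _ (utf_diag0 ug).
  by rewrite (utf_diag ug)// (lav1 lv).
- by rewrite /diagabs stage_col; exact: IH.
have [->|ri] := eqVneq r i.
  by rewrite diagabs_row ?mulr_gt0// (lt_le_trans _ (growth_ge1 _ _ _)).
have [->|rj] := eqVneq r j.
  by rewrite diagabs_colS ?divr_gt0// (lt_le_trans _ (growth_ge1 _ _ _)).
by rewrite diagabs_other.
Qed.

Lemma stage_lower g j i : unitriangular_from1 g -> (i <= j)%N ->
  (forall r c, (r < c)%N -> (c < j)%N -> stage j i g r c = 0) /\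
  (forall r, (r < i)%N -> stage j i g r j = 0).
Proof.
move=> ug; move: j i; apply: stage_ind => [//|j [IH1 IH2]|j i ij [IH1 IH2]].
  rewrite stage_col; split => // r c rc; rewrite ltnS leq_eqVlt => /predU1P[cj|cj].
    by rewrite cj IH2// -cj.
  exact: IH1.
have d0 := diagabs_gt0 ug (ltnW ij) i.
have Bii : stage j i g i i != 0 by rewrite -(lav_eq0 lv) gt_eqF.
split=> [r c rc cj|r].
  rewrite stageS /clear /rowop (ltn_eqF cj).
  case: ifP => _; last exact: IH1.
  have [ci|_] := eqVneq c i; last exact: IH1.
  by rewrite IH2// -ci.
rewrite ltnS stageS /clear /rowop (gtn_eqF ij) eqxx leq_eqVlt => /predU1P[->|ri].
  rewrite /pivot_ratio; case: ifPn => [H|/negbTE->]; last by rewrite mulfVK// subrr.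
  rewrite H.
  rewrite mulfVK ?subrr//; apply: contraTneq H => H0.
  by rewrite /swapped H0 (lav0 lv) -leNgt (lav_ge0 lv).
by rewrite (IH1 _ _ ri ij) (IH2 _ ri) mulr0 subr0; case: ifP.
Qed.

(** With the other entries fixed, so are the operations of the previous stages;
    they are linear on rows, hence the next pivot candidate is affine in the
    entry, with slope the current diagonal entry of its column. *)
Lemma stage_entry_affine g g' j i : unitriangular_from1 g -> (i < j)%N ->
  (forall r c, (r, c) != (i, j) -> g' r c = g r c) ->
  stage j i g' i j = stage j i g i j +
    (g' i j - g i j) * rowact g j i (unit_row j) j.
Proof.
move=> ug ij gg'; have ij' := ltnW ij.
rewrite !stage_rowact//.
have -> : rowact g' j i = rowact g j i.
  apply: rowact_dep => // r c H; apply: gg'; apply: contraTneq H => -[-> ->].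
  by rewrite !ltnn andbF.
have E : g' i = (fun c => g i c + (g' i j - g i j) * unit_row j c).
  apply/funext => c; rewrite /unit_row; have [->|cj] := eqVneq c j.
    by rewrite mulr1 subrKC.
  by rewrite mulr0 addr0 gg'// xpair_eqE (negbTE cj) andbF.
by rewrite [in LHS]E rowact_linear.
Qed.

Lemma diagabs_indep g g' j i r : (i < j)%N ->
  (forall r c, (r, c) != (i, j) -> g' r c = g r c) ->
  diagabs j i g' r = diagabs j i g r.
Proof.
move=> ij gg'; have ij' := ltnW ij.
rewrite /diagabs !stage_rowact//; congr v.
have -> : rowact g' j i = rowact g j i.
  apply: rowact_dep => // r' c H; apply: gg'; apply: contraTneq H => -[-> ->].
  by rewrite !ltnn andbF.
have [->|ri] := eqVneq r i; last first.
  suff -> : g' r = g r by [].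
  by apply/funext => c; apply: gg'; rewrite xpair_eqE (negbTE ri).
have -> : g' i = (fun c => g i c + (g' i j - g i j) * unit_row j c).
  apply/funext => c; rewrite /unit_row; have [->|cj] := eqVneq c j.
    by rewrite mulr1 subrKC.
  by rewrite mulr0 addr0 gg'// xpair_eqE (negbTE cj) andbF.
by rewrite rowact_linear// rowact_unit_row0 ?leqnn// mulr0 addr0.
Qed.

End Elimination.

(** * Integrating out one entry *)
Section StageIntegral.
Context (R : realType) (K : localFieldType) (v : K -> R).
Hypothesis lv : local_absval v.
Context (mu : {sigma_finite_measure set (borel K) -> \bar R}).
Hypothesis hmu : haar_measure mu.
Context (n : nat).
Implicit Types (g : nat -> nat -> K) (e : nat -> R) (i j r c : nat).

(** At the last stage, the absolute value of a character of the lower triangular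
    group at the triangular factor. *)
Definition weight j i e g : R := \prod_(r < n) diagabs v j i g r `^ e r.

Lemma weight_ge0 j i e g : 0 <= weight j i e g.
Proof. by apply: prodr_ge0 => r _; exact: powR_ge0. Qed.

Lemma weightD j i e e' g : unitriangular_from1 g -> (i <= j)%N ->
  weight j i (fun r => e r + e' r) g = weight j i e g * weight j i e' g.
Proof.
move=> ug ij; rewrite /weight -big_split /=; apply: eq_bigr => r _.
by rewrite powR_gt0D// (diagabs_gt0 lv).
Qed.

Definition shift_exponent i j : nat -> R := fun r => (r == i)%:R - (r == j)%:R.

Lemma prod_two (F : nat -> R) i j : (i < n)%N -> (j < n)%N -> i != j ->
  (forall r, r != i -> r != j -> F r = 1) -> \prod_(r < n) F r = F i * F j.
Proof.
move=> iN jN ij F1; rewrite (bigD1 (Ordinal iN))//= (bigD1 (Ordinal jN))/=.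
  by rewrite big1 ?mulr1// => r /andP[ri rj]; exact: F1.
by rewrite eq_sym.
Qed.

Lemma weight_shift j i g : (i < j < n)%N -> unitriangular_from1 g ->
  weight j i (shift_exponent i j) g = diagabs v j i g i / diagabs v j i g j.
Proof.
move=> /andP[ij jn] ug; have d0 := diagabs_gt0 lv ug (ltnW ij).
pose F r := diagabs v j i g r `^ shift_exponent i j r.
rewrite /weight (_ : \prod_(r < n) _ = F i * F j).
  rewrite /F /shift_exponent !eqxx (ltn_eqF ij) (gtn_eqF ij) subr0 sub0r.
  by rewrite powRr1 ?(ltW (d0 _))// powR_inv1// ltW.
apply: prod_two; rewrite ?(ltn_trans ij) ?ltn_eqF// => r /negbTE ri /negbTE rj.
by rewrite /F /shift_exponent ri rj subrr powRr0.
Qed.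

Lemma weightS j i e g : (i < j < n)%N -> unitriangular_from1 g ->
  weight j i.+1 e g = weight j i e g * growth v j i g `^ (e i - e j).
Proof.
move=> /andP[ij jn] ug; have d0 := diagabs_gt0 lv ug (ltnW ij).
have m0 : 0 < growth v j i g by rewrite (lt_le_trans ltr01)// growth_ge1.
have E r : diagabs v j i.+1 g r =
    diagabs v j i g r * growth v j i g `^ shift_exponent i j r.
  rewrite /shift_exponent; have [->|ri] := eqVneq r i.
    by rewrite diagabs_row// (ltn_eqF ij) subr0 powRr1// ltW.
  have [->|rj] := eqVneq r j.
    by rewrite (diagabs_colS lv)// sub0r powR_inv1// ltW.
  by rewrite diagabs_other// subrr powRr0 mulr1.
rewrite /weight; under eq_bigr do rewrite E powRM ?powR_ge0 ?(ltW (d0 _))// -powRrM.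
rewrite big_split /=; congr (_ * _).
pose F r := growth v j i g `^ (shift_exponent i j r * e r).
rewrite (_ : \prod_(r < n) _ = F i * F j).
  rewrite /F /shift_exponent !eqxx (ltn_eqF ij) (gtn_eqF ij) subr0 sub0r.
  by rewrite mul1r mulN1r powR_gt0D.
apply: prod_two; rewrite ?(ltn_trans ij) ?ltn_eqF// => r /negbTE ri /negbTE rj.
by rewrite /F /shift_exponent ri rj subrr mul0r powRr0.
Qed.

Definition set_entry g i j (y : K) : nat -> nat -> K :=
  fun r c => if (r == i) && (c == j) then y else g r c.

Lemma set_entry_unitriangular g i j y : (i < j)%N -> unitriangular_from1 g ->
  unitriangular_from1 (set_entry g i j y).
Proof.
move=> ij [gl gd g0]; split => [r c cr|r r0|]; rewrite /set_entry.
- case: andP => [[/eqP ri /eqP cj]|_]; last exact: gl.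
  by move: cr; rewrite ri cj ltnNge (ltnW ij).
- case: andP => [[/eqP ri /eqP rj]|_]; last exact: gd.
  by move: ij; rewrite -ri -rj ltnn.
- by case: andP => [[/eqP i0 /eqP j0]|//]; move: ij; rewrite -i0 -j0.
Qed.

Lemma measurable_affine_decay (q d : R) (s b : K) :
  measurable_fun setT (fun y : borel K => Num.max 1 (v (s * (y : K) + b) / d) `^ q).
Proof.
apply: (measurableT_comp (measurable_powR q)).
apply: measurable_maxr => //; apply: measurable_funM => //.
apply: (@borel_continuousR R K (fun y => v (s * y + b))) => y.
apply: (@continuous_comp K K R (fun y => s * y + b) v).
  rewrite (_ : (fun y => _) = (fun z => b + z) \o (fun z => s * z)).
    by apply: continuous_comp; [exact: continuous_mull|exact: continuous_addl].
  by apply/funext => z /=; rewrite addrC.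
exact: (lav_continuous lv).
Qed.

(** Integrating out one entry: the new weight carries the Jacobian of the
    affine substitution of [stage_entry_affine]. *)
Lemma integral_stage j i e : (i < j < n)%N -> e i - e j < - 1 ->
  exists2 C : R, 0 <= C & forall g, unitriangular_from1 g ->
  (\int[mu]_y (weight j i.+1 e (set_entry g i j y))%:E <=
    (C * weight j i (fun r => e r + shift_exponent i j r)%R g)%:E)%E.
Proof.
move=> ijn eij; have /andP[ij jn] := ijn.
have [C C0 HC] := integral_decay lv hmu (q := e j - e i) ltac:(lra).
exists C => // g ug; have ij' := ltnW ij.
have d0 := diagabs_gt0 lv ug ij'.
set u := rowact v g j i (unit_row K j) j.
have vu : v u = diagabs v j i g j by rewrite diagabs_col// (leq_ltn_trans _ ij).
have u0 : u != 0 by rewrite -(lav_eq0 lv) vu gt_eqF.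
(* [u * y + b] is the pivot candidate as a function of the entry [y] *)
pose b := stage v j i g i j - g i j * u.
have same y r c : (r, c) != (i, j) -> set_entry g i j y r c = g r c.
  by rewrite xpair_eqE /set_entry => /negbTE ->.
have E y : weight j i.+1 e (set_entry g i j y) = weight j i e g *
    Num.max 1 (v (u * y + b) / diagabs v j i g i) `^ (- (e j - e i)).
  rewrite weightS//; last exact: set_entry_unitriangular.
  rewrite opprB; congr (_ * _ `^ _).
    by apply: eq_bigr => r _; rewrite (diagabs_indep _ _ ij (same y)).
  rewrite /growth (diagabs_indep _ _ ij (same y)) (stage_entry_affine _ ug ij (same y)).
  rewrite -/u {1}/set_entry !eqxx /=; congr (Num.max _ (v _ / _)).
  by rewrite /b; ring.
under eq_integral do rewrite E EFinM.
rewrite ge0_integralZl ?lee_fin ?weight_ge0//; last 2 first.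
- by apply/measurable_EFinP; exact: measurable_affine_decay.
- by move=> y _; rewrite lee_fin powR_ge0.
rewrite weightD// weight_shift// mulrCA EFinM -vu; apply: lee_wpmul2l.
  by rewrite lee_fin weight_ge0.
exact: HC.
Qed.

End StageIntegral.

(** * The compact factor of the elimination *)
Section StageFactorization.
Context (R : realType) (K : localFieldType) (v : K -> R).
Hypothesis lv : local_absval v.
Context (n : nat).
Local Notation M := 'M[K]_n.

Definition mx_of (g : nat -> nat -> K) : M := \matrix_(r, c) g r c.

Definition pivot_mx (i j : 'I_n) (s : bool) (tau : K) : M :=
  (1%:M + tau *: delta_mx i j) *m (if s then tperm_mx i j else 1%:M).

Lemma pivot_mx_unit i j s tau : i != j -> pivot_mx i j s tau \in unitmx.
Proof.
move=> ij; rewrite unitmx_mul; apply/andP; split; last first.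
  by case: s; rewrite ?unitmx1 ?unitmx_perm.
suff /mulmx1_unit[] : (1%:M + tau *: delta_mx i j) *m (1%:M - tau *: delta_mx i j) = 1%:M :> M by [].
rewrite mulmxDl mul1mx mulmxBr mulmx1 -scalemxAl -scalemxAr mul_delta_mx_0 1?eq_sym//.
by rewrite !scaler0 subr0 subrK.
Qed.

Lemma clear_factor (i j : 'I_n) B : i != j ->
  mx_of B = mx_of (clear v i j B) *m
    pivot_mx i j (swapped v i j B) (pivot_ratio v i j B).
Proof.
move=> ij; have ij' : (i == j :> nat) = false by exact: negbTE.
set s := swapped v i j B; set tau := pivot_ratio v i j B.
have H (A : M) r c : (A *m (1%:M + tau *: delta_mx i j)) r c =
    A r c + (c == j)%:R * (tau * A r i).
  rewrite mulmxDr mulmx1 -scalemxAr !mxE; congr (_ + _).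
  rewrite (bigD1 i)//= big1 => [|k ki].
    by rewrite !mxE eqxx addr0 /= mulrCA mulrC mulrA mulrC eq_sym; ring.
  by rewrite !mxE (negbTE ki) mulr0.
have ji' : (j == i :> nat) = false by rewrite eq_sym.
have ji : (j == i) = false by rewrite eq_sym (negbTE ij).
apply/matrixP => r c; rewrite /pivot_mx mulmxA.
case: (boolP s) => sE; last first.
  rewrite mulmx1 H !mxE /clear /rowop -/s (negbTE sE) -/tau.
  have [->|cj] := eqVneq c j; last by rewrite mul0r addr0 (negbTE (cj : (c : nat) != j)).
  by rewrite eqxx ij' mul1r subrK.
rewrite -xcolE [in RHS]mxE H !mxE /clear /rowop -/s sE -/tau.
have [->|ci] := eqVneq c i.
  by rewrite tpermL !eqxx ji' mul1r subrK.
have [->|cj] := eqVneq c j.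
  by rewrite tpermR eqxx (negbTE ij) mul0r addr0.
have ic : i != c by rewrite eq_sym.
have jc : j != c by rewrite eq_sym.
have ci' : (c == i :> nat) = false by exact: negbTE.
have cj' : (c == j :> nat) = false by exact: negbTE.
by rewrite tpermD// ?ci' ?cj' ?(negbTE cj) mul0r addr0.
Qed.

Lemma continuous_to_mx (S : topologicalType) (f : S -> M) (x : S) :
  (forall i j, {for x, continuous (fun t => f t i j)}) -> {for x, continuous f}.
Proof.
move=> cf U [P xP PU].
have H : \forall t \near x, forall ij : 'I_n * 'I_n, P ij.1 ij.2 (f t ij.1 ij.2).
  by apply: filter_forall => -[i j]; exact: (cf i j _ (xP i j)).
by apply: filterS H => t H; apply: PU => i j; exact: (H (i, j)).
Qed.

Lemma continuous_mx_entry p q (i : 'I_p) (j : 'I_q) :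
  continuous (fun x : 'M[K]_(p, q) => x i j).
Proof.
move=> x U /= Ux; exists (fun i' j' => if (i' == i) && (j' == j) then U else setT).
  by move=> i' j'; case: ifPn => [/andP[/eqP -> /eqP ->]//|_]; exact: filterT.
by move=> y /(_ i j); rewrite !eqxx.
Qed.

Lemma continuous_addK (S : topologicalType) (f h : S -> K) (x : S) :
  {for x, continuous f} -> {for x, continuous h} ->
  {for x, continuous (fun t => f t + h t)}.
Proof. by move=> cf ch; exact: (cvg_comp2 cf ch (add_continuous (f x, h x))). Qed.

Lemma continuous_mulK (S : topologicalType) (f h : S -> K) (x : S) :
  {for x, continuous f} -> {for x, continuous h} ->
  {for x, continuous (fun t => f t * h t)}.
Proof. by move=> cf ch; exact: (cvg_comp2 cf ch (lf_mul_continuous (f x, h x))). Qed.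

Lemma continuous_sumK (S : topologicalType) (I : Type) (s : seq I)
    (F : I -> S -> K) (x : S) : (forall i, {for x, continuous (F i)}) ->
  {for x, continuous (fun t => \sum_(i <- s) F i t)}.
Proof.
move=> cF; elim: s => [|i s IH].
  rewrite (_ : (fun t => _) = cst 0); first exact: cst_continuous.
  by apply/funext => t; rewrite big_nil.
rewrite (_ : (fun t => _) = fun t => F i t + \sum_(i <- s) F i t).
  exact: continuous_addK.
by apply/funext => t; rewrite big_cons.
Qed.

Lemma continuous_mulmxK (S : topologicalType) (f h : S -> M) (x : S) :
  {for x, continuous f} -> {for x, continuous h} ->
  {for x, continuous (fun t => f t *m h t)}.
Proof.
have E (f' : S -> M) i j : {for x, continuous f'} -> {for x, continuous (fun t => f' t i j)}.
  by move=> cf; exact: (continuous_comp cf (@continuous_mx_entry n n i j (f' x))).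
move=> cf ch; apply: continuous_to_mx => i j.
rewrite (_ : (fun t => _) = fun t => \sum_k f t i k * h t k j); last first.
  by apply/funext => t; rewrite mxE.
by apply: continuous_sumK => k; apply: continuous_mulK; exact: E.
Qed.

Definition pivot_mxs (i j : 'I_n) : set M :=
  [set pivot_mx i j false tau | tau in vball v 1] `|`
  [set pivot_mx i j true tau | tau in vball v 1].

Lemma compact_pivot_mxs i j : compact (pivot_mxs i j).
Proof.
have H s : compact [set pivot_mx i j s tau | tau in vball v 1].
  apply: continuous_compact; last exact: compact_ball.
  apply: continuous_subspaceT => tau.
  apply: (@continuous_mulmxK _ (fun tau => 1%:M + tau *: delta_mx i j)
    (fun=> if s then tperm_mx i j else 1%:M)); last exact: cst_continuous.
  apply: continuous_to_mx => r c.
  rewrite (_ : (fun t => _) = fun t => (r == c)%:R + t * ((r == i) && (c == j))%:R); last first.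
    by apply/funext => t; rewrite !mxE.
  apply: (@continuous_addK _ (fun=> (r == c)%:R)); first exact: cst_continuous.
  apply: (@continuous_mulK _ id (fun=> ((r == i) && (c == j))%:R)).
    exact: cvg_id.
  exact: cst_continuous.
exact: compactU.
Qed.

Lemma pivot_ratio_le1 i j B : v (pivot_ratio v i j B) <= 1.
Proof.
rewrite /pivot_ratio /swapped; case: ltP => H; rewrite (lavM lv) (lavV lv).
  by rewrite ler_pdivrMr ?mul1r ?ltW// (le_lt_trans _ H)// (lav_ge0 lv).
have [->|B0] := eqVneq (B i i) 0; first by rewrite (lav0 lv) invr0 mulr0 ler01.
by rewrite ler_pdivrMr ?mul1r// (lav_gt0 lv).
Qed.

Definition compact_unitmx (Q : set M) : Prop :=
  compact Q /\ forall q, Q q -> q \in unitmx.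

(** The column operations used up to a given stage lie in a fixed compact set;
    this plays the part of the maximal compact subgroup. *)
Lemma stage_factor j i : (i <= j)%N -> (j < n)%N ->
  exists2 Q : set M, compact_unitmx Q &
  forall g, exists2 q, Q q & mx_of g = mx_of (stage v j i g) *m q.
Proof.
move: j i; apply: stage_ind => [_|j IH jn|j i ij IH jn].
- exists [set 1%:M]; first by split; [exact: compact_set1|move=> _ ->; exact: unitmx1].
  by move=> g; exists 1%:M => //; rewrite mulmx1.
- by have [Q cQ HQ] := IH (ltnW jn); exists Q.
have [Q [cQ uQ] HQ] := IH jn.
pose i' := Ordinal (ltn_trans ij jn); pose j' := Ordinal jn.
have ij' : i' != j' by rewrite -val_eqE /= ltn_eqF.
exists [set p.1 *m p.2 | p in pivot_mxs i' j' `*` Q].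
  split.
    apply: continuous_compact; last first.
      by apply: compact_setX => //; exact: compact_pivot_mxs.
    apply: continuous_subspaceT => p.
    apply: (@continuous_mulmxK _ (fun p : M * M => p.1) (fun p : M * M => p.2)).
      exact: cvg_fst.
    exact: cvg_snd.
  move=> _ [[s q] /= [Es Qq] <-]; rewrite unitmx_mul; apply/andP; split; last exact: uQ.
  by case: Es => -[tau _ <-]; exact: pivot_mx_unit.
move=> g; have [q Qq gq] := HQ g.
pose B := stage v j i g.
exists (pivot_mx i' j' (swapped v i j B) (pivot_ratio v i j B) *m q).
  exists (pivot_mx i' j' (swapped v i j B) (pivot_ratio v i j B), q) => //=; split => //=.
  have H : vball v 1 (pivot_ratio v i j B) by exact: pivot_ratio_le1.
  by case: swapped; [right|left]; exists (pivot_ratio v i j B).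
by rewrite gq mulmxA -(@clear_factor i' j').
Qed.

End StageFactorization.

(** * Measurability of the elimination *)
Section MeasurableStages.
Context (R : realType) (K : localFieldType) (v : K -> R).
Hypothesis lv : local_absval v.
Context d (T : measurableType d).

Definition pair_mx (x y : K) : 'M[K]_(1, 2) := \matrix_(i, j) if j == ord0 then x else y.

Lemma measurable_op2 (op : K -> K -> K) (D : set T) (f h : T -> borel K) :
  measurable D -> (forall X : 'M[K]_(1, 2),
    {for X, continuous (fun Y : 'M[K]_(1, 2) => op (Y ord0 ord0) (Y ord0 ord_max))}) ->
  measurable_fun D f -> measurable_fun D h ->
  measurable_fun D (fun t => op (f t) (h t) : borel K).
Proof.
move=> mD cop mf mh.
have := @measurable_continuous_mxK R K v lv d T D 1 2 mD
  (fun t => pair_mx (f t) (h t)) _ setT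
  (fun Y => op (Y ord0 ord0) (Y ord0 ord_max)).
rewrite (_ : _ \o _ = fun t => op (f t) (h t)); last first.
  by apply/funext => t /=; rewrite !mxE.
apply => //; last exact: openT.
move=> i j; rewrite (_ : (fun t => _) = if j == ord0 then f else h).
  by case: ifP.
by apply/funext => t; rewrite mxE; case: ifP.
Qed.

Lemma measurable_addK (D : set T) (f h : T -> borel K) : measurable D ->
  measurable_fun D f -> measurable_fun D h ->
  measurable_fun D (fun t => (f t : K) + (h t : K) : borel K).
Proof.
move=> mD; apply: (measurable_op2 (op := fun x y => x + y)) => // X.
by apply: continuous_addK; exact: continuous_mx_entry.
Qed.

Lemma measurable_mulK (D : set T) (f h : T -> borel K) : measurable D ->
  measurable_fun D f -> measurable_fun D h ->
  measurable_fun D (fun t => (f t : K) * (h t : K) : borel K).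
Proof.
move=> mD; apply: (measurable_op2 (op := fun x y => x * y)) => // X.
by apply: continuous_mulK; exact: continuous_mx_entry.
Qed.

Lemma borel_set1 (a : K) : measurable ([set a] : set (borel K)).
Proof.
apply: closed_borel; apply: accessible_closed_set1; apply: hausdorff_accessible.
exact: lf_hausdorff.
Qed.

Lemma measurable_invK : measurable_fun setT (fun x : borel K => (x : K)^-1 : borel K).
Proof.
apply: (@measurability _ _ (borel K) (borel K) setT (@GRing.inv K) (@open K)) => //.
move=> _ [U oU <-]; rewrite setTI.
rewrite (_ : _ @^-1` U = ([set x | x != 0] `&` (@GRing.inv K) @^-1` U) `|`
    ([set 0] `&` (@GRing.inv K) @^-1` U)).
  apply: (@measurableU _ (borel K)).
    apply: open_borel; rewrite openE => x [x0 Ux]; apply: filterI.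
      apply: open_nbhs_nbhs; split => //.
      rewrite (_ : [set x : K | x != 0] = ~` [set 0]); last first.
        by apply/seteqP; split => z /= /eqP.
      by rewrite openC; apply: accessible_closed_set1; apply: hausdorff_accessible;
        exact: lf_hausdorff.
    have H : {for x, continuous (@GRing.inv K)} by exact: lf_inv_continuous.
    exact: (H U (open_nbhs_nbhs (conj oU Ux))).
  case: (pselect (U 0)) => U0.
    rewrite (_ : _ `&` _ = [set 0]); first exact: borel_set1.
    by apply/seteqP; split => [x []//|x -> /=]; split => //=; rewrite invr0.
  rewrite (_ : _ `&` _ = set0); first exact: (@measurable0 _ (borel K)).
  by apply/seteqP; split => // x [-> /=]; rewrite invr0.
apply/seteqP; split => [x Ux|x [[]|[]]//].
by have [x0|x0] := eqVneq x 0; [right|left].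
Qed.

Lemma measurable_lav_comp (D : set T) (f : T -> borel K) : measurable_fun D f ->
  measurable_fun D (fun t => v (f t)).
Proof. by move=> mf; apply: (measurableT_comp (measurable_lav lv)). Qed.

Lemma measurable_stage (phi : T -> nat -> nat -> K) :
  (forall r c, measurable_fun setT (fun t => phi t r c : borel K)) ->
  forall j i, (i <= j)%N -> forall r c,
  measurable_fun setT (fun t => stage v j i (phi t) r c : borel K).
Proof.
move=> mphi; apply: stage_ind => [//|j IH r c|j i ij IH r c]; first exact: IH.
pose B t := stage v j i (phi t).
have mB r' c' : measurable_fun setT (fun t => B t r' c' : borel K) by exact: IH.
have ms : measurable_fun setT (fun t => swapped v i j (B t)).
  by apply: measurable_fun_ltr; exact: measurable_lav_comp.
have mdiv f h : measurable_fun setT (f : T -> borel K) ->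
    measurable_fun setT (h : T -> borel K) ->
    measurable_fun setT (fun t => (f t : K) / (h t : K) : borel K).
  move=> mf mh; apply: measurable_mulK => //.
  exact: (measurableT_comp measurable_invK).
have mp : measurable_fun setT (fun t => pivot_ratio v i j (B t) : borel K).
  by apply: measurable_fun_ifT => //; exact: mdiv.
have msub k l : measurable_fun setT
    (fun t => B t r k - pivot_ratio v i j (B t) * B t r l : borel K).
  apply: measurable_addK => //.
  rewrite (_ : (fun t => _) = fun t => (- 1) * (pivot_ratio v i j (B t) * B t r l)).
    by apply: measurable_mulK => //; exact: measurable_mulK.
  by apply/funext => t; rewrite mulN1r.
rewrite (_ : (fun t => _) = fun t => if swapped v i j (B t)
  then (if c == i then B t r j
        else if c == j then B t r i - pivot_ratio v i j (B t) * B t r j else B t r c)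
  else (if c == j then B t r j - pivot_ratio v i j (B t) * B t r i else B t r c)) //.
apply: measurable_fun_ifT => //; last by case: (c == j).
by case: (c == i) => //; case: (c == j).
Qed.

Lemma measurable_weight n (phi : T -> nat -> nat -> K) :
  (forall r c, measurable_fun setT (fun t => phi t r c : borel K)) ->
  forall j i e, (i <= j)%N -> measurable_fun setT (fun t => weight v n j i e (phi t)).
Proof.
move=> mphi j i e ij; apply: measurable_prod => r _.
apply: (measurableT_comp (measurable_powR (e r))); apply: measurable_lav_comp.
exact: measurable_stage.
Qed.

End MeasurableStages.

(** * Coordinates on the group R *)
Section Coordinates.
Context (R : realType) (K : localFieldType) (n : nat) (hn : (2 <= n)%N).
Local Notation N := #|R_coords hn|.
Implicit Types (x : N.-tuple (borel K)) (r c i j : nat).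

Definition coord (x : N.-tuple (borel K)) r c : K :=
  if (insub r, insub c) is (Some i, Some j) then
    nth 0 (x : seq K) (index (i, j) (enum (R_coords hn))) else 0.

Lemma coord_ord x (i j : 'I_n) :
  coord x i j = nth 0 (x : seq K) (index (i, j) (enum (R_coords hn))).
Proof. by rewrite /coord !valK. Qed.

Definition is_coord r c := [&& (r < c)%N, (c < n)%N & (c != 1)%N].

Lemma mem_R_coords (i j : 'I_n) : ((i, j) \in R_coords hn) = is_coord i j.
Proof. by rewrite inE /is_coord /= ltn_ord. Qed.

Lemma coord0 x r c : ~~ is_coord r c -> coord x r c = 0.
Proof.
rewrite /coord; case: insubP => [i _ <-|//]; case: insubP => [j _ <-|//].
rewrite -mem_R_coords => ij; rewrite memNindex ?mem_enum// nth_default//.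
by rewrite size_tuple cardE.
Qed.

Lemma index_coord (p : 'I_n * 'I_n) : p \in R_coords hn ->
  (index p (enum (R_coords hn)) < N)%N.
Proof. by move=> pR; rewrite cardE index_mem mem_enum. Qed.

Lemma coord_index r c : is_coord r c -> exists k : 'I_N, forall x,
  coord x r c = tnth x k /\
  forall y, coord (upd k y x) r c = y /\
    forall r' c', (r', c') != (r, c) -> coord (upd k y x) r' c' = coord x r' c'.
Proof.
move=> rc; have /and3P[rltc cn _] := rc; have rn := ltn_trans rltc cn.
have pR : (Ordinal rn, Ordinal cn) \in R_coords hn by rewrite mem_R_coords.
exists (Ordinal (index_coord pR)) => x.
have E z : coord z r c = tnth z (Ordinal (index_coord pR)).
  by rewrite (coord_ord z (Ordinal rn) (Ordinal cn)) (tnth_nth 0).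
split => // y; split => [|r' c' rc']; first by rewrite E tnth_upd eqxx.
have [rc'R|rc'R] := boolP (is_coord r' c'); last by rewrite !coord0.
have /and3P[r'c' c'n _] := rc'R; have r'n := ltn_trans r'c' c'n.
have pR' : (Ordinal r'n, Ordinal c'n) \in R_coords hn by rewrite mem_R_coords.
have E' z : coord z r' c' = tnth z (Ordinal (index_coord pR')).
  by rewrite (coord_ord z (Ordinal r'n) (Ordinal c'n)) (tnth_nth 0).
rewrite !E' tnth_upd -val_eqE /=.
case: eqP => // /index_inj; rewrite !mem_enum => /(_ (Ordinal r'n, Ordinal c'n) pR' pR) [e1 e2].
by exfalso; move/negP: rc'; apply; rewrite e1 e2.
Qed.

Lemma measurable_coord r c : measurable_fun setT
  (fun x : N.-tuple (borel K) => coord x r c : borel K).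
Proof.
have [/coord_index[k Hk]|rc] := boolP (is_coord r c).
  rewrite (_ : (fun _ => _) = fun x => tnth x k); first exact: measurable_tnth.
  by apply/funext => x; have [] := Hk x.
rewrite (_ : (fun _ => _) = cst 0); first exact: measurable_cst.
by apply/funext => x; rewrite coord0.
Qed.

(** The matrix [w1 * R_elt a x] for [J = n]; smaller values of [J] interpolate
    to the matrix whose entries are independent variables. *)
Definition sheared_mx J (a : K) x : nat -> nat -> K := fun r c =>
  if r == c then (if r == 0%N then a else 1)
  else if (r == 0%N) && (c == 1%N) then 1
  else if (r < c)%N then
    coord x r c + (if (r == 0%N) && (c < J)%N then coord x 1 c else 0)
  else 0.

Lemma sheared_mx_unitriangular J a x : a != 0 ->
  unitriangular_from1 (sheared_mx J a x).
Proof.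
move=> a0; split => [r c cr|r r0|]; rewrite /sheared_mx.
- rewrite gtn_eqF// ltnNge (ltnW cr) /=.
  by case: andP => // -[/eqP r0 _]; move: cr; rewrite r0.
- by rewrite eqxx gtn_eqF.
- by rewrite !eqxx.
Qed.

Lemma w1_mulmx (X : 'M[K]_n) (i j : 'I_n) : (w1 K hn *m X) i j =
  X i j + (if i == idx1 hn then X (idx2 hn) j else 0).
Proof.
have w1E k l : w1 K hn k l = (k == l)%:R + ((k == idx1 hn) && (l == idx2 hn))%:R.
  rewrite mxE; have [->|_] := eqVneq k l; last by rewrite add0r.
  by rewrite /=; case: eqVneq => [->|_]; rewrite addr0.
rewrite mxE; under eq_bigr do rewrite w1E mulrDl; rewrite big_split /=; congr (_ + _).
  rewrite (bigD1 i)//= eqxx mul1r big1 ?addr0// => k ki.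
  by rewrite eq_sym (negbTE ki) mul0r.
case: ifP => _; last by rewrite big1// => k _; rewrite mul0r.
rewrite (bigD1 (idx2 hn))//= ?eqxx mul1r big1 ?addr0// => k k2.
by rewrite (negbTE k2) mul0r.
Qed.

Lemma w1_R_elt a x : w1 K hn *m R_elt a x = mx_of n (sheared_mx n a x).
Proof.
have RE (i j : 'I_n) : R_elt a x i j =
    if i == j :> nat then (if i == 0%N :> nat then a else 1) else coord x i j.
  by rewrite mxE coord_ord.
have C0 r c : (c <= r)%N || (c == 1)%N -> coord x r c = 0.
  move=> H; apply: coord0; apply: contraTN H => /and3P[rc _ c1].
  by rewrite negb_or -ltnNge rc.
apply/matrixP => i j; rewrite w1_mulmx !RE [RHS]mxE /sheared_mx -val_eqE /=.
have [i0|i0] := eqVneq (i : nat) 0%N; last first.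
  rewrite addr0; case: eqVneq => // ij.
  by case: ltnP => [_|ji]; rewrite ?addr0// C0// ji.
rewrite i0; case: j => -[|[|j]] jn //=.
- by rewrite C0 ?addr0.
- by rewrite C0 ?add0r.
- by rewrite jn.
Qed.

Lemma sheared_mx_upd i j : is_coord i j -> exists k : 'I_N, forall a x y,
  [/\ coord (upd k y x) i j = y,
    forall r c, (r, c) != (i, j) -> coord (upd k y x) r c = coord x r c &
    sheared_mx 0 a (upd k y x) = set_entry (sheared_mx 0 a x) i j y].
Proof.
move=> ij; have [k Hk] := coord_index ij; exists k => a x y.
have [E /(_ y)[Hy Ho]] := Hk x; split => //.
have /and3P[ij' _ j1] := ij.
apply/funext => r; apply/funext => c; rewrite /set_entry /sheared_mx /= andbF.
have [rc|rc] := eqVneq r c.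
  by case: andP => // -[/eqP ri /eqP cj]; move: ij'; rewrite -ri -cj rc ltnn.
have [/eqP rci|rci] := boolP ((r, c) == (i, j)).
  case: rci => -> ->; rewrite !eqxx (negbTE j1) andbF /= ij' Hy addr0.
  by [].
move: (rci); rewrite xpair_eqE => /negbTE ->.
by rewrite Ho// /= andbF.
Qed.

Lemma sheared_mx_shear J : is_coord 0%N J -> exists k : 'I_N, forall a x,
  exists b : K, forall y, sheared_mx J.+1 a (upd k y x) = sheared_mx J a (upd k ((y : K) + b : borel K) x).
Proof.
move=> J0; have [k Hk] := coord_index J0; exists k => a x.
have [E H] := Hk x; exists (coord x 1 J) => y.
have [Hy Ho] := H y; have [Hyb Hob] := H ((y : K) + coord x 1 J : borel K).
apply/funext => r; apply/funext => c; rewrite /sheared_mx.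
case: (r == c) => //; case: ifP => // _; case: ifP => // _.
have [/eqP[-> ->]|rc] := boolP ((r, c) == (0%N, J)).
  by rewrite /= ltnSn ltnn addr0 Hy Hyb Ho.
rewrite Ho// Hob//; congr (_ + _); move: rc; rewrite xpair_eqE ltnS leq_eqVlt.
case: (eqVneq r 0%N) => //= _ /negbTE -> /=; case: ifP => // cJ.
by rewrite Ho// Hob.
Qed.

Lemma sheared_mx_noshear J a x : ~~ is_coord 0%N J ->
  sheared_mx J.+1 a x = sheared_mx J a x.
Proof.
move=> J0; apply/funext => r; apply/funext => c; rewrite /sheared_mx.
have [//|rc] := eqVneq r c; case: ifPn => // rc1; case: ifP => // rltc.
congr (_ + _); rewrite ltnS leq_eqVlt; have [r0|//] := eqVneq r 0%N.
have [cJ|//] := eqVneq c J.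
rewrite /= cJ ltnn coord0//; apply: contra J0 => /and3P[_ Jn J1].
by rewrite /is_coord Jn J1 -cJ -r0 rltc.
Qed.

Lemma measurable_sheared_mx (v : K -> R) J a r c : local_absval v ->
  measurable_fun setT (fun x : N.-tuple (borel K) => sheared_mx J a x r c : borel K).
Proof.
move=> lv; rewrite /sheared_mx; case: (r == c); first exact: measurable_cst.
case: (_ && _); first exact: measurable_cst.
case: (r < c)%N; last exact: measurable_cst.
apply: (measurable_addK lv) => //; first exact: measurable_coord.
by case: (_ && _); [exact: measurable_coord|exact: measurable_cst].
Qed.

End Coordinates.

(** * The integral over the unipotent entries *)
Section IteratedIntegral.
Context (R : realType) (K : localFieldType) (v : K -> R).
Hypothesis lv : local_absval v.
Context (mu : {sigma_finite_measure set (borel K) -> \bar R}).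
Hypothesis hmu : haar_measure mu.
Context (n : nat) (hn : (2 <= n)%N).
Local Notation N := #|R_coords hn|.
Context (nu : nat -> R).
Hypothesis hnu : forall i j : nat, (i < j < n)%N -> (1 < j)%N -> nu i < nu j.
Implicit Types (i j r c : nat).

Definition twisted_exponent r : R := nu r + ((2 * r + 1)%:R - n%:R) / 2.

(** The exponents of the weight that is left when the entries from row [i] of
    column [j] on have been integrated out: each integration over an entry
    [(r, c)] contributes the Jacobian of [integral_stage], hence raises the
    exponent of row [r] by one and lowers that of row [c] by one. *)
Definition stage_exponent j i r : R := twisted_exponent r +
  if (r < j)%N then n%:R - 1 - j%:R + (i <= r)%N%:R
  else if r == j then n%:R - 1 - j%:R - (j%:R - i%:R) else n%:R - 1 - r%:R - r%:R.

Lemma stage_exponent_col j : stage_exponent j.+1 0 = stage_exponent j j.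
Proof.
apply/funext => r; rewrite /stage_exponent; congr (_ + _); rewrite ltnS leq_eqVlt.
case: eqVneq => [->|rj] /=; first by rewrite ltnn -[j.+1]addn1 natrD; ring.
case: ltnP => rj' /=; first by rewrite -[j.+1]addn1 natrD; ring.
by case: eqVneq => [->|//]; rewrite -[j.+1]addn1 natrD; ring.
Qed.

Lemma stage_exponentS j i : (i < j)%N ->
  stage_exponent j i = fun r => stage_exponent j i.+1 r + shift_exponent R i j r.
Proof.
move=> ij; apply/funext => r; rewrite /stage_exponent /shift_exponent -[RHS]addrA; congr (_ + _).
have [rj|jr] := ltnP r j.
  rewrite (ltn_eqF rj) subr0; have [->|ri] := eqVneq r i.
    by rewrite leqnn ltnn /=; ring.
  by rewrite [(i < r)%N]ltn_neqAle eq_sym ri addr0.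
have [->|rj] := eqVneq r j.
  by rewrite (gtn_eqF ij) ?eqxx -[i.+1]addn1 natrD /=; ring.
by rewrite (gtn_eqF (leq_trans ij jr)) subrr addr0.
Qed.

(** The Jacobians of the earlier integrations have changed the gap between the
    exponents of rows [i] and [j] to exactly [nu i - nu j - 1]; here the order of
    the exponents of the inducing character makes the next integral converge. *)
Lemma stage_exponent_gap j i : (i < j < n)%N -> (1 < j)%N ->
  stage_exponent j i.+1 i - stage_exponent j i.+1 j < - 1.
Proof.
move=> ijn j1; have /andP[ij jn] := ijn; have := hnu ijn j1.
rewrite /stage_exponent ij ltnn ltnn eqxx /twisted_exponent /=.
have E (k : nat) : (2 * k + 1)%:R = 2 * k%:R + 1 :> R by rewrite natrD natrM.
by rewrite !E -[i.+1]addn1 [(i + 1)%:R]natrD; lra.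
Qed.

Lemma stage_exponent_end r : (r < n)%N -> stage_exponent n 0 r = twisted_exponent r.
Proof. by move=> rn; rewrite /stage_exponent rn /=; ring. Qed.

(** Any density would serve: it keeps the number of variables constant while the
    entries are integrated out. *)
Lemma exists_density : exists h : borel K -> R,
  [/\ measurable_fun setT h, (forall y, 0 <= h y) & (\int[mu]_y (h y)%:E = 1)%E].
Proof.
have m0 : (0 < mu (vball v 1))%E.
  case: hmu => _ _ H.
  have oU : open [set y : K | v y < 1].
    rewrite -[X in open X]/(v @^-1` [set t | t < 1]).
    by apply: open_comp => [x _|]; [exact: (lav_continuous lv)|exact: open_lt].
  apply: lt_le_trans (H _ oU _) _; first by exists 0; rewrite /= (lav0 lv).
  apply: le_measure; rewrite ?inE; [exact: open_borel|exact: borel_ball|].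
  by move=> y /= /ltW.
have moo := haar_ball_lty lv hmu 1.
set m := mu (vball v 1) in m0 moo.
have mE : m = (fine m)%:E by rewrite fineK// ge0_fin_numE// ltW.
have fm0 : 0 < fine m by rewrite -lte_fin -mE.
exists (fun y => (fine m)^-1 * \1_(vball v 1 : set (borel K)) y).
have mi : measurable_fun setT (\1_(vball v 1 : set (borel K)) : borel K -> R).
  by apply: measurable_indic; exact: borel_ball.
split.
- by apply: measurable_funM => //; exact: measurable_cst.
- by move=> y; rewrite mulr_ge0 ?invr_ge0 ?(ltW fm0)// indicE.
under eq_integral do rewrite EFinM.
rewrite ge0_integralZl ?lee_fin ?invr_ge0 ?(ltW fm0)//; last exact/measurable_EFinP.
rewrite integral_indic ?setIT//; last exact: borel_ball.
by rewrite -/m [X in (_ * X)%E]mE -EFinM mulVf// gt_eqF.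
Qed.

Section Density.
Context (h : borel K -> R).
Hypotheses (mh : measurable_fun setT h) (h0 : forall y, 0 <= h y)
  (h1 : (\int[mu]_y (h y)%:E = 1)%E).

(** Entries that have been integrated out are kept as dummy variables carrying
    the probability density [h], so that the domain never changes. *)
Definition pending j i r c : bool := (j < c)%N || (c == j) && (i <= r)%N.

Definition stage_integrand j i (a : K) (x : N.-tuple (borel K)) : R :=
  weight v n j i (stage_exponent j i) (sheared_mx 0 a x) *
  \prod_(p in R_coords hn | pending j i p.1 p.2) h (coord x p.1 p.2).

Lemma stage_integrand_ge0 j i a x : 0 <= stage_integrand j i a x.
Proof.
by apply: mulr_ge0; [exact: weight_ge0|apply: prodr_ge0 => p _; exact: h0].
Qed.

Lemma measurable_stage_integrand j i a : (i <= j)%N ->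
  measurable_fun [set: N.-tuple (borel K)] (stage_integrand j i a).
Proof.
move=> ij; apply: measurable_funM.
  by apply: (measurable_weight lv) => // r c; apply: measurable_sheared_mx; exact: lv.
rewrite (_ : (fun x => _) = (fun x : N.-tuple (borel K) =>
    \prod_(p <- enum [set p in R_coords hn | pending j i p.1 p.2]) h (coord x p.1 p.2))).
  apply: measurable_prod => p _; apply: (measurableT_comp mh).
  exact: measurable_coord.
by apply/funext => x; rewrite big_enum /=; apply: eq_bigl => p; rewrite [in RHS]inE.
Qed.

Lemma stage_integrand_step j i : (i < j < n)%N -> (1 < j)%N ->
  exists2 C : R, 0 <= C & forall a, a != 0 ->
  (\int[power_measure mu N]_x (stage_integrand j i.+1 a x)%:E <=
   C%:E * \int[power_measure mu N]_x (stage_integrand j i a x)%:E)%E.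
Proof.
move=> ijn j1; have /andP[ij jn] := ijn.
have [C C0 HC] := integral_stage lv hmu ijn (stage_exponent_gap ijn j1).
exists C => // a a0.
have ijc : is_coord n i j by rewrite /is_coord ij jn gtn_eqF.
have [k Hk] := sheared_mx_upd K hn ijc.
rewrite -ge0_integralZl//; last 2 first.
- by apply/measurable_EFinP; apply: measurable_stage_integrand; exact: ltnW.
- by move=> x _; rewrite lee_fin stage_integrand_ge0.
apply: (@ge0_le_integral_sections R _ (borel K) mu N k).
- by apply/measurable_EFinP; exact: measurable_stage_integrand.
- apply: emeasurable_funM; first exact: measurable_cst.
  by apply/measurable_EFinP; apply: measurable_stage_integrand; exact: ltnW.
- by move=> x; rewrite lee_fin stage_integrand_ge0.
- by move=> x; rewrite mule_ge0 ?lee_fin ?stage_integrand_ge0.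
move=> x; have ug := sheared_mx_unitriangular 0 x a0.
pose P : R := \prod_(p in R_coords hn | pending j i.+1 p.1 p.2) h (coord x p.1 p.2).
have P0 : 0 <= P by apply: prodr_ge0 => p _; exact: h0.
pose i' : 'I_n := Ordinal (ltn_trans ij jn); pose j' : 'I_n := Ordinal jn.
have pE r c : pending j i r c = ((r, c) == (i, j)) || pending j i.+1 r c.
  rewrite /pending xpair_eqE [(i <= r)%N]leq_eqVlt [i == r]eq_sym.
  by case: (r == i); case: (c == j); rewrite /= ?orbT ?orbF.
have PS y : \prod_(p in R_coords hn | pending j i.+1 p.1 p.2)
    h (coord (upd k y x) p.1 p.2) = P.
  apply: eq_bigr => p /andP[_ pp]; have [_ Ho _] := Hk a x y; rewrite Ho//.
  by apply: contraTneq pp => -[-> ->]; rewrite /pending !ltnn eqxx.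
have PE y : \prod_(p in R_coords hn | pending j i p.1 p.2)
    h (coord (upd k y x) p.1 p.2) = h y * P.
  rewrite (bigD1 (i', j'))/=; last first.
    by rewrite mem_R_coords ijc /pending eqxx leqnn orbT.
  have [-> _ _] := Hk a x y; rewrite -(PS y); congr (_ * _).
  apply: eq_bigl => p; rewrite -andbA pE; congr (_ && _).
  have -> : ((p.1 : nat, p.2 : nat) == (i, j)) = (p == (i', j')) by case: p.
  case: eqVneq => [->|_] /=; last by rewrite andbT.
  by rewrite /pending /= !ltnn eqxx.
have WE y : weight v n j i (stage_exponent j i) (sheared_mx 0 a (upd k y x)) =
    weight v n j i (stage_exponent j i) (sheared_mx 0 a x).
  have [_ _ ->] := Hk a x y; apply: eq_bigr => r _; congr (_ `^ _).
  apply: diagabs_indep => // r' c'; rewrite xpair_eqE /set_entry => /negbTE ->.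
  by [].
apply: (@le_trans _ _ (P%:E * \int[mu]_y
    (weight v n j i.+1 (stage_exponent j i.+1) (set_entry (sheared_mx 0 a x) i j y))%:E)%E).
  rewrite -ge0_integralZl ?lee_fin//; last 2 first.
  - apply/measurable_EFinP.
    apply: (@measurable_weight R K v lv _ (borel K) n
      (fun y : borel K => set_entry (sheared_mx 0 a x) i j y)) => //.
    by move=> r c; rewrite /set_entry; case: (_ && _).
  - by move=> y _; rewrite lee_fin weight_ge0.
  rewrite le_eqVlt; apply/orP; left; apply/eqP; apply: eq_integral => y _.
  by rewrite /stage_integrand PS; have [_ _ ->] := Hk a x y; rewrite -EFinM mulrC.
rewrite [leRHS](eq_integral (fun y => ((C * (weight v n j i (stage_exponent j i) (sheared_mx 0 a x) * P))%:E
   * (h y)%:E)%E)); last first.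
  by move=> y _; rewrite /stage_integrand PE WE -!EFinM; congr (_%:E); ring.
rewrite ge0_integralZl//; last 3 first.
- exact/measurable_EFinP.
- by move=> y _; rewrite lee_fin.
- by rewrite lee_fin !mulr_ge0 ?weight_ge0.
rewrite h1 mule1.
rewrite [in leRHS](_ : C * _ = P * (C * weight v n j i (stage_exponent j i) (sheared_mx 0 a x))).
  rewrite EFinM; apply: lee_wpmul2l; first by rewrite lee_fin.
  by rewrite (stage_exponentS ij); exact: HC.
by ring.
Qed.

Lemma stage_integrand_chain : exists2 C : R, 0 <= C & forall a, a != 0 ->
  (\int[power_measure mu N]_x (stage_integrand n 0 a x)%:E <=
   C%:E * \int[power_measure mu N]_x (stage_integrand 2 0 a x)%:E)%E.
Proof.
pose P j i := exists2 C : R, 0 <= C & forall a, a != 0 ->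
  (\int[power_measure mu N]_x (stage_integrand j i a x)%:E <=
   C%:E * \int[power_measure mu N]_x (stage_integrand 2 0 a x)%:E)%E.
have Pi j : (1 < j)%N -> (j < n)%N -> P j 0%N -> forall i, (i <= j)%N -> P j i.
  move=> j1 jn Pj0; elim=> [//|i IH] ij.
  have [C C0 HC] := IH (ltnW ij).
  have [C' C'0 HC'] := stage_integrand_step (i := i) (j := j) ltac:(by rewrite ij) j1.
  exists (C' * C) => [|a a0]; first exact: mulr_ge0.
  apply: le_trans (HC' a a0) _; rewrite EFinM -muleA; apply: lee_wpmul2l.
    by rewrite lee_fin.
  exact: HC.
have Pc j : P j j -> P j.+1 0%N.
  move=> [C C0 HC]; exists C => // a a0; apply: le_trans (HC a a0).
  rewrite le_eqVlt; apply/orP; left; apply/eqP; apply: eq_integral => x _.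
  rewrite /stage_integrand stage_exponent_col; congr (_ * _)%:E.
  apply: eq_bigl => -[r c]; apply: andb_id2l; rewrite mem_R_coords => /and3P[rc _ _].
  rewrite /pending /= andbT orbC [RHS]orbC [_ == j.+1]eq_sym -leq_eqVlt.
  have [cj|_] //= := eqVneq (c : nat) j.
  by move: rc; rewrite /= cj; case: leqP.
have H j : (1 < j)%N -> (j <= n)%N -> P j 0%N.
  elim: j => [//|j IH]; rewrite ltnS leq_eqVlt => /predU1P[<- _|j1 jn].
    by exists 1 => // a a0; rewrite mul1e.
  by apply/Pc/Pi => //; apply: IH => //; exact: ltnW.
exact: H.
Qed.

(** The only entry left to clear is the constant [1] of the first row, so the
    weight is a function of [a] and the densities integrate to one. *)
Lemma integral_last_stage a : a != 0 ->
  (\int[power_measure mu N]_x (stage_integrand 2 0 a x)%:E =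
   (v a `^ (twisted_exponent 0 + n%:R - 2) *
    Num.max 1 (v a)^-1 `^ (twisted_exponent 0 - twisted_exponent 1))%:E)%E.
Proof.
move=> a0; set W := _ * _.
have W0 : 0 <= W by rewrite mulr_ge0 ?powR_ge0.
have WE x : weight v n 2 0 (stage_exponent 2 0) (sheared_mx 0 a x) = W.
  have ug := sheared_mx_unitriangular 0 x a0.
  have -> : weight v n 2 0 (stage_exponent 2 0) (sheared_mx 0 a x) =
      weight v n 1 1 (stage_exponent 2 0) (sheared_mx 0 a x) by [].
  rewrite (weightS lv) ?hn//; congr (_ * _); last first.
    rewrite /growth /diagabs /stage /sheared_mx /= (lav1 lv) mul1r.
    by congr (_ `^ _); rewrite /stage_exponent /=; ring.
  rewrite /weight (bigD1 (idx1 hn))//= big1 => [|r r1]; last first.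
    rewrite /diagabs /stage /= (utf_diag ug) ?(lav1 lv) ?powR1//.
    by rewrite lt0n.
  rewrite mulr1 /diagabs /stage /sheared_mx /=; congr (_ `^ _).
  by rewrite /stage_exponent /=; ring.
have PE x : \prod_(p in R_coords hn | pending 2 0 p.1 p.2) h (coord x p.1 p.2) =
    \prod_(k < N) h (tnth x k).
  rewrite (eq_bigl (fun p => p \in R_coords hn)); last first.
    move=> [r c]; rewrite -[RHS]andbT; apply: andb_id2l; rewrite mem_R_coords.
    move=> /and3P[rc _ c1]; rewrite /pending /= andbT orbC eq_sym -leq_eqVlt.
    by case: (c : nat) rc c1 => [|[|]].
  rewrite big_enum_val; apply: eq_bigr => k _; congr h.
  rewrite coord_ord -surjective_pairing (tnth_nth 0); congr (nth _ _ _).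
  by rewrite (enum_val_nth (enum_val k)) index_uniq ?enum_uniq// -cardE.
rewrite (eq_integral (fun x : N.-tuple (borel K) => (W%:E * (\prod_(k < N) h (tnth x k))%:E)%E)).
  rewrite ge0_integralZl ?lee_fin//; last 2 first.
  - apply/measurable_EFinP; apply: measurable_prod => k _.
    by apply: (measurableT_comp mh); exact: measurable_tnth.
  - by move=> x _; rewrite lee_fin; apply: prodr_ge0 => k _; exact: h0.
  by rewrite (integral_power_prod N mh h0 h1) mule1.
by move=> x _; rewrite /stage_integrand WE PE -EFinM.
Qed.
End Density.

(** The columns are integrated from the last to the third and from bottom to top
    in each; the second column contains no variable and leaves the maximum. *)
Lemma integral_unsheared : exists2 C : R, 0 <= C & forall a, a != 0 ->
  (\int[power_measure mu N]_x
     (weight v n n 0 twisted_exponent (sheared_mx 0 a x))%:E <=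
   (C * (v a `^ (twisted_exponent 0 + n%:R - 2) *
    Num.max 1 (v a)^-1 `^ (twisted_exponent 0 - twisted_exponent 1)))%:E)%E.
Proof.
have [h [mh h0 h1]] := exists_density.
have [C C0 HC] := stage_integrand_chain mh h0 h1.
exists C => // a a0; have := HC a a0; rewrite integral_last_stage// -EFinM.
apply: le_trans; rewrite le_eqVlt; apply/orP; left; apply/eqP.
apply: eq_integral => x _; rewrite /stage_integrand big_pred0 ?mulr1 => [|p].
  by congr (_%:E); apply: eq_bigr => r _; rewrite stage_exponent_end.
by rewrite /pending ltnNge (ltnW (ltn_ord _)) ltn_eqF// andbF.
Qed.

(** The shear adds the second row to the first one; in each entry of the first
    row this is a translation, which the Haar measure ignores. *)
Lemma integral_sheared J a : a != 0 ->
  (\int[power_measure mu N]_x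
     (weight v n n 0 twisted_exponent (sheared_mx J a x))%:E <=
   \int[power_measure mu N]_x
     (weight v n n 0 twisted_exponent (sheared_mx 0 a x))%:E)%E.
Proof.
move=> a0.
pose F J (x : N.-tuple (borel K)) := (weight v n n 0 twisted_exponent (sheared_mx J a x))%:E.
rewrite -/(F J) -/(F 0%N).
suff S J' : (\int[power_measure mu N]_x F J'.+1 x <= \int[power_measure mu N]_x F J' x)%E.
  elim: J => [|J IH]; first exact: lexx.
  exact: le_trans (S J) IH.
clear J; move: J' => J.
have mF J' : measurable_fun setT (F J').
  apply/measurable_EFinP; apply: (measurable_weight lv) => // r c.
  by apply: measurable_sheared_mx; exact: lv.
have F0 J' x : (0 <= F J' x)%E by rewrite lee_fin weight_ge0.
have [J0|J0] := boolP (is_coord n 0 J); last first.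
  rewrite le_eqVlt; apply/orP; left; apply/eqP; apply: eq_integral => x _.
  by rewrite /F sheared_mx_noshear.
have [k Hk] := sheared_mx_shear K hn J0.
have HF x : exists b : K, forall y,
    F J.+1 (upd k y x) = F J (upd k ((y : K) + b : borel K) x).
  by have [b Hb] := Hk a x; exists b => y; rewrite /F Hb.
clearbody F.
apply: (@ge0_le_integral_sections R _ (borel K) mu N k (F J.+1) (F J)) => // x.
have [b Hb] := HF x.
rewrite (eq_integral (fun y : borel K => F J (upd k ((y : K) + b : borel K) x))).
  rewrite (@ge0_integral_translate R K mu hmu b (fun y => F J (upd k y x)))//.
  apply: (measurableT_comp (mF J)); apply/measurable_fun_tnthP => i.
  rewrite (_ : _ \o _ = fun y => if i == k then y else tnth x i).
    by case: (i == k).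
  by apply/funext => y /=; rewrite tnth_upd.
by move=> y _; rewrite Hb.
Qed.

End IteratedIntegral.

(** * Smooth functions and their sup norms *)
Section SmoothContinuous.
Context (R : realType) (K : localFieldType) (n : nat).
Local Notation M := 'M[K]_n.

Lemma continuous_real_complex : continuous (fun t : R => t%:C%C : cplx R).
Proof.
move=> t U /nbhs_cplxP[e e0 eU]; apply/nbhs_ballP; exists e => //= s ts.
apply: eU; rewrite -(rmorphB (real_complex R)) normc_real distrC; exact: ts.
Qed.

Lemma archimedean_real_embedding : archimedean_field R K ->
  exists iota : {rmorphism R -> K}, continuous iota.
Proof.
move=> [[phi [phi' [_ _ cphi _]]]|[phi [phi' [_ _ cphi _]]]]; first by exists phi.
exists ((phi : {rmorphism complex R -> K}) \o (real_complex R) : {rmorphism R -> K})%FUN.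
move=> t; apply: (@continuous_comp R (cplx R) K (fun t : R => t%:C%C) phi).
  exact: continuous_real_complex.
exact: cphi.
Qed.

(** In the archimedean case continuity is smoothness with no derivative taken;
    in the other case the function is locally constant. *)
Lemma smooth_continuous (f : M -> cplx R) g : smooth f -> g \in unitmx ->
  {for g, continuous f}.
Proof.
rewrite /smooth; case: asboolP => [ar sf gu|_ [U [oU _ U1 _ _] Uf] gu].
  have [iota ciota] := archimedean_real_embedding ar.
  by have [] := sf iota ciota [::] g gu.
have cg : {for g, continuous (fun x : M => invmx g *m x)}.
  apply: (@continuous_mulmxK _ n _ (fun=> invmx g) id); first exact: cst_continuous.
  exact: cvg_id.
have gU : nbhs (invmx g *m g) U.
  by rewrite mulVmx//; exact: (@open_nbhs_nbhs M 1%:M U (conj oU U1)).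
move=> W /= Wg; have H : nbhs g [set x | U (invmx g *m x)] := cg U gU.
suff S : [set x | U (invmx g *m x)] `<=` f @^-1` W by exact: (filterS S H).
move=> x Ux /=.
have -> : x = g *m (invmx g *m x) by rewrite mulKVmx.
by rewrite Uf//; exact: nbhs_singleton.
Qed.

End SmoothContinuous.

Section InducedBound.
Context (R : realType) (K : localFieldType) (v : K -> R).
Hypothesis lv : local_absval v.
Context (n : nat) (hn : (2 <= n)%N) (sigma : 'I_n -> K -> cplx R) (nu : 'I_n -> R).
Hypothesis hnu : forall i x, x != 0 -> Normc.normc (sigma i x) = v x `^ nu i.
Local Notation M := 'M[K]_n.
Local Notation I := (induced_rep v sigma).

Lemma induced_inP (f : I) : in_induced v sigma f.
Proof. by apply/asboolP; exact: induced_funP. Qed.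

Lemma induced_continuous (f : I) g : g \in unitmx -> {for g, continuous (f : M -> cplx R)}.
Proof. by have [sf _ _] := induced_inP f; exact: smooth_continuous. Qed.

Definition sup_norm (Q : set M) (f : I) : R := sup [set Normc.normc (f g) | g in Q].

Lemma sup_norm_has_sup (Q : set M) (f : I) : compact_unitmx Q -> Q !=set0 ->
  has_sup [set Normc.normc (f g) | g in Q].
Proof.
move=> [cQ uQ] [q Qq]; split; first by exists (Normc.normc (f q)); exists q.
have cf : {within Q, continuous (fun g => Normc.normc (f g))}.
  apply: continuous_in_subspaceT => g; rewrite inE => Qg.
  apply: (@continuous_comp _ _ _ (f : M -> cplx R) (@Normc.normc R)).
    exact: induced_continuous (uQ _ Qg).
  exact: continuous_normc.
have := continuous_compact cf cQ => /compact_bounded [B [_ HB]].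
exists (B + 1) => _ [g Qg <-]; apply: le_trans (ler_norm _) _.
by apply: (HB (B + 1) ltac:(lra) (Normc.normc (f g))); exists g.
Qed.

Lemma sup_norm_ub (Q : set M) (f : I) q : compact_unitmx Q -> Q q ->
  Normc.normc (f q) <= sup_norm Q f.
Proof.
move=> cQ Qq; apply: ub_le_sup; last by exists q.
by have [] := @sup_norm_has_sup Q f cQ (ex_intro _ q Qq).
Qed.

Lemma sup_norm_le (Q : set M) (f : I) b : Q !=set0 ->
  (forall q, Q q -> Normc.normc (f q) <= b) -> sup_norm Q f <= b.
Proof.
move=> [q Qq] H; apply: ge_sup; first by exists (Normc.normc (f q)); exists q.
by move=> _ [g Qg <-]; exact: H.
Qed.

Lemma sup_norm_ge0 (Q : set M) (f : I) : compact_unitmx Q -> Q !=set0 ->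
  0 <= sup_norm Q f.
Proof.
by move=> cQ [q Qq]; apply: le_trans (sup_norm_ub f cQ Qq); exact: normc_ge0.
Qed.

Lemma sup_normD (Q : set M) (f h : I) : compact_unitmx Q -> Q !=set0 ->
  sup_norm Q (f + h) <= sup_norm Q f + sup_norm Q h.
Proof.
move=> cQ Q0; apply: sup_norm_le => // q Qq.
apply: le_trans (normc_triangle _ _) _.
by apply: lerD; exact: sup_norm_ub.
Qed.

Lemma sup_norm_seminorm (Q : set M) : compact_unitmx Q -> Q !=set0 ->
  seminorm (sup_norm Q).
Proof.
move=> cQ Q0; split => [f h|a f]; first exact: sup_normD.
have le (b : complex R) (h : I) : sup_norm Q (b *: h) <= Normc.normc b * sup_norm Q h.
  apply: sup_norm_le => // q Qq; rewrite [induced_fun _ _](_ : _ = b * h q)//.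
  by rewrite Normc.normcM ler_wpM2l ?normc_ge0// sup_norm_ub.
apply/eqP; rewrite eq_le le /=.
have [->|a0] := eqVneq a 0.
  by rewrite Normc.normc0 mul0r; exact: sup_norm_ge0.
have na : 0 < Normc.normc a.
  by rewrite lt_def normc_ge0 andbT; apply: contraNneq a0 => /Normc.eq0_normc ->.
rewrite -ler_pdivlMl// -Normc.normcV.
by have := le a^-1 (a *: f); rewrite scalerA mulVf// scale1r.
Qed.

(** The archimedean topology contains this seminorm as the one attached to the
    empty list of derivatives; the finest locally convex topology contains all
    seminorms. *)
Lemma sup_norm_defining (Q : set M) : compact_unitmx Q -> Q !=set0 ->
  defining_seminorm (sup_norm Q).
Proof.
move=> cQ Q0; rewrite /defining_seminorm; case: asboolP => [ar|_].
  have [iota ciota] := archimedean_real_embedding ar.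
  by exists iota, [::], Q; case: cQ => ? ?; split.
exact: sup_norm_seminorm.
Qed.

End InducedBound.

(** * Complex-valued integrals *)
Section ComplexIntegrals.
Context (R : realType) d (T : measurableType d) (mu : {measure set T -> \bar R}).
Context (D : set T) (mD : measurable D).
Implicit Types f g : T -> cplx R.

Definition cplx_measurable f : Prop :=
  measurable_fun D (fun x => complex.Re (f x)) /\
  measurable_fun D (fun x => complex.Im (f x)).

Lemma cplx_measurableM f g : cplx_measurable f -> cplx_measurable g ->
  cplx_measurable (fun x => f x * g x).
Proof.
move=> [rf jf] [rg jg]; split.
  rewrite (_ : (fun _ => _) = fun x => complex.Re (f x) * complex.Re (g x) -
      complex.Im (f x) * complex.Im (g x)).
    by apply: measurable_funB; exact: measurable_funM.
  by apply/funext => x; case: (f x) (g x) => a b [].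
rewrite (_ : (fun _ => _) = fun x => complex.Re (f x) * complex.Im (g x) +
    complex.Im (f x) * complex.Re (g x)).
  by apply: measurable_funD; exact: measurable_funM.
by apply/funext => x; case: (f x) (g x) => a b [].
Qed.

Lemma cplx_measurableD f g : cplx_measurable f -> cplx_measurable g ->
  cplx_measurable (fun x => f x + g x).
Proof.
move=> [rf jf] [rg jg]; split.
  rewrite (_ : (fun _ => _) = fun x => complex.Re (f x) + complex.Re (g x)).
    exact: measurable_funD.
  by apply/funext => x; case: (f x) (g x) => a b [].
rewrite (_ : (fun _ => _) = fun x => complex.Im (f x) + complex.Im (g x)).
  exact: measurable_funD.
by apply/funext => x; case: (f x) (g x) => a b [].
Qed.

Lemma cplx_measurable_cst (z : cplx R) : cplx_measurable (fun=> z).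
Proof. by split; exact: measurable_cst. Qed.

Lemma cplx_measurable_real (h : T -> R) : measurable_fun D h ->
  cplx_measurable (fun x => (h x)%:C%C).
Proof. by move=> mh; split => //; exact: measurable_cst. Qed.

Lemma cplx_measurable_eq f g : {in D, f =1 g} -> cplx_measurable f -> cplx_measurable g.
Proof.
move=> fg [rf jf]; split.
  by apply: eq_measurable_fun rf => x xD; rewrite fg.
by apply: eq_measurable_fun jf => x xD; rewrite fg.
Qed.

Lemma measurable_normc f : cplx_measurable f ->
  measurable_fun D (fun x => Normc.normc (f x)).
Proof.
move=> [rf jf].
rewrite (_ : (fun _ => _) = fun x =>
    (complex.Re (f x) ^+ 2 + complex.Im (f x) ^+ 2) `^ (2^-1)).
  apply: (measurableT_comp (measurable_powR _)).
  by apply: measurable_funD; apply: measurable_funX.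
by apply/funext => x; rewrite -sqr_normc powR12_sqrt ?sqr_ge0// sqrtr_sqr ger0_norm ?normc_ge0.
Qed.

Lemma cplx_integrableP f : cplx_integrable mu D f <->
  cplx_measurable f /\ (\int[mu]_(x in D) (Normc.normc (f x))%:E < +oo)%E.
Proof. by split=> [[? ? ?]|[[? ?] ?]]. Qed.

Lemma cplx_integrable_ReIm f : cplx_integrable mu D f ->
  mu.-integrable D (fun x => (complex.Re (f x))%:E) /\
  mu.-integrable D (fun x => (complex.Im (f x))%:E).
Proof.
move=> [rf jf fi].
have mn : measurable_fun D (fun x => (Normc.normc (f x))%:E).
  by apply/measurable_EFinP; exact: measurable_normc.
split; apply/integrableP; (split; first exact/measurable_EFinP);
  apply: le_lt_trans fi; apply: ge0_le_integral => //;
  rewrite ?lee_fin// => *; rewrite ?lee_fin ?normc_ge_Re ?normc_ge_Im//.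
all: do 2 apply: measurableT_comp => //.
Qed.

Lemma cplx_integrable_le f (h : T -> R) : cplx_measurable f -> measurable_fun D h ->
  (forall x, D x -> Normc.normc (f x) <= h x) ->
  (\int[mu]_(x in D) (h x)%:E < +oo)%E -> cplx_integrable mu D f.
Proof.
move=> mf mh fh hi; apply/cplx_integrableP; split => //; apply: le_lt_trans hi.
apply: ge0_le_integral => //.
- by move=> x _; rewrite lee_fin normc_ge0.
- by apply/measurable_EFinP; exact: measurable_normc.
- exact/measurable_EFinP.
Qed.

Lemma cplx_integrableZD (a : cplx R) f g : cplx_integrable mu D f ->
  cplx_integrable mu D g -> cplx_integrable mu D (fun x => a * f x + g x).
Proof.
move=> /cplx_integrableP[mf fi] /cplx_integrableP[mg gi].
have mnf : measurable_fun D (fun x => (Normc.normc (f x))%:E).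
  by apply/measurable_EFinP; exact: measurable_normc.
have mng : measurable_fun D (fun x => (Normc.normc (g x))%:E).
  by apply/measurable_EFinP; exact: measurable_normc.
apply: (@cplx_integrable_le _ (fun x => Normc.normc a * Normc.normc (f x) + Normc.normc (g x))).
- apply: cplx_measurableD => //.
  by apply: (@cplx_measurableM (fun=> a) f) => //; exact: cplx_measurable_cst.
- apply: measurable_funD; last exact: measurable_normc.
  by apply: measurable_funM; [exact: measurable_cst|exact: measurable_normc].
- by move=> x _; rewrite (le_trans (normc_triangle _ _))// Normc.normcM.
under eq_integral do rewrite EFinD EFinM.
rewrite ge0_integralD//; last 3 first.
- by move=> x _; rewrite mule_ge0 ?lee_fin ?normc_ge0.
- by apply: emeasurable_funM => //; exact: measurable_cst.
- by move=> x _; rewrite lee_fin normc_ge0.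
rewrite ge0_integralZl ?lee_fin ?normc_ge0//; last first.
  by move=> x _; rewrite lee_fin normc_ge0.
by apply: lte_add_pinfty => //; rewrite lte_mul_pinfty ?lee_fin ?normc_ge0.
Qed.

Lemma cintegralZD (a : cplx R) f g : cplx_integrable mu D f ->
  cplx_integrable mu D g ->
  cintegral mu D (fun x => a * f x + g x) = a * cintegral mu D f + cintegral mu D g.
Proof.
move=> fi gi; have [rf jf] := cplx_integrable_ReIm fi.
have [rg jg] := cplx_integrable_ReIm gi.
rewrite /cintegral; case: a => a b.
have Z (c : R) (h : T -> R) : mu.-integrable D (EFin \o h) ->
    mu.-integrable D (EFin \o (fun x => c * h x)).
  by move=> ih; under [X in mu.-integrable D X]eq_fun do rewrite /= EFinM; exact: integrableZl.
have E1 : \int[mu]_(x in D) complex.Re (Complex a b * f x + g x) =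
    a * \int[mu]_(x in D) complex.Re (f x) - b * \int[mu]_(x in D) complex.Im (f x) +
    \int[mu]_(x in D) complex.Re (g x).
  rewrite -!RintegralZl// -RintegralB//; [|exact: Z..].
  rewrite -RintegralD//; last first.
    exact: (integrableB mD (Z a _ rf) (Z b _ jf)).
  by apply: eq_Rintegral => x _; case: (f x) (g x) => ? ? [].
have E2 : \int[mu]_(x in D) complex.Im (Complex a b * f x + g x) =
    a * \int[mu]_(x in D) complex.Im (f x) + b * \int[mu]_(x in D) complex.Re (f x) +
    \int[mu]_(x in D) complex.Im (g x).
  rewrite -!RintegralZl// -RintegralD//; [|exact: Z..].
  rewrite -RintegralD//; last first.
    exact: (integrableD mD (Z a _ jf) (Z b _ rf)).
  by apply: eq_Rintegral => x _; case: (f x) (g x) => ? ? [].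
by rewrite E1 E2; apply/eqP; rewrite eq_complex /= !eqxx.
Qed.

(** Real and imaginary parts are bounded separately, whence the factor [2]. *)
Lemma normc_cintegral_le f (b : R) : cplx_integrable mu D f ->
  (\int[mu]_(x in D) (Normc.normc (f x))%:E <= b%:E)%E ->
  Normc.normc (cintegral mu D f) <= 2 * b.
Proof.
move=> fi fb; have [rf jf] := cplx_integrable_ReIm fi.
have /cplx_integrableP[mf _] := fi.
have mn : measurable_fun D (fun x => (Normc.normc (f x))%:E).
  by apply/measurable_EFinP; exact: measurable_normc.
have H (h : T -> R) : mu.-integrable D (EFin \o h) ->
    (forall x, `|h x| <= Normc.normc (f x)) -> `|\int[mu]_(x in D) h x| <= b.
  move=> ih hf; apply: le_trans (le_normr_Rintegral _ _) _ => //.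
  rewrite -lee_fin /Rintegral fineK; last first.
    exact: integrable_fin_num (integrable_abse ih).
  apply: le_trans fb; apply: ge0_le_integral => //.
  - have /integrableP[/measurable_EFinP mh _] := ih.
    by apply/measurable_EFinP; apply: measurableT_comp.
  - by move=> x _; rewrite lee_fin.
apply: le_trans (normc_le_ReIm _) _; rewrite mulr_natl mulr2n.
apply: lerD; apply: H => // x; [exact: normc_ge_Re|exact: normc_ge_Im].
Qed.

Lemma eq_cintegral f g : {in D, f =1 g} -> cintegral mu D f = cintegral mu D g.
Proof.
move=> fg; rewrite /cintegral; congr Complex; apply: eq_Rintegral => x xD; by rewrite fg.
Qed.

End ComplexIntegrals.

(** * Complex powers *)
Section ComplexPowers.
Context (R : realType).
Implicit Types (x y t r : R) (z h : cplx R).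

Lemma sin_mvt y : exists2 t, `|t| <= `|y| & sin y = cos t * y.
Proof.
have H (u : R) : 0 <= u -> exists2 t, `|t| <= `|u| & sin u = cos t * u.
  move=> u0; have [t /itvP tu E] := @MVT_segment R sin cos 0 u u0
    (fun x _ => is_derive_sin x)
    (@continuous_subspaceT _ _ _ _ (@continuous_sin R)).
  exists t; first by rewrite !ger0_norm ?tu.
  by move: E; rewrite sin0 !subr0.
have [/H//|/ltW y0] := leP 0 y.
have [t tu E] := H (- y) ltac:(lra); exists t; first by rewrite normrN in tu.
by apply: oppr_inj; rewrite -sinN E mulrN.
Qed.

Lemma ler_norm_sin y : `|sin y| <= `|y|.
Proof.
have [t _ ->] := sin_mvt y; rewrite normrM -[leRHS]mul1r ler_wpM2r//.
exact: cos_max.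
Qed.

Lemma one_sub_cos y : 1 - cos y = 2 * sin (y / 2) ^+ 2.
Proof.
have E : (y / 2) *+ 2 = y by rewrite -mulr_natr mulfVK.
have := cos_mulr2n (y / 2); rewrite E => ->.
by have := cos2Dsin2 (y / 2); rewrite mulr2n; lra.
Qed.

Lemma ler_norm_cos_sub1 y : `|cos y - 1| <= y ^+ 2.
Proof.
rewrite distrC one_sub_cos ger0_norm; last by apply: mulr_ge0 => //; exact: sqr_ge0.
have : sin (y / 2) ^+ 2 <= (y / 2) ^+ 2.
  rewrite -[leLHS]real_normK ?num_real// -[leRHS]real_normK ?num_real//.
  by rewrite ler_sqr ?nnegrE ?ler_norm_sin.
by rewrite expr_div_n => H; have := sqr_ge0 y; lra.
Qed.

Lemma ler_norm_sin_sub y : `|sin y - y| <= y ^+ 2.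
Proof.
have [t ty ->] := sin_mvt y.
rewrite -[X in _ - X]mul1r -mulrBl normrM -real_normK ?num_real// expr2.
apply: ler_wpM2r => //; apply: le_trans ty.
rewrite distrC one_sub_cos ger0_norm; last by apply: mulr_ge0 => //; exact: sqr_ge0.
have := ler_norm_sin (t / 2); have := sin_max (t / 2).
rewrite -real_normK ?num_real// normrM (gtr0_norm (x := 2^-1)) ?invr_gt0// => s1 s2.
have := normr_ge0 (sin (t / 2)) => s0.
have : `|sin (t / 2)| ^+ 2 <= `|sin (t / 2)| by rewrite expr2 ler_piMl.
lra.
Qed.

Lemma ler_norm_expR_sub1 x : `|expR x - 1| <= `|x| * expR `|x|.
Proof.
have [x0|x0] := leP 0 x.
  rewrite !ger0_norm// ?subr_ge0 ?expR_ge1//; last first.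
    by rewrite -expR0 ler_expR.
  have := expR_ge1Dx (- x); rewrite -(ler_pM2r (expR_gt0 x)) -expRD addNr expR0.
  lra.
rewrite ler0_norm; last by rewrite subr_le0 expR_le1 ltW.
have H1 := expR_ge1Dx x; have nx : `|x| = - x by rewrite ltr0_norm.
have : `|x| * 1 <= `|x| * expR `|x|.
  by apply: ler_wpM2l => //; rewrite -expR0 ler_expR.
rewrite nx; lra.
Qed.

Lemma ler_norm_expR_taylor x : `|expR x - 1 - x| <= x ^+ 2 * expR `|x|.
Proof.
have H1 := expR_ge1Dx x.
rewrite ger0_norm; last lra.
have H : expR x - 1 <= x * expR x.
  have := expR_ge1Dx (- x); rewrite -(ler_pM2r (expR_gt0 x)) -expRD addNr expR0.
  lra.
apply: (@le_trans _ _ (x * (expR x - 1))); first by lra.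
apply: le_trans (ler_norm _) _; rewrite normrM -real_normK ?num_real// expr2 -mulrA.
by apply: ler_wpM2l => //; exact: ler_norm_expR_sub1.
Qed.

Lemma normc_cpow r z : 0 < r -> Normc.normc (cpow r z) = r `^ complex.Re z.
Proof.
move=> r0; rewrite /cpow /= !exprMn -mulrDr cos2Dsin2 mulr1 sqrtr_sqr.
by rewrite ger0_norm// powR_ge0.
Qed.

Lemma cpowD r z h : 0 < r -> cpow r (z + h) = cpow r z * cpow r h.
Proof.
move=> r0; case: z => a b; case: h => c d; rewrite /cpow /=.
apply/eqP; rewrite eq_complex /= mulrDl cosD sinD powR_gt0D//.
by apply/andP; split; apply/eqP; ring.
Qed.

Lemma cpow0 r : cpow r 0 = 1.
Proof. by rewrite /cpow /= powRr0 mul0r cos0 sin0 mulr0 mulr1. Qed.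

Lemma cpowV r z : 0 < r -> (cpow r z)^-1 = cpow r (- z).
Proof.
move=> r0; have E : cpow r z * cpow r (- z) = 1 by rewrite -cpowD// subrr cpow0.
have z0 : cpow r z != 0.
  by apply/eqP => z0; move: E; rewrite z0 mul0r => /esym/eqP; rewrite oner_eq0.
by apply: (mulfI z0); rewrite E divff.
Qed.

Lemma cpow_taylor r h : 0 < r ->
  Normc.normc (cpow r h - 1 - h * (ln r)%:C%C) <=
  4 * (Normc.normc h * `|ln r|) ^+ 2 * expR (Normc.normc h * `|ln r|).
Proof.
move=> r0; set L := ln r; set w := Normc.normc h * `|L|.
pose x := complex.Re h * L; pose y := complex.Im h * L.
have w0 : 0 <= w by rewrite mulr_ge0 ?normc_ge0.
have xw : `|x| <= w by rewrite normrM ler_wpM2r// normc_ge_Re.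
have yw : `|y| <= w by rewrite normrM ler_wpM2r// normc_ge_Im.
have sq t : `|t| <= w -> t ^+ 2 <= w ^+ 2.
  by move=> tw; rewrite -[t ^+ 2]real_normK ?num_real// ler_sqr ?nnegrE.
have ew1 : 1 <= expR w by rewrite -expR0 ler_expR.
have exw : expR `|x| <= expR w by rewrite ler_expR.
have exw' : expR x <= expR w by rewrite ler_expR (le_trans (ler_norm _)).
have rx : r `^ complex.Re h = expR x by rewrite /powR gt_eqF.
have w2e : w ^+ 2 <= w ^+ 2 * expR w by rewrite ler_peMr// sqr_ge0.
apply: le_trans (normc_le_ReIm _) _.
rewrite (_ : complex.Re _ = expR x * (cos y - 1) + (expR x - 1 - x)); last first.
  by rewrite /cpow rx /x /y -/L; case: (h) => a b /=; ring.
rewrite (_ : complex.Im _ = (expR x - 1) * sin y + (sin y - y)); last first.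
  by rewrite /cpow rx /x /y -/L; case: (h) => a b /=; ring.
have h1 : `|expR x * (cos y - 1)| <= w ^+ 2 * expR w.
  rewrite normrM (ger0_norm (expR_ge0 _)) mulrC; apply: ler_pM => //.
    exact: le_trans (ler_norm_cos_sub1 _) (sq _ yw).
have h2 : `|expR x - 1 - x| <= w ^+ 2 * expR w.
  apply: le_trans (ler_norm_expR_taylor _) _; apply: ler_pM => //.
  - exact: sqr_ge0.
  - exact: sq.
have h3 : `|(expR x - 1) * sin y| <= w ^+ 2 * expR w.
  rewrite normrM expr2 mulrAC; apply: ler_pM => //.
    apply: le_trans (ler_norm_expR_sub1 _) _; apply: ler_pM => //.
  exact: le_trans (ler_norm_sin _) yw.
have h4 : `|sin y - y| <= w ^+ 2 * expR w.
  by apply: le_trans (ler_norm_sin_sub _) (le_trans (sq _ yw) w2e).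
have := ler_normD (expR x * (cos y - 1)) (expR x - 1 - x).
have := ler_normD ((expR x - 1) * sin y) (sin y - y).
lra.
Qed.

Lemma ler_norm_expR x : `|x| <= expR `|x|.
Proof. by have := expR_ge1Dx `|x|; lra. Qed.

Lemma ler_sqr_expR x : x ^+ 2 <= 2 * expR `|x|.
Proof.
have := @expR_ge1Dxn R `|x| 1 (normr_ge0 _); rewrite real_normK ?num_real//.
by rewrite /factorial /= => H; lra.
Qed.

Lemma expR_norm_ln r t : 0 < r -> 0 <= t -> expR (t * `|ln r|) <= r `^ t + r `^ (- t).
Proof.
move=> r0 t0; rewrite /powR gt_eqF//.
have [l0|l0] := leP 0 (ln r).
  by rewrite ger0_norm// lerDl expR_ge0.
by rewrite ltr0_norm// mulrN mulNr lerDr expR_ge0.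
Qed.

(** Powers of [ln r] are absorbed by a small change of the exponent, to either
    side according as [r] is large or small. *)
Lemma cpow_estimate (e r : R) h : 0 < e -> 0 < r -> Normc.normc h <= e ->
  Normc.normc (cpow r h - 1 - h * (ln r)%:C%C) <=
  Normc.normc h ^+ 2 * (8 / e ^+ 2 * (r `^ (2 * e) + r `^ (- (2 * e)))).
Proof.
move=> e0 r0 he; apply: le_trans (cpow_taylor _ r0) _.
set L := ln r; set H := Normc.normc h.
have H0 : 0 <= H by exact: normc_ge0.
have E1 : expR (H * `|L|) <= expR (e * `|L|) by rewrite ler_expR ler_wpM2r.
have E2 := expR_norm_ln r0 (t := 2 * e) ltac:(lra).
have E3 := ler_sqr_expR (e * L); rewrite normrM (gtr0_norm e0) in E3.
have E4 : expR (2 * e * `|L|) = expR (e * `|L|) * expR (e * `|L|).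
  by rewrite -expRD; congr expR; ring.
have e2 : 0 < e ^+ 2 by rewrite exprn_gt0.
rewrite (_ : _ * _ * _ = H ^+ 2 * (4 * (L ^+ 2 * expR (H * `|L|)))); last first.
  by rewrite -[L ^+ 2]real_normK ?num_real//; ring.
apply: ler_wpM2l; first exact: sqr_ge0.
apply: (@le_trans _ _ (8 / e ^+ 2 * expR (2 * e * `|L|))); last first.
  by apply: ler_wpM2l => //; apply: divr_ge0 => //; exact: ltW.
rewrite E4 [leRHS]mulrAC ler_pdivlMr//.
have -> : 4 * (L ^+ 2 * expR (H * `|L|)) * e ^+ 2 = 4 * ((e * L) ^+ 2 * expR (H * `|L|)) by ring.
have -> : 8 * (expR (e * `|L|) * expR (e * `|L|)) = 4 * ((2 * expR (e * `|L|)) * expR (e * `|L|)) by ring.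
by apply: ler_wpM2l => //; apply: ler_pM => //; exact: sqr_ge0.
Qed.

Lemma norm_ln_le (e r : R) : 0 < e -> 0 < r ->
  `|ln r| <= (2 * e)^-1 * (r `^ (2 * e) + r `^ (- (2 * e))).
Proof.
move=> e0 r0; rewrite mulrC ler_pdivlMr ?mulr_gt0//.
have := expR_norm_ln r0 (t := 2 * e) ltac:(lra); apply: le_trans.
have := ler_norm_expR (2 * e * ln r); rewrite normrM gtr0_norm ?mulr_gt0//.
by rewrite [`|ln r| * _]mulrC.
Qed.

End ComplexPowers.

(** * Domination of the functions in the induced representation *)
Section WeightBound.
Context (R : realType) (K : localFieldType) (v : K -> R).
Hypothesis lv : local_absval v.
Context (n : nat) (hn : (2 <= n)%N) (sigma : 'I_n -> K -> cplx R) (nu : 'I_n -> R).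
Hypothesis hnu : forall i x, x != 0 -> Normc.normc (sigma i x) = v x `^ nu i.
Local Notation M := 'M[K]_n.
Local Notation N := #|R_coords hn|.

Definition nat_nu (r : nat) : R := if insub r is Some i then nu i else 0.

Lemma nat_nu_ord (i : 'I_n) : nat_nu i = nu i.
Proof. by rewrite /nat_nu valK. Qed.

Lemma nat_nu_increasing :
  (forall j : 'I_n, j = 2%N :> nat ->
     Num.max (nu (idx1 hn)) (nu (idx2 hn)) < nu j) ->
  (forall i j : 'I_n, (2 <= i)%N -> j = i.+1 :> nat -> nu i < nu j) ->
  forall i j : nat, (i < j < n)%N -> (1 < j)%N -> nat_nu i < nat_nu j.
Proof.
move=> nu3 nuS i j /andP[ij jn].
have -> : nat_nu i = nu (Ordinal (ltn_trans ij jn)) by rewrite -nat_nu_ord.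
have -> : nat_nu j = nu (Ordinal jn) by rewrite -nat_nu_ord.
move: (ltn_trans ij jn) => iN.
elim: j jn ij => [//|j IH] jn ij; rewrite ltnS leq_eqVlt => /predU1P[j1|j1].
  have := nu3 (Ordinal jn) (congr1 S (esym j1)); rewrite gt_max => /andP[h1 h2].
  have i2 : (i < 2)%N by rewrite [2%N](congr1 S j1).
  have [i0|i0] := posnP i; [apply: le_lt_trans h1|apply: le_lt_trans h2];
    rewrite le_eqVlt; apply/orP; left; apply/eqP; congr nu; apply: val_inj => //=.
  by apply/eqP; rewrite eqn_leq i0 andbT.
have jn' := ltnW jn.
have lt : nu (Ordinal jn') < nu (Ordinal jn) by apply: nuS.
move: ij; rewrite ltnS leq_eqVlt => /predU1P[ij|ij].
  apply: le_lt_trans lt; rewrite le_eqVlt; apply/orP; left; apply/eqP.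
  by congr nu; apply: val_inj.
apply: lt_trans lt; apply: le_lt_trans (IH jn' ij j1).
by rewrite le_eqVlt; apply/orP; left; apply/eqP; congr nu; apply: val_inj.
Qed.

(** On a lower triangular matrix the character of the induction datum has the
    weight of the elimination as absolute value. *)
Lemma induced_weight_bound : exists Q : set M,
  [/\ compact_unitmx Q, Q !=set0 &
   forall (f : induced_rep v sigma) a (x : N.-tuple (borel K)), a != 0 ->
   Normc.normc (f (w1 K hn *m R_elt a x)) <=
     sup_norm Q f * weight v n n 0 (twisted_exponent n nat_nu) (sheared_mx n a x)].
Proof.
have n0 : (n.-1 < n)%N by rewrite prednK// ltnW.
have [Q cQ HQ] := stage_factor lv (leqnn n.-1) n0; exists Q; split => //.
  by have [q Qq _] := HQ (fun _ _ => 0); exists q.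
move=> f a x a0; have ug := sheared_mx_unitriangular n x a0.
(* the next stage after the last entry of the last column is the final one *)
have sE g : stage v n 0 g = stage v n.-1 n.-1 g by case: (n) hn.
rewrite w1_R_elt; have [q Qq ->] := HQ (sheared_mx n a x); rewrite -sE.
set B := stage v n 0 (sheared_mx n a x).
have dB r : 0 < v (B r r) by exact: (diagabs_gt0 lv ug (leq0n n) r).
have B0 r : B r r != 0 by rewrite -(lav_eq0 lv) gt_eqF.
have tB : is_trig_mx (mx_of n B).
  apply/is_trig_mxP => i j ij; rewrite mxE.
  by have [H _] := stage_lower lv ug (leq0n n); exact: H.
have uB : mx_of n B \in unitmx.
  rewrite unitmxE det_trig// unitfE; apply/prodf_neq0 => i _.
  by rewrite mxE B0.
have [cQ1 uQ] := cQ.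
have [_ _ fB] := induced_inP f.
rewrite (fB _ _ tB uB (uQ _ Qq)) !Normc.normcM mulrC.
apply: ler_pM; rewrite ?normc_ge0 ?mulr_ge0 ?normc_ge0//; first exact: sup_norm_ub.
rewrite /rho_Bbar normc_real ger0_norm; last by apply: prodr_ge0 => i _; exact: powR_ge0.
have -> : Normc.normc (sigma_Bbar sigma (mx_of n B)) = \prod_i Normc.normc (sigma i (B i i)).
  rewrite /sigma_Bbar; elim/big_ind2 : _ => //; first exact: Normc.normc1.
    by move=> z s w t <- <-; rewrite Normc.normcM.
  by move=> i _; rewrite mxE.
rewrite -big_split /= le_eqVlt; apply/orP; left; apply/eqP; apply: eq_bigr => i _.
by rewrite hnu// mxE -powR_gt0D// /twisted_exponent nat_nu_ord.
Qed.

End WeightBound.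

(** * The integrand *)
Section Integrand.
Context (R : realType) (K : localFieldType) (v : K -> R).
Hypothesis lv : local_absval v.
Context (psi : K -> cplx R).
Hypothesis hpsi : nontrivial_unitary_character psi.
Context (mu : {sigma_finite_measure set (borel K) -> \bar R}).
Hypothesis hmu : haar_measure mu.
Context (n : nat) (hn : (2 <= n)%N) (sigma : 'I_n -> K -> cplx R) (nu : 'I_n -> R).
Hypothesis hsigma : forall i x, x != 0 -> Normc.normc (sigma i x) = v x `^ nu i.
Local Notation M := 'M[K]_n.
Local Notation N := #|R_coords hn|.
Local Notation P := (borel K * N.-tuple (borel K))%type.
Local Notation D := (R_domain (K := K) hn).

Lemma R_elt_entry a (x : N.-tuple (borel K)) (i j : 'I_n) : R_elt a x i j =
  if i == j then (if i == idx1 hn then a else 1) else coord x i j.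
Proof. by rewrite mxE coord_ord. Qed.

Lemma measurable_R_domain : measurable D.
Proof.
rewrite (_ : D = (fst : P -> borel K) @^-1` (~` [set 0])).
  rewrite -[X in measurable X]setTI; apply: measurable_fst => //.
  by apply: measurableC; exact: borel_set1.
by apply/seteqP; split => -[a x] /= /eqP.
Qed.

Lemma R_elt_unit a (x : N.-tuple (borel K)) : a != 0 -> R_elt a x \in unitmx.
Proof.
move=> a0; have -> : R_elt a x = (R_elt a x)^T^T by rewrite trmxK.
rewrite unitmx_tr unitmxE det_trig; last first.
  apply/is_trig_mxP => i j ij; rewrite mxE R_elt_entry.
  rewrite -val_eqE /= gtn_eqF// coord0//.
  by rewrite /is_coord; apply: contraTN ij => /andP[ji _]; rewrite -leqNgt ltnW.
rewrite unitfE; apply/prodf_neq0 => i _; rewrite mxE R_elt_entry eqxx.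
by case: ifP => // _; exact: oner_neq0.
Qed.

Lemma w1_unit : w1 K hn \in unitmx.
Proof.
have := R_elt_unit (a := 1) [tuple of nseq N (0 : borel K)] (oner_neq0 _).
set X := R_elt _ _ => uX.
suff : w1 K hn *m X \in unitmx by rewrite unitmx_mul => /andP[].
have ug := sheared_mx_unitriangular n [tuple of nseq N (0 : borel K)] (oner_neq0 K).
rewrite w1_R_elt -unitmx_tr unitmxE det_trig; last first.
  by apply/is_trig_mxP => i j ij; rewrite !mxE (utf_lower ug).
rewrite unitfE; apply/prodf_neq0 => i _; rewrite !mxE.
have [i0|i0] := posnP i; last by rewrite (utf_diag ug)// oner_neq0.
by rewrite i0; exact: utf_diag0 ug.
Qed.

Lemma measurable_on_R (h : M -> R) :
  (forall g : M, g \in unitmx -> {for g, continuous h}) ->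
  measurable_fun D (fun p : P => h (R_elt p.1 p.2)).
Proof.
move=> ch.
apply: (@measurable_continuous_mxR R K v lv _ P D n n measurable_R_domain
  (fun p => R_elt p.1 p.2) _ [set g | g \in unitmx] h) => //.
- move=> i j; apply: (@measurable_funS _ _ P (borel K) setT) => //.
  rewrite (_ : (fun t => _) = fun t : P =>
      if i == j then (if i == idx1 hn then t.1 else 1) else coord t.2 i j).
    case: (i == j); last first.
      by apply: (measurableT_comp (@measurable_coord K n hn i j)); exact: measurable_snd.
    by case: (_ == _); [exact: measurable_fst|exact: measurable_cst].
  by apply/funext => t; rewrite R_elt_entry.
- exact: open_unitmx.
- by move=> p Dp; exact: R_elt_unit.
Qed.

Lemma cplx_measurable_on_R (h : M -> cplx R) :
  (forall g : M, g \in unitmx -> {for g, continuous h}) ->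
  cplx_measurable D (fun p : P => h (R_elt p.1 p.2)).
Proof.
move=> ch; split.
  apply: (measurable_on_R (h := fun g => complex.Re (h g))) => g ug.
  by apply: (@continuous_comp _ _ _ h (@complex.Re R)); [exact: ch|exact: continuous_Re].
apply: (measurable_on_R (h := fun g => complex.Im (h g))) => g ug.
by apply: (@continuous_comp _ _ _ h (@complex.Im R)); [exact: ch|exact: continuous_Im].
Qed.

Lemma psi0 : psi 0 = 1.
Proof.
case: hpsi => _ H n1 _; have E := H 0 0; rewrite addr0 in E.
have p0 : psi 0 != 0.
  by apply: contraTneq (oner_neq0 R) => p0; rewrite -(n1 0) p0 Normc.normc0 eqxx.
by apply: (mulfI p0); rewrite -E mulr1.
Qed.

Lemma psiV x : (psi x)^-1 = psi (- x).
Proof.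
case: hpsi => _ H n1 _.
have px : psi x != 0.
  by apply: contraTneq (oner_neq0 R) => p0; rewrite -(n1 x) p0 Normc.normc0 eqxx.
by apply: (mulfI px); rewrite divff// -H subrr psi0.
Qed.

Definition superdiag_sum (g : M) : K :=
  \sum_(i < n) \sum_(j < n | j == i.+1 :> nat) g i j.

(** Right multiplication by [diag1 hn a^-1] only changes the first column, which
    has no entry above the diagonal. *)
Lemma psi_N_R_elt a (x : N.-tuple (borel K)) : a != 0 ->
  psi_N psi (R_elt a x *m invmx (diag1 hn a)) = psi (superdiag_sum (R_elt a x)).
Proof.
move=> a0; rewrite /psi_N; congr psi.
have -> : invmx (diag1 hn a) = diag1 hn a^-1.
  have E : diag1 hn a *m diag1 hn a^-1 = 1%:M.
    rewrite /diag1 mulmx_diag; apply/matrixP => i j; rewrite !mxE.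
    by case: ifP => _; rewrite ?divff ?mulr1.
  by have [u _] := mulmx1_unit E; rewrite -[RHS](mulKmx u) E mulmx1.
apply: eq_bigr => i _; apply: eq_bigr => j /eqP ij.
have j1 : j != idx1 hn by rewrite -val_eqE /= ij.
by rewrite mul_mx_diag mxE [X in _ * X]mxE (negbTE j1) mulr1.
Qed.

(** The part of the integrand that does not depend on [s]; the rest is a complex
    power of [v a], so the functional is a Mellin transform. *)
Definition amplitude (f : M -> cplx R) (p : P) : cplx R :=
  f (w1 K hn *m R_elt p.1 p.2) * psi (- superdiag_sum (R_elt p.1 p.2)) *
    ((v p.1)^-1)%:C%C.

Lemma Lambda_integrandE s f p : D p -> Lambda_integrand v psi hn s f p =
  amplitude f p * cpow (v p.1) (s - (n%:R - 1) / 2).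
Proof.
case: p => a x; rewrite /R_domain /= => a0.
have va : 0 < v a by exact: lav_gt0 lv _ a0.
rewrite /Lambda_integrand /psi_s /amplitude /= R_elt_entry !eqxx psi_N_R_elt//.
by rewrite invfM psiV cpowV// opprB mulrA mulrAC.
Qed.

Lemma normc_psi x : Normc.normc (psi x) = 1.
Proof. by case: hpsi => _ _ H _; exact: H. Qed.

Lemma normc_amplitude f p : D p ->
  Normc.normc (amplitude f p) = Normc.normc (f (w1 K hn *m R_elt p.1 p.2)) * (v p.1)^-1.
Proof.
case: p => a x; rewrite /R_domain /= => a0.
have va : 0 < v a by exact: lav_gt0 lv _ a0.
rewrite /amplitude !Normc.normcM normc_psi mulr1 normc_real ger0_norm//.
by rewrite invr_ge0 ltW.
Qed.

Lemma measurable_v1 : measurable_fun D (fun p : P => v p.1).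
Proof.
apply: (@measurable_funS _ _ P R setT) => //.
by apply: (measurableT_comp (measurable_lav lv)); exact: measurable_fst.
Qed.

Lemma cplx_measurable_amplitude (f : induced_rep v sigma) :
  cplx_measurable D (amplitude f).
Proof.
have mD := measurable_R_domain.
apply: cplx_measurableM; last first.
  apply: cplx_measurable_real.
  rewrite (_ : (fun p => _) = fun p : P => v p.1 `^ (- 1)).
    by apply: (measurableT_comp (measurable_powR (- 1))); exact: measurable_v1.
  by apply/funext => p; rewrite powR_inv1// (lav_ge0 lv).
apply: cplx_measurableM.
  apply: (cplx_measurable_on_R (h := fun g => f (w1 K hn *m g))) => g ug.
  apply: (@continuous_comp _ _ _ (fun g : M => w1 K hn *m g) (f : M -> cplx R)).
    by apply: (@continuous_mulmxK K n _ (fun=> w1 K hn) id g); [exact: cst_continuous|exact: cvg_id].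
  by apply: induced_continuous; rewrite unitmx_mul w1_unit.
apply: (cplx_measurable_on_R (h := fun g => psi (- superdiag_sum g))) => g ug.
have cs : {for g, continuous superdiag_sum}.
  apply: continuous_sumK => i.
  rewrite (_ : (fun t : M => _) = fun t : M =>
     \sum_(j <- [seq j : 'I_n <- index_enum 'I_n | j == i.+1 :> nat]) t i j).
    by apply: continuous_sumK => j; exact: continuous_mx_entry.
  by apply/funext => t; rewrite big_filter.
apply: (@continuous_comp _ _ _ (fun g => - superdiag_sum g) psi); last by case: hpsi => H _ _ _; exact: H.
exact: (@continuous_comp _ _ _ superdiag_sum (@GRing.opp K) g cs (@opp_continuous K _)).
Qed.

End Integrand.

(** * Absolute convergence *)
Section ProductBounds.
Context (R : realType) d1 d2 (T1 : measurableType d1) (T2 : measurableType d2).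

Lemma ge0_integral_product_le (m1 : {sigma_finite_measure set T1 -> \bar R})
    (m2 : {sigma_finite_measure set T2 -> \bar R}) (E : set (T1 * T2))
    (f : T1 * T2 -> \bar R) (h : T1 -> \bar R) :
  measurable E -> measurable_fun E f -> (forall p, (0 <= f p)%E) ->
  measurable_fun setT h ->
  (forall a, (\int[m2]_x (f \_ E) (a, x) <= h a)%E) ->
  (\int[(m1 \x m2)%E]_(p in E) f p <= \int[m1]_a h a)%E.
Proof.
move=> mE mf f0 mh fh.
have mg : measurable_fun setT (f \_ E) by apply/(measurable_restrictT f mE).
have g0 p : (0 <= (f \_ E) p)%E by rewrite patchE; case: ifP.
rewrite integral_mkcond fubini_tonelli1//; apply: ge0_le_integral => //.
- by move=> a _; exact: integral_ge0.
- exact: measurable_fun_fubini_tonelli_F.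
- by move=> a _; exact: fh.
Qed.

Lemma ge0_integral_dominated_by (m2 : {measure set T2 -> \bar R}) (g W : T2 -> \bar R)
    (c w : R) : measurable_fun setT g -> measurable_fun setT W ->
  (forall x, (0 <= g x)%E) -> (forall x, (0 <= W x)%E) -> 0 <= c ->
  (forall x, (g x <= c%:E * W x)%E) -> (\int[m2]_x W x <= w%:E)%E ->
  (\int[m2]_x g x <= (c * w)%:E)%E.
Proof.
move=> mg mW g0 W0 c0 gW Ww; rewrite EFinM.
apply: (@le_trans _ _ (\int[m2]_x (c%:E * W x))%E).
  apply: ge0_le_integral => //.
  by apply: emeasurable_funM => //; exact: measurable_cst.
by rewrite ge0_integralZl//; apply: lee_wpmul2l.
Qed.

End ProductBounds.

Section LambdaBound.
Context (R : realType) (K : localFieldType) (v : K -> R).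
Hypothesis lv : local_absval v.
Context (psi : K -> cplx R).
Hypothesis hpsi : nontrivial_unitary_character psi.
Context (mu : {sigma_finite_measure set (borel K) -> \bar R}).
Hypothesis hmu : haar_measure mu.
Context (n : nat) (hn : (2 <= n)%N) (sigma : 'I_n -> K -> cplx R) (nu : 'I_n -> R).
Hypothesis hsigma : forall i x, x != 0 -> Normc.normc (sigma i x) = v x `^ nu i.
Hypothesis hnu : forall i j : nat, (i < j < n)%N -> (1 < j)%N -> nat_nu nu i < nat_nu nu j.
Local Notation M := 'M[K]_n.
Local Notation N := #|R_coords hn|.
Local Notation P := (borel K * N.-tuple (borel K))%type.
Local Notation D := (R_domain (K := K) hn).
Local Notation I := (induced_rep v sigma).

(** The unipotent integral leaves, as a function of [a], a product of powers of
    [v a] and [max 1 (v a)^-1]. It is integrable at infinity because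
    [x < 1 - nu_1] and at [0] because [x > - nu_2]. *)
Lemma amplitude_integral_bound : exists Q : set M,
  [/\ compact_unitmx Q, Q !=set0 &
   forall x : R, - nu (idx2 hn) < x < 1 - nu (idx1 hn) -> exists2 C : R, 0 <= C &
   forall f : I, (\int[R_measure mu hn]_(p in D)
      (Normc.normc (amplitude v psi f p) * v p.1 `^ (x - (n%:R - 1) / 2))%:E <=
     (C * sup_norm Q f)%:E)%E].
Proof.
have [Q [cQ Q0 HQ]] := induced_weight_bound lv hn hsigma.
exists Q; split => // x /andP[x1 x2].
pose t := twisted_exponent n (nat_nu nu).
have [C C0 HC] := integral_unsheared lv hmu hn hnu.
pose e := x + nu (idx1 hn) - 2; pose e' := nu (idx1 hn) - nu (idx2 hn) - 1.
pose b (a : borel K) := v a `^ e * Num.max 1 (v a)^-1 `^ e'.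
have b0 a : 0 <= b a by rewrite mulr_ge0 ?powR_ge0.
have mb : measurable_fun setT b.
  apply: measurable_funM; apply: (measurableT_comp (measurable_powR _)).
    exact: measurable_lav.
  apply: measurable_maxr; first exact: measurable_cst.
  rewrite (_ : (fun a => _) = fun a : borel K => v a `^ (- 1)).
    by apply: (measurableT_comp (measurable_powR (- 1))); exact: measurable_lav.
  by apply/funext => a; rewrite powR_inv1// (lav_ge0 lv).
have bfin : (\int[mu]_a (b a)%:E < +oo)%E.
  apply: (integral_powR_lty lv hmu).
    by rewrite /e; lra.
  by rewrite /e /e'; lra.
pose B := fine (\int[mu]_a (b a)%:E)%E.
have BE : (\int[mu]_a (b a)%:E = B%:E)%E.
  by rewrite fineK// ge0_fin_numE//; apply: integral_ge0 => a _; rewrite lee_fin.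
have B0 : 0 <= B by apply: fine_ge0; apply: integral_ge0 => a _; rewrite lee_fin.
exists (C * B); first exact: mulr_ge0.
move=> f; set S := sup_norm Q f.
have S0 : 0 <= S by exact: sup_norm_ge0.
apply: (@le_trans _ _ (\int[mu]_a ((C * S)%:E * (b a)%:E))%E); last first.
  rewrite ge0_integralZl//; last 3 first.
  - exact/measurable_EFinP.
  - by move=> a _; rewrite lee_fin.
  - by rewrite lee_fin mulr_ge0.
  by rewrite BE -EFinM lee_fin mulrAC.
have mF : measurable_fun D (fun p : P =>
    (Normc.normc (amplitude v psi f p) * v p.1 `^ (x - (n%:R - 1) / 2))%:E).
  apply/measurable_EFinP; apply: measurable_funM.
    exact: (measurable_normc (cplx_measurable_amplitude lv hpsi hn f)).
  by apply: (measurableT_comp (measurable_powR _)); exact: measurable_v1.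
have mD := @measurable_R_domain K n hn.
apply: ge0_integral_product_le => //.
- by move=> p; rewrite lee_fin mulr_ge0 ?normc_ge0 ?powR_ge0.
- apply: emeasurable_funM; first exact: measurable_cst.
  exact/measurable_EFinP.
move=> a; set F := (F in F \_ D).
have [a0|a0] := eqVneq (a : K) 0.
  rewrite integral0_eq => [|y _]; first by rewrite -EFinM lee_fin; exact: mulr_ge0 (mulr_ge0 C0 S0) (b0 a).
  by rewrite patchE memNset// /R_domain /= a0 eqxx.
have va : 0 < v a by exact: lav_gt0 lv _ a0.
pose p := x - (n%:R - 1) / 2 - 1.
pose W (y : N.-tuple (borel K)) := (weight v n n 0 t (sheared_mx n a y))%:E.
have intW : (\int[power_measure mu N]_y W y <=
    (C * (v a `^ (t 0%N + n%:R - 2) * Num.max 1 (v a)^-1 `^ (t 0%N - t 1%N)))%:E)%E.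
  apply: le_trans (HC a a0).
  exact: (integral_sheared lv hmu hn (nat_nu nu) n a0).
have -> : ((C * S)%:E * (b a)%:E)%E = (S * v a `^ p *
    (C * (v a `^ (t 0%N + n%:R - 2) * Num.max 1 (v a)^-1 `^ (t 0%N - t 1%N))))%:E.
  rewrite -EFinM; congr (_%:E).
  have -> : b a = v a `^ p * (v a `^ (t 0%N + n%:R - 2) *
      Num.max 1 (v a)^-1 `^ (t 0%N - t 1%N)).
    rewrite mulrA -powR_gt0D// /b; congr (_ `^ _ * _ `^ _).
      by rewrite /e /p /t /twisted_exponent (nat_nu_ord nu (idx1 hn)); field.
    rewrite /e' /t /twisted_exponent (nat_nu_ord nu (idx1 hn)) (nat_nu_ord nu (idx2 hn)).
    by field.
  by ring.
apply: (@ge0_integral_dominated_by R _ (N.-tuple (borel K)) (power_measure mu N) _ W) => //.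
- apply: (measurableT_comp (f := F \_ D)); last exact: pair1_measurable.
  exact/(measurable_restrictT F mD).
- apply/measurable_EFinP; apply: (measurable_weight lv) => // r c.
  by apply: measurable_sheared_mx; exact: lv.
- move=> y; rewrite patchE; case: ifP => // _.
  by rewrite lee_fin mulr_ge0 ?normc_ge0 ?powR_ge0.
- by move=> y; rewrite lee_fin weight_ge0.
- by rewrite mulr_ge0 ?powR_ge0.
- move=> y; rewrite patchE mem_set//.
  rewrite /F normc_amplitude// -EFinM lee_fin /= -mulrA.
  have -> : (v a)^-1 * v a `^ (x - (n%:R - 1) / 2) = v a `^ p.
    by rewrite -powR_inv1 ?(ltW va)// -powR_gt0D//; congr (_ `^ _); rewrite /p addrC.
  rewrite -mulrA [v a `^ p * _]mulrC mulrA ler_wpM2r ?powR_ge0//.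
  exact: HQ.
Qed.
End LambdaBound.

(** * Mellin integrals *)
Section MellinIntegral.
Context (R : realType) d (T : measurableType d) (mu : {measure set T -> \bar R}).
Context (D : set T) (mD : measurable D) (r : T -> R) (A : T -> cplx R).
Hypothesis mr : measurable_fun D r.
Hypothesis r0 : forall x, D x -> 0 < r x.
Hypothesis mA : cplx_measurable D A.
Context (y1 y2 : R).
Hypothesis moment : forall y, y1 < y < y2 ->
  (\int[mu]_(x in D) (Normc.normc (A x) * r x `^ y)%:E < +oo)%E.

Let F s x := A x * cpow (r x) s.

Lemma cplx_measurable_cpow s : cplx_measurable D (fun x => cpow (r x) s).
Proof.
have ml : measurable_fun D (fun x => complex.Im s * ln (r x)).
  by apply: measurable_funM; [exact: measurable_cst|exact: (measurableT_comp (@measurable_ln R))].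
have mp : measurable_fun D (fun x => r x `^ complex.Re s).
  exact: (measurableT_comp (measurable_powR _)).
split; apply: measurable_funM => //.
  apply: measurableT_comp ml; apply: continuous_measurable_fun; exact: continuous_cos.
apply: measurableT_comp ml; apply: continuous_measurable_fun; exact: continuous_sin.
Qed.

Lemma mellin_measurable s : cplx_measurable D (F s).
Proof. exact: cplx_measurableM mA (cplx_measurable_cpow s). Qed.

Lemma normc_mellin s x : D x ->
  Normc.normc (F s x) = Normc.normc (A x) * r x `^ complex.Re s.
Proof. by move=> Dx; rewrite Normc.normcM normc_cpow// r0. Qed.

Lemma moment_measurable y :
  measurable_fun D (fun x => Normc.normc (A x) * r x `^ y).
Proof.
apply: measurable_funM; first exact: measurable_normc.
exact: (measurableT_comp (measurable_powR _)).
Qed.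

Lemma mellin_integrable s : y1 < complex.Re s < y2 -> cplx_integrable mu D (F s).
Proof.
move=> /moment; apply: cplx_integrable_le => //.
- exact: mellin_measurable.
- exact: moment_measurable.
- by move=> x Dx; rewrite normc_mellin.
Qed.

(** Differentiation under the integral sign with an explicit remainder: the
    Taylor remainder of the power is bounded by [|h| ^ 2] times two moments of
    neighbouring exponents, which are finite because the strip is open. The same
    estimate gives the derivative and continuity. *)
Lemma mellin_second_order s : y1 < complex.Re s < y2 ->
  exists (L : cplx R) (C e : R), [/\ 0 <= C, 0 < e & forall h, Normc.normc h <= e ->
    Normc.normc (cintegral mu D (F (s + h)) - cintegral mu D (F s) - h * L) <=
    C * Normc.normc h ^+ 2].
Proof.
move=> /andP[s1 s2]; set y := complex.Re s in s1 s2 *.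
(* the moments at distance [2 * e] and the shifts by at most [e] stay in the strip *)
pose e := Num.min (y - y1) (y2 - y) / 3.
have e0 : 0 < e by rewrite divr_gt0// lt_min !subr_gt0 s1.
have e1 : y1 + 3 * e <= y.
  by rewrite -lerBrDl [3 * e]mulrC /e divfK// ge_min lexx.
have e2 : y + 3 * e <= y2.
  by rewrite -lerBrDl [3 * e]mulrC /e divfK// ge_min lexx orbT.
pose H x := Normc.normc (A x) * r x `^ (y + 2 * e) + Normc.normc (A x) * r x `^ (y - 2 * e).
have mH : measurable_fun D H by apply: measurable_funD; exact: moment_measurable.
have HE x : D x -> Normc.normc (A x) * r x `^ y * (r x `^ (2 * e) + r x `^ (- (2 * e))) = H x.
  by move=> Dx; rewrite /H !powR_gt0D ?r0// mulrDr !mulrA.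
have H0 x : 0 <= H x by rewrite addr_ge0 ?mulr_ge0 ?normc_ge0 ?powR_ge0.
have iH : (\int[mu]_(x in D) (H x)%:E < +oo)%E.
  under eq_integral do rewrite EFinD.
  rewrite ge0_integralD//.
  - by apply: lte_add_pinfty; apply: moment; lra.
  - by move=> x _; rewrite lee_fin mulr_ge0 ?normc_ge0 ?powR_ge0.
  - by apply/measurable_EFinP; exact: moment_measurable.
  - by move=> x _; rewrite lee_fin mulr_ge0 ?normc_ge0 ?powR_ge0.
  - by apply/measurable_EFinP; exact: moment_measurable.
have ikH k : 0 <= k -> (\int[mu]_(x in D) (k * H x)%:E = (k * fine (\int[mu]_(x in D) (H x)%:E)%E)%:E)%E.
  move=> k0; rewrite EFinM fineK; last first.
    by rewrite ge0_fin_numE//; apply: integral_ge0 => x _; rewrite lee_fin.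
  under eq_integral do rewrite EFinM.
  rewrite ge0_integralZl//; first exact/measurable_EFinP.
  by move=> x _; rewrite lee_fin.
pose F1 x := F s x * (ln (r x))%:C%C.
have mF1 : cplx_measurable D F1.
  apply: cplx_measurableM; first exact: mellin_measurable.
  by apply: cplx_measurable_real; exact: (measurableT_comp (@measurable_ln R)).
have k0 : 0 <= (2 * e)^-1 by rewrite invr_ge0 mulr_ge0// ltW.
have iF1 : cplx_integrable mu D F1.
  apply: (@cplx_integrable_le _ _ _ _ _ mD F1 (fun x => (2 * e)^-1 * H x)) => //.
  - by apply: measurable_funM => //; exact: measurable_cst.
  - move=> x Dx; rewrite /F1 Normc.normcM normc_mellin// normc_real -HE// mulrCA.
    by rewrite ler_wpM2l ?mulr_ge0 ?normc_ge0 ?powR_ge0// norm_ln_le// r0.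
  by rewrite ikH// ltry.
pose k := 8 / e ^+ 2.
have k'0 : 0 <= k by rewrite divr_ge0// sqr_ge0.
pose B := fine (\int[mu]_(x in D) (H x)%:E)%E.
have B0 : 0 <= B by apply: fine_ge0; apply: integral_ge0 => x _; rewrite lee_fin.
exists (cintegral mu D F1), (2 * (k * B)), e; split => //.
  exact: mulr_ge0 (mulr_ge0 k'0 B0).
move=> h he.
have sh : y1 < complex.Re (s + h) < y2.
  have -> : complex.Re (s + h) = y + complex.Re h by rewrite /y; case: (s) (h) => ? ? [].
  have := le_trans (normc_ge_Re h) he; rewrite ler_norml => /andP[h1 h2].
  by apply/andP; split; lra.
have iFs : cplx_integrable mu D (F s) by apply: mellin_integrable; rewrite s1.
have iFh := mellin_integrable sh.
have iG := cplx_integrableZD mD (- 1) iFs iFh.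
have EG := cintegralZD mD (- 1) iFs iFh.
have iE := cplx_integrableZD mD (- h) iF1 iG.
have EE := cintegralZD mD (- h) iF1 iG.
have -> : cintegral mu D (F (s + h)) - cintegral mu D (F s) - h * cintegral mu D F1 =
    cintegral mu D (fun x => - h * F1 x + (- 1 * F s x + F (s + h) x)).
  by rewrite EE EG; ring.
have -> : 2 * (k * B) * Normc.normc h ^+ 2 = 2 * (Normc.normc h ^+ 2 * k * B) by ring.
apply: (normc_cintegral_le mD iE).
have kh0 : 0 <= Normc.normc h ^+ 2 * k by exact: mulr_ge0 (sqr_ge0 _) k'0.
rewrite /B -(ikH _ kh0).
apply: ge0_le_integral => //.
- by move=> x _; rewrite lee_fin normc_ge0.
- apply/measurable_EFinP; apply: measurable_normc.
  by have /cplx_integrableP[] := iE.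
- by apply/measurable_EFinP; apply: measurable_funM => //; exact: measurable_cst.
move=> x Dx; rewrite lee_fin.
have -> : - h * F1 x + (- 1 * F s x + F (s + h) x) =
    F s x * (cpow (r x) h - 1 - h * (ln (r x))%:C%C).
  by rewrite /F1 /F cpowD ?r0//; ring.
rewrite Normc.normcM normc_mellin// -HE// [leRHS]mulrCA.
rewrite ler_wpM2l ?mulr_ge0 ?normc_ge0 ?powR_ge0// -mulrA.
by apply: cpow_estimate => //; exact: r0.
Qed.

End MellinIntegral.

(** * The functional as a Mellin integral *)
Section LambdaFunctional.
Context (R : realType) (K : localFieldType) (v : K -> R).
Hypothesis lv : local_absval v.
Context (psi : K -> cplx R).
Hypothesis hpsi : nontrivial_unitary_character psi.
Context (mu : {sigma_finite_measure set (borel K) -> \bar R}).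
Hypothesis hmu : haar_measure mu.
Context (n : nat) (hn : (2 <= n)%N) (sigma : 'I_n -> K -> cplx R) (nu : 'I_n -> R).
Hypothesis hsigma : forall i x, x != 0 -> Normc.normc (sigma i x) = v x `^ nu i.
Hypothesis hnu : forall i j : nat, (i < j < n)%N -> (1 < j)%N -> nat_nu nu i < nat_nu nu j.
Local Notation M := 'M[K]_n.
Local Notation D := (R_domain (K := K) hn).
Local Notation I := (induced_rep v sigma).
Local Notation c := ((n%:R - 1) / 2).
Local Notation Lam s f := (Lambda v psi mu hn s f).

Lemma Re_sub_shift (s : cplx R) : complex.Re (s - c) = complex.Re s - c.
Proof.
have -> : c = (c : R)%:C%C :> cplx R by rewrite rmorphM rmorphB fmorphV !rmorph_nat rmorph1.
by case: s.
Qed.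

Lemma Lambda_mellin s (f : I) : Lam s f = cintegral (R_measure mu hn) D
  (fun p => amplitude v psi f p * cpow (v p.1) (s - c)).
Proof.
by apply: eq_cintegral => p /set_mem Dp; rewrite (Lambda_integrandE lv hpsi).
Qed.

Lemma amplitudeZD (a : cplx R) (f h : I) p :
  amplitude v psi (a *: f + h) p = a * amplitude v psi f p + amplitude (hn := hn) v psi h p.
Proof.
by rewrite /amplitude [induced_fun _ _](_ : _ = a * f (w1 K hn *m R_elt p.1 p.2) +
  h (w1 K hn *m R_elt p.1 p.2))//; ring.
Qed.

Lemma v1_gt0 p : D p -> 0 < v p.1.
Proof. by rewrite /R_domain /= => /(lav_gt0 lv). Qed.

Definition vertical_strip : set (cplx R) :=
  [set s | - nu (idx2 hn) < complex.Re s < 1 - nu (idx1 hn)].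

Lemma amplitude_moment (f : I) (y : R) :
  - nu (idx2 hn) - c < y < 1 - nu (idx1 hn) - c ->
  (\int[R_measure mu hn]_(p in D)
     (Normc.normc (amplitude v psi f p) * v p.1 `^ y)%:E < +oo)%E.
Proof.
move=> yc; have [Q [_ _ HQ]] := amplitude_integral_bound lv hpsi hmu hn hsigma hnu.
have yc' : - nu (idx2 hn) < y + c < 1 - nu (idx1 hn) by case/andP: yc => h1 h2; apply/andP; split; lra.
have [C _ HC] := HQ _ yc'.
by have := HC f; rewrite addrK => /le_lt_trans; apply; exact: ltry.
Qed.

Lemma strip_shift (s : cplx R) : vertical_strip s ->
  - nu (idx2 hn) - c < complex.Re (s - c) < 1 - nu (idx1 hn) - c.
Proof. by move=> Os; rewrite Re_sub_shift !ltrD2r. Qed.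

Lemma Lambda_mellin_integrable s (f : I) : vertical_strip s ->
  cplx_integrable (R_measure mu hn) D
    (fun p => amplitude v psi f p * cpow (v p.1) (s - c)).
Proof.
move=> /strip_shift; apply: mellin_integrable.
- exact: measurable_R_domain.
- exact: measurable_v1.
- exact: v1_gt0.
- exact: cplx_measurable_amplitude.
- exact: amplitude_moment.
Qed.

Lemma Lambda_integrable s (f : I) : vertical_strip s ->
  cplx_integrable (R_measure mu hn) D (Lambda_integrand v psi hn s f).
Proof.
move=> /(Lambda_mellin_integrable f) /cplx_integrableP[mF iF].
apply/cplx_integrableP; split.
  by apply: cplx_measurable_eq mF => p /set_mem Dp; rewrite (Lambda_integrandE lv hpsi).
rewrite (eq_integral (fun p => (Normc.normc (amplitude v psi f p * cpow (v p.1) (s - c)))%:E))//.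
by move=> p /set_mem Dp; rewrite (Lambda_integrandE lv hpsi).
Qed.

Lemma Lambda_linear s (a : cplx R) (f h : I) : vertical_strip s ->
  Lam s (a *: f + h : I) = a * Lam s f + Lam s h.
Proof.
move=> Os; rewrite !Lambda_mellin.
rewrite -(cintegralZD (@measurable_R_domain K n hn) a
  (Lambda_mellin_integrable f Os) (Lambda_mellin_integrable h Os)).
by apply: eq_cintegral => p _; rewrite amplitudeZD; ring.
Qed.

Lemma Lambda_second_order s (f : I) : vertical_strip s ->
  exists (L : cplx R) (C e : R), [/\ 0 <= C, 0 < e & forall h, Normc.normc h <= e ->
    Normc.normc (Lam (s + h) f - Lam s f - h * L) <= C * Normc.normc h ^+ 2].
Proof.
move=> Os.
have [L [C [e [C0 e0 H]]]] := mellin_second_order (@measurable_R_domain K n hn)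
  (@measurable_v1 R K v lv n hn) v1_gt0 (cplx_measurable_amplitude lv hpsi hn f)
  (amplitude_moment f) (strip_shift Os).
exists L, C, e; split => // h he; rewrite !Lambda_mellin.
by rewrite [s + h - c]addrAC; exact: H.
Qed.

(** Between [x1] and [x2] a real power is at most the sum of the powers at the
    two ends, which makes the bound uniform in [s]. *)
Lemma Lambda_bound : exists Q : set M, [/\ compact_unitmx Q, Q !=set0 &
  forall x1 x2 : R, - nu (idx2 hn) < x1 < 1 - nu (idx1 hn) ->
    - nu (idx2 hn) < x2 < 1 - nu (idx1 hn) -> exists2 C : R, 0 <= C &
  forall s (f : I), x1 <= complex.Re s <= x2 ->
    Normc.normc (Lam s f) <= C * sup_norm Q f].
Proof.
have [Q [cQ Q0 HQ]] := amplitude_integral_bound lv hpsi hmu hn hsigma hnu.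
exists Q; split => // x1 x2 i1 i2.
have [C1 C10 H1] := HQ _ i1; have [C2 C20 H2] := HQ _ i2.
exists (2 * (C1 + C2)); first by rewrite mulr_ge0 ?addr_ge0.
move=> s f /andP[s1 s2].
have Os : vertical_strip s.
  by case/andP: i1 => i1 _; case/andP: i2 => _ i2; apply/andP; split; lra.
have iF := Lambda_mellin_integrable f Os.
rewrite Lambda_mellin -mulrA.
have mD := @measurable_R_domain K n hn.
apply: (normc_cintegral_le mD iF).
have mY y : measurable_fun D (fun p =>
    (Normc.normc (amplitude v psi f p) * v p.1 `^ (y - c))%:E).
  apply/measurable_EFinP; apply: moment_measurable; first exact: measurable_v1.
  exact: cplx_measurable_amplitude.
apply: le_trans (_ : _ <= \int[R_measure mu hn]_(p in D)
  ((Normc.normc (amplitude v psi f p) * v p.1 `^ (x1 - c))%:E +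
   (Normc.normc (amplitude v psi f p) * v p.1 `^ (x2 - c))%:E))%E _; last first.
  rewrite ge0_integralD//.
  - by rewrite [(C1 + C2) * _]mulrDl EFinD; apply: leeD; [exact: H1|exact: H2].
  - by move=> p _; rewrite lee_fin mulr_ge0 ?normc_ge0 ?powR_ge0.
  - by move=> p _; rewrite lee_fin mulr_ge0 ?normc_ge0 ?powR_ge0.
apply: ge0_le_integral => //.
- by move=> p _; rewrite lee_fin normc_ge0.
- have /cplx_integrableP[mF _] := iF.
  by apply/measurable_EFinP; exact: measurable_normc.
- exact: emeasurable_funD.
move=> p Dp; rewrite -EFinD lee_fin Normc.normcM normc_cpow ?v1_gt0// -mulrDr.
rewrite ler_wpM2l ?normc_ge0// Re_sub_shift.
have [v1|v1] := leP 1 (v p.1).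
  by rewrite (le_trans (ler_powR v1 (lerB s2 (lexx c))))// lerDr powR_ge0.
rewrite -[leLHS]addr0 lerD ?powR_ge0//.
by rewrite ger_powR ?lerB// v1_gt0//= ltW.
Qed.

End LambdaFunctional.

(** * Holomorphy and joint continuity *)
Section ComplexDerivative.
Context (R : realType).

Lemma derivable_second_order (F : cplx R -> cplx R) (s L : cplx R) (C e : R) :
  0 <= C -> 0 < e ->
  (forall h, Normc.normc h <= e ->
    Normc.normc (F (s + h) - F s - h * L) <= C * Normc.normc h ^+ 2) ->
  derivable F s 1.
Proof.
move=> C0 e0 H; apply/cvg_ex; exists L; apply/cvg_cplxP => eps eps0.
rewrite /dnbhs /within /=; apply/(@nbhs_cplxP R 0).
have C1 : 0 < C + 1 by lra.
exists (Num.min e (eps / (C + 1))); first by rewrite lt_min e0 divr_gt0.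
move=> h; rewrite subr0 lt_min => /andP[he heps] h0.
have nh : 0 < Normc.normc h.
  by rewrite lt_def normc_ge0 andbT; apply: contraNneq h0 => /Normc.eq0_normc ->.
have -> : h^-1 *: ((F \o shift s) (h *: (1 : cplx R)) - F s) - L =
    h^-1 * (F (s + h) - F s - h * L).
  rewrite /= [h *: 1](_ : _ = h); last exact: mulr1.
  rewrite [_ *: _](_ : _ = h^-1 * (F (h + s) - F s))// [s + h]addrC.
  by rewrite [in RHS]mulrBr mulKf.
rewrite Normc.normcM Normc.normcV ltr_pdivrMl//.
apply: le_lt_trans (H _ (ltW he)) _.
rewrite expr2 mulrA mulrC ltr_pM2l//.
apply: (@le_lt_trans _ _ ((C + 1) * Normc.normc h)).
  by rewrite ler_wpM2r ?normc_ge0// lerDl.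
by rewrite mulrC -ltr_pdivlMr.
Qed.

End ComplexDerivative.

Section LambdaContinuity.
Context (R : realType) (K : localFieldType) (v : K -> R).
Hypothesis lv : local_absval v.
Context (psi : K -> cplx R).
Hypothesis hpsi : nontrivial_unitary_character psi.
Context (mu : {sigma_finite_measure set (borel K) -> \bar R}).
Hypothesis hmu : haar_measure mu.
Context (n : nat) (hn : (2 <= n)%N) (sigma : 'I_n -> K -> cplx R) (nu : 'I_n -> R).
Hypothesis hsigma : forall i x, x != 0 -> Normc.normc (sigma i x) = v x `^ nu i.
Hypothesis hnu : forall i j : nat, (i < j < n)%N -> (1 < j)%N -> nat_nu nu i < nat_nu nu j.
Local Notation M := 'M[K]_n.
Local Notation I := (induced_rep v sigma).
Local Notation Lam s f := (Lambda v psi mu hn s f).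
Local Notation Omega := (vertical_strip hn nu).

Lemma nbhs_sup_norm (Q : set M) (f : I) (d : R) : compact_unitmx Q -> Q !=set0 ->
  0 < d -> nbhs f [set h : I | sup_norm Q (h - f) < d].
Proof.
move=> cQ Q0 d0; apply: open_nbhs_nbhs; split; last first.
  rewrite /= subrr; apply: le_lt_trans d0.
  by apply: sup_norm_le => // q _; rewrite Normc.normc0.
move=> g /= gd; exists 1%N, (fun=> sup_norm Q), (d - sup_norm Q (g - f)); split.
- by rewrite subr_gt0.
- by move=> _; exact: sup_norm_defining.
move=> h /(_ ord0); rewrite ltrBrDr; apply: le_lt_trans.
by have := sup_normD (h - g) (g - f) cQ Q0; rewrite addrA subrK.
Qed.

(** The increment is split as
    [Lam s (f - f0) + (Lam s f0 - Lam s0 f0)]: the first term is controlled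
    uniformly in [s] by a seminorm of [f - f0], the second one by the expansion
    of second order in [s]. *)
Lemma Lambda_continuous : {within Omega `*` [set: I],
  continuous (fun p : cplx R * I => Lam p.1 p.2)}.
Proof.
apply/subspace_continuousP => -[s0 f0] [/= Os0 _].
apply/cvg_cplxP => eps eps0.
have [L [C [e [C0 e0 H]]]] := Lambda_second_order lv hpsi hmu hsigma hnu f0 Os0.
have [Q [cQ Q0 HQ]] := Lambda_bound lv hpsi hmu hn hsigma hnu.
case/andP: (Os0) => s1 s2; set y := complex.Re s0 in s1 s2.
(* the closed strip of half-width [d] around [s0] lies in the open one *)
pose d := Num.min (y + nu (idx2 hn)) (1 - nu (idx1 hn) - y) / 2.
have d0 : 0 < d by rewrite divr_gt0// lt_min; apply/andP; split; lra.
have [d1 d2] : 2 * d <= y + nu (idx2 hn) /\ 2 * d <= 1 - nu (idx1 hn) - y.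
  by rewrite [2 * d]mulrC /d divfK// !ge_min !lexx orbT.
have [B B0 HB] := HQ (y - d) (y + d) ltac:(apply/andP; split; lra)
  ltac:(apply/andP; split; lra).
have B1 : 0 < B + 1 by lra.
have L1 : 0 < Normc.normc L + C + 1 by have := normc_ge0 L; lra.
pose e1 := Num.min (Num.min d e) (Num.min 1 (eps / 2 / (Normc.normc L + C + 1))).
have e10 : 0 < e1 by rewrite !lt_min d0 e0 ltr01 !divr_gt0.
pose e2 := eps / 2 / (B + 1).
have e20 : 0 < e2 by rewrite !divr_gt0.
exists ([set s | Normc.normc (s - s0) < e1], [set h : I | sup_norm Q (h - f0) < e2]) => /=.
  split; first by apply/nbhs_cplxP; exists e1.
  exact: nbhs_sup_norm.
move=> [s f] [/= se fe] [/= Os _].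
rewrite !lt_min in se; case/andP: se => /andP[sd se] /andP[s1' seps].
change (Normc.normc (Lam s f - Lam s0 f0) < eps).
have Ef : Lam s f - Lam s f0 = Lam s (f - f0 : I).
  have := Lambda_linear lv hpsi hmu hsigma hnu (- 1) f0 f Os.
  by rewrite scaleN1r mulN1r addrC => ->; rewrite addrC.
have -> : Lam s f - Lam s0 f0 = Lam s (f - f0 : I) + (Lam s f0 - Lam s0 f0).
  by rewrite -Ef addrA subrK.
rewrite [eps]splitr; apply: le_lt_trans (normc_triangle _ _) _; apply: ltrD.
  have Rs : y - d <= complex.Re s <= y + d.
    have := le_lt_trans (normc_ge_Re (s - s0)) sd.
    have -> : complex.Re (s - s0) = complex.Re s - y by rewrite /y; case: (s) (s0) => ? ? [].
    by rewrite ltr_norml => /andP[h1 h2]; apply/andP; split; lra.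
  apply: le_lt_trans (HB s _ Rs) _.
  apply: (@le_lt_trans _ _ ((B + 1) * sup_norm Q (f - f0))).
    by rewrite ler_wpM2r ?sup_norm_ge0// lerDl.
  by rewrite mulrC -ltr_pdivlMr.
set h := s - s0 in sd se s1' seps.
have -> : Lam s f0 - Lam s0 f0 = (Lam (s0 + h) f0 - Lam s0 f0 - h * L) + h * L.
  by rewrite subrK [s0 + h]addrC subrK.
have nh := normc_ge0 h; have nL := normc_ge0 L.
apply: le_lt_trans (normc_triangle _ _) _; rewrite Normc.normcM.
apply: (@le_lt_trans _ _ (Normc.normc h * (Normc.normc L + C + 1))); last by rewrite -ltr_pdivlMr.
have Hh := H h (ltW se).
have h2 : C * Normc.normc h ^+ 2 <= C * Normc.normc h.
  by rewrite ler_wpM2l// expr2 ler_piMl// ltW.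
nra.
Qed.

End LambdaContinuity.

Unset Implicit Arguments.
Set Strict Implicit.

Theorem theorem1p2 (R : realType) (K : localFieldType) (absK : K -> R)
  (psi : K -> cplx R) (mu : {sigma_finite_measure set (borel K) -> \bar R})
  (n : nat) (hn : (2 <= n)%N) (sigma : 'I_n -> K -> cplx R) (nu : 'I_n -> R)
  (habs : normalized_absval absK)
  (hpsi : nontrivial_unitary_character psi)
  (hmu : self_dual_haar_measure mu psi)
  (hsigma : forall i, mult_character (sigma i))
  (hnu : forall i x, x != 0 -> Normc.normc (sigma i x) = absK x `^ nu i)
  (hnu3 : forall j : 'I_n, j = 2%N :> nat ->
     Num.max (nu (idx1 hn)) (nu (idx2 hn)) < nu j)
  (hnuS : forall i j : 'I_n, (2 <= i)%N -> j = i.+1 :> nat -> nu i < nu j)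
  (hnu12 : nu (idx1 hn) < nu (idx2 hn) + 1) :
  let Omega : set (cplx R) :=
    [set s | - nu (idx2 hn) < complex.Re s < 1 - nu (idx1 hn)] in
  let Lam (s : cplx R) (f : induced_rep absK sigma) : cplx R :=
    Lambda absK psi mu hn s f in
  [/\ (forall s (f : induced_rep absK sigma), Omega s ->
         cplx_integrable (R_measure mu hn) (R_domain hn)
           (Lambda_integrand absK psi hn s f)),
      {within Omega `*` [set: induced_rep absK sigma],
         continuous (fun p : cplx R * induced_rep absK sigma => Lam p.1 p.2)},
      (forall (f : induced_rep absK sigma) s, Omega s -> derivable (Lam^~ f) s 1) &
      (forall s, Omega s -> forall (a : cplx R) (f h : induced_rep absK sigma),
         Lam s (a *: f + h) = a * Lam s f + Lam s h)].
Proof.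
move=> Omega Lam.
have lv := normalized_local_absval habs.
have [hm _] := hmu.
have incr := nat_nu_increasing hnu3 hnuS.
split.
- by move=> s f Os; exact: (Lambda_integrable lv hpsi hm hnu incr).
- exact: (Lambda_continuous lv hpsi hm hnu incr).
- move=> f s Os.
  have [L [C [e [C0 e0 H]]]] := Lambda_second_order lv hpsi hm hnu incr f Os.
  exact: (derivable_second_order C0 e0 H).
- by move=> s Os a f h; exact: (Lambda_linear lv hpsi hm hnu incr).
Qed.
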